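(* Let $r>0$, let $(\eta_n)$ be i.i.d. with density $\frac{r^r}{\Gamma(r)}x^{r-1}e^{-rx}$ ($x>0$), and let $\lambda_n=\ell(n)n^{-\gamma}$ with $\gamma>1/2$ and $\ell$ slowly varying at $\infty$, the sequence being positive and non-increasing with $\frac1r\sum_n\lambda_n^2=1$. Let $\sigma_M^2=\frac1r\sum_{n\ge M}\lambda_n^2$, $\tilde Y_M=\sigma_M^{-1}\sum_{n=M}^\infty\lambda_n(\eta_n-1)$ and $\kappa_{k,M}=\frac{(k-1)!}{r^{k-1}\sigma_M^k}\sum_{n\ge M}\lambda_n^k$. Then for each $N\ge2$, as $M\to\infty$, $$\mathrm P[\tilde Y_M\le x]=\Phi(x)-\phi(x)\left\{\sum_{\eta(N)}\left[\prod_{m=3}^N\frac1{k_m!}\left(\frac{\kappa_{m,M}}{m!}\right)^{k_m}\right]H_{\zeta(k_3,\dots,k_N)}(x)\right\}+O\!\left(M^{-\frac{N-1}2}\right),$$ where the $O(M^{-(N-1)/2})$ term is uniform in $x\in\mathbb{R}$.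
   Context: $\Phi,\phi$ are the standard normal CDF and density. $\eta(N)$ is the set of tuples of non-negative integers $(k_3,\dots,k_N)$ with $1\le k_3+2k_4+\dots+(N-2)k_N\le N-2$ (empty for $N=2$), and $\zeta(k_3,\dots,k_N)=3k_3+4k_4+\dots+Nk_N-1$. $H_k$ are the Hermite polynomials $H_0=1$, $H_k(x)=(-1)^ke^{x^2/2}\frac{d^k}{dx^k}e^{-x^2/2}$ (so $H_1=x$, $H_2=x^2-1$, $H_3=x^3-3x,\dots$). *)

(* Defs.v *)
From HB Require Import structures.
From mathcomp Require Import all_boot all_order all_algebra.
From mathcomp Require Import all_classical all_reals all_analysis.
Set Implicit Arguments. Unset Strict Implicit. Unset Printing Implicit Defensive.
Import Order.TTheory GRing.Theory Num.Theory.
Import numFieldNormedType.Exports.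
Local Open Scope classical_set_scope.
Local Open Scope ring_scope.

Section defs.
Variable R : realType.

(** real series starting at index [M]: limit of the partial sums
    \sum_(M <= n < K) f n as K -> oo (the value is [lim]'s default
    if the series diverges). *)
Definition tailsum (M : nat) (f : nat -> R) : R :=
  limn (fun K => \sum_(M <= n < K) f n).

Definition std_normal_pdf (x : R) : R :=
  expR (- (x ^+ 2) / 2) / Num.sqrt (pi *+ 2).

Definition std_normal_cdf (x : R) : R :=
  Rintegral lebesgue_measure `]-oo, x] std_normal_pdf.

Definition hermite (k : nat) (x : R) : R :=
  (-1) ^+ k * expR (x ^+ 2 / 2) *
  derive1n k (fun y : R => expR (- (y ^+ 2) / 2)) x.

Definition Gamma_fun (r : R) : R :=
  Rintegral lebesgue_measure `]0, +oo[ (fun x : R => x `^ (r - 1) * expR (- x)).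

Definition gamma_rr_pdf (r : R) (x : R) : R :=
  r `^ r / Gamma_fun r * x `^ (r - 1) * expR (- (r * x)).

Definition slowly_varying (l : R -> R) : Prop :=
  (exists a : R, measurable_fun `[a, +oo[ l /\ forall x, a <= x -> 0 < l x) /\
  forall t : R, 0 < t -> (l (t * x) / l x) @[x --> +oo] --> (1 : R).

End defs.

Section prob.
Variables (d : measure_display) (T : measurableType d) (R : realType).

Definition mutually_independent (P : probability T R) (X : nat -> T -> R) : Prop :=
  (forall n, measurable_fun setT (X n)) /\
  forall (s : seq nat) (B : nat -> set R), uniq s ->
    (forall i, measurable (B i)) ->
    P (\big[setI/setT]_(i <- s) (X i @^-1` B i)) =
    (\prod_(i <- s) P (X i @^-1` B i))%E.

Definition has_gamma_rr_law (P : probability T R) (r : R) (X : T -> R) : Prop :=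
  forall B : set R, measurable B ->
    P (X @^-1` B) =
    (\int[lebesgue_measure]_(x in B `&` `]0%R, +oo[) (gamma_rr_pdf r x)%:E)%E.
End prob.

(* Main.v *)
Require Import Defs.
From HB Require Import structures.
From mathcomp Require Import all_boot all_order all_algebra.
From mathcomp Require Import all_classical all_reals all_analysis.
From mathcomp Require Import measurable_realfun.
From mathcomp Require Import ring lra zify complex.
Set Implicit Arguments. Unset Strict Implicit. Unset Printing Implicit Defensive.
Import Order.TTheory GRing.Theory Num.Theory.
Import numFieldNormedType.Exports.
Local Open Scope classical_set_scope.
Local Open Scope ring_scope.

(** Since [lam] is regularly varying of index [- gam] with [gam > 1/2], the tail
    [sum_(n >= M) lam_n^2] is comparable to [M lam_M^2].  Hence the normalised weights
    [a_n = lam_n / (r sigma_M)], [n >= M], are at most [a_M], which is of exact order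
    [M^(-1/2)], and comparable to [a_M] for [M <= n < 2 M].  The characteristic function
    of [Ytilde_M] is the limit of [prod_n exp (r (log (1 - i a_n t)^-1 - i a_n t))].  For
    [a_M t] small, expanding the logarithm shows that it is [exp (- t^2 / 2)] times the
    exponential of the cumulant series, whose truncation is the Edgeworth polynomial; for
    larger [t] the [M] comparable factors make it smaller than any power of [a_M].
    Altogether the two transforms differ by at most [C a_M^(N-1) t / (1 + t^2)] for all
    [t > 0].  This bound is integrable against [dt / t], so that Fourier inversion,
    justified by Gaussian smoothing, turns it into a uniform bound between distribution
    functions; the transform of the Edgeworth polynomial is inverted by differentiating
    [int_0^oo sin (t x) / t exp (- t^2 / 2) dt]. *)

Import ComplexField.Normc.
Local Open Scope complex_scope.
Local Notation Re := complex.Re.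
Local Notation Im := complex.Im.
Local Notation "''i'" := ('i%C) : ring_scope.

(** * Calculus on the real line *)

Section derivatives.
Context {R : realType}.

Section composition.
Variables (g : R -> R) (x dg : R).
Hypothesis gd : is_derive x 1 g dg.

Lemma is_derive_ln_comp : 0 < g x -> is_derive x 1 (fun y => ln (g y)) (dg / g x).
Proof.
move=> g0; have hd := is_derive1_ln g0.
by apply: (is_derive_eq (is_derive1_comp hd gd)); rewrite mulrC.
Qed.

Lemma is_derive_expR_comp : is_derive x 1 (fun y => expR (g y)) (dg * expR (g x)).
Proof.
by apply: (is_derive_eq (is_derive1_comp (is_derive_expR _) gd)); rewrite mulrC.
Qed.

Lemma is_derive_exprn_comp n :
  is_derive x 1 (fun y : R => g y ^+ n) (n%:R * g x ^+ n.-1 * dg).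
Proof.
rewrite (_ : (fun y => _) = g ^+ n); last by apply/funext => y; rewrite exprfctE.
exact: (is_derive_eq (is_deriveX n gd)).
Qed.

Lemma is_derive_mull c : is_derive x 1 (fun y => c * g y) (c * dg).
Proof. exact: is_deriveZ. Qed.

Lemma is_derive_continuous : {for x, continuous g}.
Proof. by have [dx _] := gd; apply/differentiable_continuous/derivable1_diffP. Qed.

End composition.

Lemma is_derive_mull_id (c x : R) : is_derive x 1 (fun y => c * y) c.
Proof. by apply: (is_derive_eq (is_derive_mull (is_derive_id x 1) c)); rewrite mulr1. Qed.

Lemma is_derive_exprn n (x : R) :
  is_derive x 1 (fun y : R => y ^+ n) (n%:R * x ^+ n.-1).
Proof.
by apply: (is_derive_eq (is_derive_exprn_comp (is_derive_id x 1) n)); rewrite mulr1.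
Qed.

Section arithmetic.
Variables (f g : R -> R) (x df dg : R).
Hypotheses (fd : is_derive x 1 f df) (gd : is_derive x 1 g dg).

Lemma is_derive_addf : is_derive x 1 (fun y => f y + g y) (df + dg).
Proof. exact: is_deriveD. Qed.

Lemma is_derive_subf : is_derive x 1 (fun y => f y - g y) (df - dg).
Proof. exact: is_deriveB. Qed.

Lemma is_derive_mulf : is_derive x 1 (fun y => f y * g y) (f x * dg + g x * df).
Proof. exact: is_deriveM. Qed.

End arithmetic.

Lemma is_derive_ge0_le (g dg : R -> R) (a b : R) : a <= b ->
  (forall x, a <= x <= b -> is_derive x 1 g (dg x)) ->
  (forall x, a <= x <= b -> 0 <= dg x) -> g a <= g b.
Proof.
move=> ab gd dg0.
have [||c cab] := @MVT_segment R g dg a b ab.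
- by move=> x; rewrite in_itv /= => /andP[/ltW ax /ltW xb]; apply/gd/andP.
- apply: derivable_within_continuous => x; rewrite in_itv /= => xab.
  by have [] := gd x xab.
by rewrite -subr_ge0 => ->; rewrite mulr_ge0 ?subr_ge0 // dg0 // -in_itv.
Qed.

End derivatives.

Definition exp_trunc {F : fieldType} n (z : F) : F := \sum_(j < n) z ^+ j / j`!%:R.

Section exponential_bounds.
Context {R : realType}.
Implicit Types (x b : R) (p : {poly R}).

Lemma exp_trunc_le_expR n x : 0 <= x -> exp_trunc n x <= expR x.
Proof.
move=> x0; rewrite [leLHS](_ : _ = series (exp_coeff x) n).
  apply: nondecreasing_cvgn_le; last exact: is_cvg_series_exp_coeff.
  by apply: nondecreasing_series => k _ _; exact: exp_coeff_ge0.
by rewrite /series /= big_mkord; apply: eq_bigr.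
Qed.

Lemma exprn_fact_le_expR n x : 0 <= x -> x ^+ n / n`!%:R <= expR x.
Proof.
move=> x0; apply: le_trans (exp_trunc_le_expR n.+1 x0).
rewrite /exp_trunc big_ord_recr /= lerDr sumr_ge0 // => i _.
by rewrite divr_ge0 ?exprn_ge0.
Qed.

Lemma exprn_expRN_le n b x : 0 < b -> 0 <= x ->
  x ^+ n * expR (- (b * x)) <= n`!%:R / b ^+ n.
Proof.
move=> b0 x0; rewrite expRN ler_pdivrMr ?expR_gt0 // -ler_pdivrMl; last first.
  by rewrite divr_gt0 ?exprn_gt0 // ltr0n fact_gt0.
apply: le_trans (exprn_fact_le_expR n (mulr_ge0 (ltW b0) x0)).
by rewrite invf_div mulrAC exprMn.
Qed.

Lemma poly_expRN_bounded p b : 0 < b -> exists2 C : R, 0 <= C &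
  forall x, 0 <= x -> `|p.[x]| * expR (- (b * x)) <= C.
Proof.
move=> b0; exists (\sum_(i < size p) `|p`_i| * (i`!%:R / b ^+ i)) => [|x x0].
  by apply: sumr_ge0 => i _; rewrite mulr_ge0 // divr_ge0 // exprn_ge0 // ltW.
rewrite horner_coef (le_trans (ler_wpM2r (expR_ge0 _) (ler_norm_sum _ _ _))) //.
rewrite mulr_suml ler_sum // => i _; rewrite normrM [`|x ^+ i|]ger0_norm ?exprn_ge0 //.
by rewrite -mulrA ler_wpM2l // exprn_expRN_le.
Qed.

Lemma poly_gauss_bounded p b : 0 < b -> exists2 C : R, 0 <= C &
  forall x, 0 <= x -> `|p.[x]| * expR (- (b * x ^+ 2)) <= C.
Proof.
move=> b0; have [C C0 CP] := poly_expRN_bounded p b0.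
exists (expR b * C) => [|x x0]; first by rewrite mulr_ge0 ?expR_ge0.
apply: (@le_trans _ _ (`|p.[x]| * (expR b * expR (- (b * x))))); last first.
  by rewrite mulrCA ler_wpM2l ?expR_ge0 ?CP.
rewrite ler_wpM2l // -expRD ler_expR -subr_ge0.
rewrite (_ : _ - _ = b * ((x - 1) ^+ 2 + x)); last by ring.
by rewrite mulr_ge0 ?addr_ge0 ?sqr_ge0 // ltW.
Qed.

End exponential_bounds.

Section integrals.
Context (d : measure_display) (T : measurableType d) (R : realType).
Implicit Types (mu : {measure set T -> \bar R}) (D : set T).

Lemma integrable_measurable_fun mu D (f : T -> R) :
  mu.-integrable D (EFin \o f) -> measurable_fun D f.
Proof. by move=> /measurable_int/measurable_EFinP. Qed.

Lemma integrableZl_EFin mu D (f : T -> R) (k : R) : measurable D ->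
  mu.-integrable D (EFin \o f) -> mu.-integrable D (fun x => (k * f x)%:E).
Proof. by move=> mD fi; exact: (integrableZl mD k fi). Qed.

Lemma integrable_normr_le mu D (f g : T -> R) : measurable D ->
  measurable_fun D f -> (forall x, D x -> `|f x| <= g x) ->
  mu.-integrable D (EFin \o g) -> mu.-integrable D (EFin \o f).
Proof.
move=> mD mf fg; apply: le_integrable => //; first exact/measurable_EFinP.
by move=> x Dx; rewrite lee_fin (le_trans (fg _ Dx)) ?ler_norm.
Qed.

Lemma integrable_bounded (mu : {finite_measure set T -> \bar R}) (f : T -> R) (C : R) :
  measurable_fun setT f -> (forall x, `|f x| <= C) -> mu.-integrable setT (EFin \o f).
Proof.
move=> mf fC; apply: (@integrable_normr_le _ _ f (cst C)) => //.
exact: finite_measure_integrable_cst.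
Qed.

Lemma Rintegral_sum mu D (I : Type) (s : seq I) (h : I -> T -> R) : measurable D ->
  (forall i, mu.-integrable D (EFin \o h i)) ->
  \int[mu]_(x in D) (\sum_(i <- s) h i x) = \sum_(i <- s) \int[mu]_(x in D) h i x.
Proof.
move=> mD ih; elim: s => [|i s IH].
  rewrite big_nil (@eq_Rintegral _ _ _ _ _ (cst 0)) => [|x _]; last by rewrite big_nil.
  by rewrite /Rintegral integral0.
rewrite big_cons -IH -RintegralD //; last first.
  rewrite (_ : _ \o _ = fun x => (\sum_(i <- s) (h i x)%:E)%E); last first.
    by apply/funext => x; rewrite sumEFin.
  by apply: integrable_sum => // k _; exact: ih.
by apply: eq_Rintegral => x _; rewrite big_cons.
Qed.

Lemma cvg_integral_bigcup mu (F : (set T)^nat) (f : T -> \bar R) :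
  {homo F : n m / (n <= m)%N >-> (n <= m)%O} -> (forall n, measurable (F n)) ->
  mu.-integrable (\bigcup_n F n) f ->
  (\int[mu]_(x in F n) f x)%E @[n --> \oo] --> (\int[mu]_(x in \bigcup_n F n) f x)%E.
Proof.
move=> ndF mF fi; have mU : measurable (\bigcup_n F n) by exact: bigcupT_measurable.
have mfn (g : T -> \bar R) : measurable_fun (\bigcup_n F n) g ->
    forall n, measurable_fun (F n) g.
  by move=> mg n; apply: measurable_funS mg => //; exact: bigcup_sup.
rewrite [X in _ --> X]integralE; under eq_fun do rewrite integralE.
have /measurable_int mf := fi.
apply: cvgeB.
- by apply: fin_num_adde_defl; rewrite fin_numN; exact: integrable_neg_fin_num.
- apply: ge0_nondecreasing_set_cvg_integral => //.
  exact/mfn/measurable_funepos.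
- apply: ge0_nondecreasing_set_cvg_integral => //.
  exact/mfn/measurable_funeneg.
Qed.

End integrals.

Section improper_FTC.
Context {R : realType}.
Local Notation mu := (@lebesgue_measure R).
Variables (f F : R -> R) (a l0 l1 : R).
Hypotheses (dF : forall x, a < x -> is_derive x 1 F (f x))
           (cf : forall x, a < x -> {for x, continuous f})
           (F0 : F x @[x --> a^'+] --> l0) (F1 : F x @[x --> +oo] --> l1).

Let lo n : R := a + n.+1%:R^-1.
Let up n : R := a + n.+2%:R.

Let lt_lo n : a < lo n. Proof. by rewrite ltrDl invr_gt0. Qed.

Let lt_lo_up n : lo n < up n.
Proof. by rewrite ltrD2l (@le_lt_trans _ _ 1) ?ltr1n // invf_le1 // ler1n. Qed.

Let nondecreasing_block : {homo (fun n => `[lo n, up n]%classic) : n m / (n <= m)%N >-> (n <= m)%O}.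
Proof.
move=> n m nm; apply/subsetPset => x /=; rewrite !in_itv /= => /andP[nx xn].
rewrite (le_trans _ nx) ?lerD2l ?lef_pV2 ?posrE ?ler_nat //=.
by rewrite (le_trans xn) // lerD2l ler_nat.
Qed.

Let bigcup_block : \bigcup_n `[lo n, up n]%classic = `]a, +oo[%classic.
Proof.
apply/seteqP; split=> [x [n _] /=|x /=]; rewrite !in_itv /= andbT.
  by move=> /andP[+ _]; exact: lt_le_trans.
move=> ax; near \oo => n; exists n => //=; rewrite in_itv /=; apply/andP; split.
  rewrite -lerBrDl invf_ple ?posrE ?subr_gt0 // (@le_trans _ _ n%:R) ?ler_nat //.
  by near: n; exact: nbhs_infty_ger.
rewrite -lerBlDl (@le_trans _ _ n%:R) ?ler_nat ?(leq_trans (leqnSn n)) //.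
by near: n; exact: nbhs_infty_ger.
Unshelve. all: by end_near. Qed.

Let integral_block n : (\int[mu]_(x in `[lo n, up n]) (f x)%:E = (F (up n) - F (lo n))%:E)%E.
Proof.
have gta x : lo n <= x -> a < x by exact: lt_le_trans.
have dFx x : lo n <= x -> is_derive x 1 F (f x) by move=> /gta; exact: dF.
rewrite (@continuous_FTC2 _ f F) ?EFinB //.
- apply: continuous_in_subspaceT => x; rewrite inE /= in_itv /= => /andP[/gta ? _].
  exact: cf.
- split=> [x||].
  + by rewrite in_itv /= => /andP[/ltW /dFx[]].
  + by apply: cvg_at_right_filter; exact: is_derive_continuous (dFx _ (lexx _)).
  + by apply: cvg_at_left_filter; exact: is_derive_continuous (dFx _ (ltW (lt_lo_up n))).
- by move=> x; rewrite in_itv /= derive1E => /andP[/ltW /dFx[]].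
Qed.

Let cvg_integral_block :
  (\int[mu]_(x in `[lo n, up n]) (f x)%:E)%E @[n --> \oo] --> (l1 - l0)%:E.
Proof.
under eq_fun do rewrite integral_block.
apply: cvg_EFin; first exact: nearW.
apply: cvgB.
  move/cvg_pinftyP : F1; apply; apply/cvgryPge => A; near=> n.
  rewrite -lerBlDl (@le_trans _ _ n%:R) ?ler_nat ?(leq_trans (leqnSn n)) //.
  by near: n; exact: nbhs_infty_ger.
move/cvg_at_rightP : F0; apply; split=> //.
by rewrite -[X in _ --> X]addr0; apply: cvgD; [exact: cvg_cst|exact: cvg_harmonic].
Unshelve. all: by end_near. Qed.

Let measurable_Ioy : measurable_fun `]a, +oo[ (EFin \o f).
Proof.
apply/measurable_EFinP; apply: open_continuous_measurable_fun => //.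
by move=> x; rewrite inE /= in_itv /= andbT; exact: cf.
Qed.

Lemma ge0_integrable_derive_Ioy : (forall x, a < x -> 0 <= f x) ->
  mu.-integrable `]a, +oo[ (EFin \o f).
Proof.
move=> f0; apply/integrableP; split => //.
have -> : (\int[mu]_(x in `]a, +oo[) `|(EFin \o f) x| = \int[mu]_(x in `]a, +oo[) (f x)%:E)%E.
  apply: eq_integral => x; rewrite inE /= in_itv /= andbT => ax.
  by rewrite ger0_norm ?f0.
have h : (\int[mu]_(x in `[lo n, up n]) (f x)%:E)%E @[n --> \oo] -->
    (\int[mu]_(x in `]a, +oo[) (f x)%:E)%E.
  rewrite -bigcup_block; apply: ge0_nondecreasing_set_cvg_integral => // n.
    apply: measurable_funS measurable_Ioy => //; rewrite -bigcup_block.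
    by move=> x nx; exists n.
  by move=> x /=; rewrite in_itv /= => /andP[nx _]; rewrite lee_fin f0 // (lt_le_trans _ nx).
have -> : (\int[mu]_(x in `]a, +oo[) (f x)%:E = (l1 - l0)%:E)%E.
  exact: (cvg_unique (@ereal_hausdorff _) h cvg_integral_block).
exact: ltry.
Qed.

Lemma Rintegral_derive_Ioy : mu.-integrable `]a, +oo[ (EFin \o f) ->
  \int[mu]_(x in `]a, +oo[) f x = l1 - l0.
Proof.
move=> fi; have h : (\int[mu]_(x in `[lo n, up n]) (f x)%:E)%E @[n --> \oo] -->
    (\int[mu]_(x in `]a, +oo[) (f x)%:E)%E.
  by rewrite -bigcup_block; apply: cvg_integral_bigcup => //; rewrite bigcup_block.
by rewrite /Rintegral (cvg_unique (@ereal_hausdorff _) h cvg_integral_block).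
Qed.

End improper_FTC.

Section derivation_under_integral.
Context (R : realType) (d : measure_display) (T : measurableType d).
Variables (mu : {measure set T -> \bar R}) (D : set T) (f df : R -> T -> R) (G : T -> R).

Lemma is_derive_under_integral (t : R) : measurable D ->
  (forall x, mu.-integrable D (EFin \o f x)) ->
  (forall (x : R) y, D y -> is_derive x 1 (f ^~ y) (df x y)) ->
  mu.-integrable D (EFin \o G) ->
  (forall x y, D y -> `|df x y| <= G y) ->
  is_derive t 1 (fun x => \int[mu]_(y in D) f x y) (\int[mu]_(y in D) df t y).
Proof.
move=> mD fi fd Gi dfG.
have tI : `]t - 1, t + 1[%classic t by rewrite /= in_itv /= ltrBlDr ltrDl ltr01.
have derf x y : D y -> derivable (f ^~ y) x 1 by move=> /(fd x)[].
have partialE x y : D y -> partial1of2 f x y = df x y.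
  by rewrite partial1of2E => /(fd x)[].
have iG : mu.-integrable D (EFin \o (fun y => `|G y|)) by exact: integrable_abse Gi.
have dG x y : `]t - 1, t + 1[%classic x -> D y -> `|partial1of2 f x y| <= `|G y|.
  by move=> _ Dy; rewrite partialE // (le_trans (dfG _ _ Dy)) // ler_norm.
have dint := derivable_under_integral mD tI (fun x _ => fi x)
  (fun x y _ Dy => derf x y Dy) (fun y => normr_ge0 (G y)) iG dG.
have dintE := differentiation_under_integral mD tI (fun x _ => fi x)
  (fun x y _ Dy => derf x y Dy) (fun y => normr_ge0 (G y)) iG dG.
apply: DeriveDef => //; rewrite -derive1E dintE.
by apply: eq_Rintegral => y; rewrite inE; exact: partialE.
Qed.

End derivation_under_integral.

(** * Complex-valued functions *)

Section complex_modulus.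
Context {R : realType}.
Implicit Types (z w : R[i]) (x : R).

Lemma normc_ge0 z : 0 <= normc z.
Proof. by case: z => a b; exact: sqrtr_ge0. Qed.

Lemma normc_sqrtE z : normc z = Num.sqrt (Re z ^+ 2 + Im z ^+ 2).
Proof. by case: z. Qed.

Lemma normc_sqr z : normc z ^+ 2 = Re z ^+ 2 + Im z ^+ 2.
Proof. by rewrite normc_sqrtE sqr_sqrtr // addr_ge0 ?sqr_ge0. Qed.

Lemma normcX z n : normc (z ^+ n) = normc z ^+ n.
Proof. by elim: n => [|n ih]; rewrite ?expr0 ?normc1 // !exprS normcM ih. Qed.

Lemma normc_real x : normc x%:C = `|x|.
Proof. by rewrite /= expr0n addr0 sqrtr_sqr. Qed.

Lemma normc_nat n : normc (n%:R : R[i]) = n%:R.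
Proof. by rewrite -(rmorph_nat (real_complex R)) normc_real normr_nat. Qed.

Lemma normc_i : normc ('i : R[i]) = 1.
Proof. by rewrite /= expr0n add0r expr1n sqrtr1. Qed.

Lemma le_normr_Re z : `|Re z| <= normc z.
Proof. by rewrite normc_sqrtE -sqrtr_sqr ler_wsqrtr // lerDl sqr_ge0. Qed.

Lemma le_normr_Im z : `|Im z| <= normc z.
Proof. by rewrite normc_sqrtE -sqrtr_sqr ler_wsqrtr // lerDr sqr_ge0. Qed.

Lemma normc_sum (I : Type) (s : seq I) (P : pred I) (f : I -> R[i]) :
  normc (\sum_(i <- s | P i) f i) <= \sum_(i <- s | P i) normc (f i).
Proof.
elim/big_ind2 : _ => [|a b c d ab cd|//]; first by rewrite normc0.
by rewrite (le_trans (le_normcD _ _)) // lerD.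
Qed.

Lemma normc_prod (I : Type) (s : seq I) (P : pred I) (f : I -> R[i]) :
  normc (\prod_(i <- s | P i) f i) = \prod_(i <- s | P i) normc (f i).
Proof. exact: (big_morph _ (@normcM R) (@normc1 R)). Qed.

Lemma Re_realM x z : Re (x%:C * z) = x * Re z.
Proof. by case: z => a b /=; rewrite mul0r subr0. Qed.

Lemma Im_realM x z : Im (x%:C * z) = x * Im z.
Proof. by case: z => a b /=; rewrite mul0r addr0. Qed.

Lemma cReD z w : Re (z + w) = Re z + Re w.
Proof. by case: z w => [? ?] []. Qed.

Lemma cImD z w : Im (z + w) = Im z + Im w.
Proof. by case: z w => [? ?] []. Qed.

Lemma cReM z w : Re (z * w) = Re z * Re w - Im z * Im w.
Proof. by case: z w => [? ?] []. Qed.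

Lemma cImM z w : Im (z * w) = Re z * Im w + Im z * Re w.
Proof. by case: z w => [? ?] []. Qed.

Lemma eq_ReIm z w : Re z = Re w -> Im z = Im w -> z = w.
Proof. by case: z w => [a b] [c e] /= -> ->. Qed.

Lemma inner_le_normc z w : Re z * Re w + Im z * Im w <= normc z * normc w.
Proof.
have -> : Re z * Re w + Im z * Im w = Re (z^* * w).
  by case: z w => [a b] [c e] /=; rewrite mulNr opprK.
rewrite (le_trans (ler_norm _)) // (le_trans (le_normr_Re _)) // normcM.
by case: z => a b /=; rewrite sqrrN.
Qed.

Lemma normc_prodB (I : Type) (s : seq I) (a b : I -> R[i]) (d E : I -> R) :
  (forall i, normc (a i) <= E i) -> (forall i, normc (b i) <= E i) ->
  (forall i, normc (a i - b i) <= d i * E i) ->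
  normc (\prod_(i <- s) a i - \prod_(i <- s) b i) <=
  (\sum_(i <- s) d i) * \prod_(i <- s) E i.
Proof.
move=> aE bE abE; elim: s => [|i s ih]; first by rewrite !big_nil subrr normc0 mul0r.
rewrite !big_cons.
rewrite [X in normc X](_ : _ = (a i - b i) * \prod_(j <- s) a j +
  b i * (\prod_(j <- s) a j - \prod_(j <- s) b j)); last by ring.
rewrite (le_trans (le_normcD _ _)) // !normcM mulrDl lerD //.
  rewrite mulrA ler_pM ?normc_ge0 // normc_prod.
  by apply: ler_prod => j _; rewrite normc_ge0 aE.
by rewrite mulrCA ler_pM ?normc_ge0.
Qed.

End complex_modulus.

Section complex_limits.
Context {R : realType}.
Implicit Types (u v : nat -> R[i]) (x y z : R[i]).

Definition ccvg u z :=
  Re (u n) @[n --> \oo] --> Re z /\ Im (u n) @[n --> \oo] --> Im z.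

Lemma ccvg_cst z : ccvg (fun=> z) z.
Proof. by split; exact: cvg_cst. Qed.

Lemma ccvg_real (a : nat -> R) (l : R) :
  a @ \oo --> l -> ccvg (fun n => (a n)%:C) l%:C.
Proof. by move=> al; split => //; exact: cvg_cst. Qed.

Lemma ccvgD u v x y : ccvg u x -> ccvg v y -> ccvg (fun n => u n + v n) (x + y).
Proof.
move=> [u1 u2] [v1 v2]; split.
  by under eq_fun do rewrite cReD; rewrite cReD; exact: cvgD.
by under eq_fun do rewrite cImD; rewrite cImD; exact: cvgD.
Qed.

Lemma ccvgN u x : ccvg u x -> ccvg (fun n => - u n) (- x).
Proof.
by move=> [u1 u2]; split; rewrite raddfN /=; under eq_fun do rewrite raddfN /=;
  exact: cvgN.
Qed.

Lemma ccvgM u v x y : ccvg u x -> ccvg v y -> ccvg (fun n => u n * v n) (x * y).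
Proof.
move=> [u1 u2] [v1 v2]; split.
  by under eq_fun do rewrite cReM; rewrite cReM; apply: cvgB; exact: cvgM.
by under eq_fun do rewrite cImM; rewrite cImM; apply: cvgD; exact: cvgM.
Qed.

Lemma ccvgX u x k : ccvg u x -> ccvg (fun n => u n ^+ k) (x ^+ k).
Proof.
move=> ux; elim: k => [|k ih]; first exact: ccvg_cst.
by rewrite exprS; under eq_fun do rewrite exprS; exact: ccvgM.
Qed.

Lemma ccvg_sum (I : Type) (s : seq I) (P : pred I) (u : I -> nat -> R[i]) (z : I -> R[i]) :
  (forall i, ccvg (u i) (z i)) ->
  ccvg (fun n => \sum_(i <- s | P i) u i n) (\sum_(i <- s | P i) z i).
Proof.
move=> uz; elim: s => [|i s ih].
  by rewrite big_nil; under eq_fun do rewrite big_nil; exact: ccvg_cst.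
rewrite big_cons; under eq_fun do rewrite big_cons.
by case: ifP => // _; exact: ccvgD.
Qed.

Lemma ccvg_prod (I : Type) (s : seq I) (P : pred I) (u : I -> nat -> R[i]) (z : I -> R[i]) :
  (forall i, ccvg (u i) (z i)) ->
  ccvg (fun n => \prod_(i <- s | P i) u i n) (\prod_(i <- s | P i) z i).
Proof.
move=> uz; elim: s => [|i s ih].
  by rewrite big_nil; under eq_fun do rewrite big_nil; exact: ccvg_cst.
rewrite big_cons; under eq_fun do rewrite big_cons.
by case: ifP => // _; exact: ccvgM.
Qed.

Lemma normc_le_ccvg u z (b : nat -> R) (l : R) : ccvg u z -> b @ \oo --> l ->
  (\forall n \near \oo, normc (u n) <= b n) -> normc z <= l.
Proof.
move=> [u1 u2] bl ub; apply: (ler_cvg_to _ bl ub).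
under eq_fun do rewrite normc_sqrtE; rewrite normc_sqrtE.
apply: continuous_cvg; first exact: sqrt_continuous.
by apply: cvgD; apply: cvgM.
Qed.

End complex_limits.

Section complex_derivative.
Context {R : realType}.
Implicit Types (f g : R -> R[i]) (x : R) (z df dg : R[i]).

Definition is_cderive x f df :=
  is_derive x 1 (fun y => Re (f y)) (Re df) /\
  is_derive x 1 (fun y => Im (f y)) (Im df).

Lemma is_cderive_eq x f df dg : is_cderive x f df -> df = dg -> is_cderive x f dg.
Proof. by move=> fd <-. Qed.

Lemma is_cderive_cst x z : is_cderive x (fun=> z) 0.
Proof. by split; exact: is_derive_cst. Qed.

Lemma is_cderive_real (h : R -> R) (x dh : R) :
  is_derive x 1 h dh -> is_cderive x (fun y => (h y)%:C) dh%:C.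
Proof. by move=> hd; split => //=; exact: is_derive_cst. Qed.

Lemma is_cderiveD x f g df dg : is_cderive x f df -> is_cderive x g dg ->
  is_cderive x (fun y => f y + g y) (df + dg).
Proof.
move=> [f1 f2] [g1 g2]; split.
  by under eq_fun do rewrite cReD; rewrite cReD; exact: is_deriveD.
by under eq_fun do rewrite cImD; rewrite cImD; exact: is_deriveD.
Qed.

Lemma is_cderiveM x f g df dg : is_cderive x f df -> is_cderive x g dg ->
  is_cderive x (fun y => f y * g y) (df * g x + f x * dg).
Proof.
move=> [f1 f2] [g1 g2]; split.
  under eq_fun do rewrite cReM.
  apply: (is_derive_eq (is_derive_subf (is_derive_mulf f1 g1) (is_derive_mulf f2 g2))).
  by rewrite cReD !cReM; ring.
under eq_fun do rewrite cImM.
apply: (is_derive_eq (is_derive_addf (is_derive_mulf f1 g2) (is_derive_mulf f2 g1))).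
by rewrite cImD !cImM; ring.
Qed.

Lemma is_cderiveZ x z f df : is_cderive x f df -> is_cderive x (fun y => z * f y) (z * df).
Proof.
move=> fd; apply: (is_cderive_eq (is_cderiveM (is_cderive_cst x z) fd)).
by rewrite mul0r add0r.
Qed.

Lemma is_cderiveN x f df : is_cderive x f df -> is_cderive x (fun y => - f y) (- df).
Proof.
by move=> /(is_cderiveZ (-1)); under eq_fun do rewrite mulN1r; rewrite mulN1r.
Qed.

Lemma is_cderive_sum x (I : Type) (s : seq I) (f : I -> R -> R[i]) (df : I -> R[i]) :
  (forall i, is_cderive x (f i) (df i)) ->
  is_cderive x (fun y => \sum_(i <- s) f i y) (\sum_(i <- s) df i).
Proof.
move=> fd; elim: s => [|i s ih].
  by rewrite big_nil; under eq_fun do rewrite big_nil; exact: is_cderive_cst.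
by rewrite big_cons; under eq_fun do rewrite big_cons; exact: is_cderiveD.
Qed.

Lemma is_cderive_exprn x f df n : is_cderive x f df ->
  is_cderive x (fun y => f y ^+ n) (n%:R * f x ^+ n.-1 * df).
Proof.
move=> fd; elim: n => [|n ih].
  by rewrite !mul0r; under eq_fun do rewrite expr0; exact: is_cderive_cst.
under eq_fun do rewrite exprS; apply: (is_cderive_eq (is_cderiveM fd ih)).
case: n {ih} => [|n]; first by rewrite !expr0; ring.
by rewrite -[n.+2%:R]natr1 /= exprS; ring.
Qed.

Lemma is_cderive_comp (g : R -> R) x f (dg : R) df :
  is_derive x 1 g dg -> is_cderive (g x) f df ->
  is_cderive x (fun y => f (g y)) (dg%:C * df).
Proof.
move=> gd [f1 f2]; split; rewrite ?Re_realM ?Im_realM mulrC.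
  exact: (is_derive1_comp f1 gd).
exact: (is_derive1_comp f2 gd).
Qed.

Lemma is_cderive_0_is_cst f : (forall x, is_cderive x f 0) -> forall x y, f x = f y.
Proof.
move=> fd x y; have {}fd := fun t => fd t.
by apply: eq_ReIm; [apply: (@is_derive_0_is_cst _ (fun t => Re (f t))) => t
                   |apply: (@is_derive_0_is_cst _ (fun t => Im (f t))) => t];
  have [] := fd t.
Qed.

(* Projecting on the direction of the endpoint value reduces the vector-valued
   mean value inequality to a scalar one. *)
Lemma is_cderive_normc_le (f df : R -> R[i]) (B dB : R -> R) (b : R) : 0 <= b ->
  (forall x, 0 <= x <= b -> is_cderive x f (df x)) ->
  (forall x, 0 <= x <= b -> is_derive x 1 B (dB x)) ->
  (forall x, 0 <= x <= b -> normc (df x) <= dB x) ->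
  normc (f 0) <= B 0 -> normc (f b) <= B b.
Proof.
move=> b0 fd Bd dfB f0B0.
have projection_le (u : R[i]) : normc u <= 1 -> Re u * Re (f b) + Im u * Im (f b) <= B b.
  move=> u1; have le_proj z : Re u * Re z + Im u * Im z <= normc z.
    by rewrite (le_trans (inner_le_normc _ _)) // ler_piMl // normc_ge0.
  pose g x := B x - (Re u * Re (f x) + Im u * Im (f x)).
  have gd x : 0 <= x <= b ->
      is_derive x 1 g (dB x - (Re u * Re (df x) + Im u * Im (df x))).
    move=> xb; have [? ?] := fd x xb.
    by apply: is_derive_subf (Bd x xb) _; apply: is_derive_addf; exact: is_derive_mull.
  have : g 0 <= g b.
    apply: (is_derive_ge0_le b0 gd) => x xb.
    by rewrite subr_ge0 (le_trans (le_proj _)) // dfB.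
  rewrite /g => g0b; rewrite -subr_ge0 (le_trans _ g0b) // subr_ge0.
  by rewrite (le_trans (le_proj _)).
have [fb0|fb_neq0] := eqVneq (f b) 0.
  by have := projection_le 0; rewrite fb0 normc0 /= !mul0r addr0; apply.
have nfb0 : normc (f b) != 0 by apply: contra_neq fb_neq0; exact: eq0_normc.
have := projection_le ((normc (f b))^-1%:C * f b).
rewrite normcM normc_real ger0_norm ?invr_ge0 ?normc_ge0 // mulVf // => /(_ (lexx _)).
by rewrite Re_realM Im_realM -!mulrA -mulrDr -!expr2 -normc_sqr expr2 mulKf.
Qed.

End complex_derivative.

Section complex_exponential.
Context {R : realType}.
Implicit Types (z w : R[i]) (x y : R).

Definition cexp z : R[i] :=
  (expR (Re z) * cos (Im z)) +i* (expR (Re z) * sin (Im z)).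

Lemma cexpD z w : cexp (z + w) = cexp z * cexp w.
Proof.
case: z w => [a b] [c d]; apply: eq_ReIm; rewrite /= expRD ?cosD ?sinD; ring.
Qed.

Lemma cexp0 : cexp 0 = 1.
Proof. by rewrite /cexp /= expR0 cos0 sin0 mulr0 mulr1. Qed.

Lemma cexp_real x : cexp x%:C = (expR x)%:C.
Proof. by rewrite /cexp /= cos0 sin0 mulr1 mulr0. Qed.

Lemma cexp_imag x : cexp (x%:C * 'i) = cos x +i* sin x.
Proof. by rewrite /cexp /= !(mulr0, mul0r, mulr1, subr0, addr0) expR0 !mul1r. Qed.

Lemma cexp_sum (I : Type) (s : seq I) (P : pred I) (f : I -> R[i]) :
  cexp (\sum_(i <- s | P i) f i) = \prod_(i <- s | P i) cexp (f i).
Proof. exact: (big_morph _ cexpD cexp0). Qed.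

Lemma normc_cexp z : normc (cexp z) = expR (Re z).
Proof.
by rewrite /cexp /= !exprMn -mulrDr cos2Dsin2 mulr1 sqrtr_sqr ger0_norm.
Qed.

Lemma normc_cexp_imag x : normc (cexp (x%:C * 'i)) = 1.
Proof. by rewrite normc_cexp /= mulr0 mul0r subr0 expR0. Qed.

Lemma normc_cexp_le z : normc (cexp z) <= expR (normc z).
Proof. by rewrite normc_cexp ler_expR (le_trans (ler_norm _)) // le_normr_Re. Qed.

Lemma is_cderive_cexp f (df : R[i]) x : is_cderive x f df ->
  is_cderive x (fun y => cexp (f y)) (df * cexp (f x)).
Proof.
move=> [f1 f2]; split.
  have := is_derive_mulf (is_derive_expR_comp f1) (is_derive1_comp (is_derive_cos _) f2).
  by move=> h; apply: (is_derive_eq h); case: (df) => a b /=; ring.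
have := is_derive_mulf (is_derive_expR_comp f1) (is_derive1_comp (is_derive_sin _) f2).
by move=> h; apply: (is_derive_eq h); case: (df) => a b /=; ring.
Qed.

Lemma is_cderive_realM z x : is_cderive x (fun y => y%:C * z) z.
Proof.
apply: (is_cderive_eq (is_cderiveM (is_cderive_real (is_derive_id x 1))
  (is_cderive_cst x z))).
by rewrite mulr0 addr0 mul1r.
Qed.

Lemma is_cderive_exp_trunc n z x : is_cderive x (fun y => exp_trunc n.+1 (y%:C * z))
  (z * exp_trunc n (x%:C * z)).
Proof.
rewrite /exp_trunc; under eq_fun do rewrite big_ord_recl expr0 /=.
apply: (is_cderive_eq (is_cderiveD (is_cderive_cst x _) (is_cderive_sum _ (fun j : 'I_n =>
  is_cderiveM (is_cderive_exprn j.+1 (is_cderive_realM z x)) (is_cderive_cst x _))))).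
rewrite add0r mulr_sumr; apply: eq_bigr => j _.
rewrite /= mulr0 addr0 /bump add1n factS natrM.
have f0 : (j`!)%:R != 0 :> R[i] by rewrite pnatr_eq0 -lt0n fact_gt0.
by field; rewrite f0 nat1r pnatr_eq0.
Qed.

Lemma exp_trunc0 n : exp_trunc n.+1 (0 : R[i]) = 1.
Proof.
rewrite /exp_trunc big_ord_recl expr0 fact0 divr1 big1 ?addr0 // => i _.
by rewrite expr0n mul0r.
Qed.

Lemma cexp_trunc_scale_le n z (s : R) : 0 <= s ->
  normc (cexp (s%:C * z) - exp_trunc n (s%:C * z)) <=
  (s * normc z) ^+ n * expR (s * normc z).
Proof.
elim: n s => [|n ih] s s0.
  rewrite /exp_trunc big_ord0 subr0 expr0 mul1r (le_trans (normc_cexp_le _)) //.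
  by rewrite ler_expR normcM normc_real ger0_norm.
apply: (@is_cderive_normc_le _
  (fun y => cexp (y%:C * z) - exp_trunc n.+1 (y%:C * z))
  (fun y => z * (cexp (y%:C * z) - exp_trunc n (y%:C * z)))
  (fun y => (y * normc z) ^+ n.+1 * expR (y * normc z))
  (fun y => normc z * ((n.+1%:R * (y * normc z) ^+ n + (y * normc z) ^+ n.+1) *
                       expR (y * normc z))) s s0).
- move=> x _; rewrite mulrBr.
  apply: is_cderiveD; first exact: is_cderive_cexp (is_cderive_realM _ _).
  exact/is_cderiveN/is_cderive_exp_trunc.
- move=> x _; have xz : is_derive x 1 (fun y : R => y * normc z) (normc z).
    by under eq_fun do rewrite mulrC; exact: is_derive_mull_id.
  apply: (is_derive_eq (is_derive_mulf (is_derive_exprn_comp xz n.+1)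
    (is_derive_expR_comp xz))).
  by ring.
- move=> x /andP[x0 _]; rewrite normcM ler_wpM2l ?normc_ge0 //.
  have xz0 : 0 <= x * normc z by rewrite mulr_ge0 ?normc_ge0.
  apply: (le_trans (ih _ x0)); rewrite ler_wpM2r ?expR_ge0 //.
  by rewrite -[leLHS]addr0 lerD ?exprn_ge0 // ler_peMl ?exprn_ge0 // ler1n.
- by rewrite rmorph0 mul0r cexp0 exp_trunc0 subrr normc0 mul0r expr0n mul0r.
Qed.

Lemma cexp_trunc_le n z :
  normc (cexp z - exp_trunc n z) <= normc z ^+ n * expR (normc z).
Proof. by have := cexp_trunc_scale_le n z ler01; rewrite !mul1r. Qed.

Lemma cexpB1_le z : normc (cexp z - 1) <= normc z * expR (normc z).
Proof.
by have := cexp_trunc_le 1 z; rewrite /exp_trunc big_ord1 expr0 divr1 expr1.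
Qed.

Lemma normc_exp_trunc n z : normc (exp_trunc n z) <= exp_trunc n (normc z).
Proof.
rewrite (le_trans (normc_sum _ _ _)) // ler_sum // => j _.
by rewrite normcM normcX normcV normc_nat.
Qed.

End complex_exponential.

Section complex_logarithm.
Context {R : realType}.
Implicit Types u x y : R.

(* The principal logarithm of [1 / (1 - 'i u)]. *)
Definition clog u : R[i] := (- (ln (1 + u ^+ 2) / 2)) +i* atan u.

Lemma clog0 : clog 0 = 0.
Proof. by rewrite /clog expr0n addr0 ln1 mul0r oppr0 atan0. Qed.

Lemma normc_1Bi_ge1 u : 1 <= normc (1 - u%:C * 'i).
Proof.
by rewrite (le_trans _ (le_normr_Re _)) //= !mul0r !mulr0 !subr0 normr1.
Qed.

Lemma subr_1Bi_neq0 u : 1 - u%:C * 'i != 0 :> R[i].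
Proof. by apply/eqP => u0; have := normc_1Bi_ge1 u; rewrite u0 normc0 ler10. Qed.

Lemma is_cderive_clog u : is_cderive u clog ('i / (1 - u%:C * 'i)).
Proof.
have u1 : 0 < 1 + u ^+ 2 by rewrite ltr_pwDl // sqr_ge0.
rewrite (_ : 'i / _ = (- (u / (1 + u ^+ 2))) +i* (1 + u ^+ 2)^-1); last first.
  apply: (mulIf (subr_1Bi_neq0 u)); rewrite divfK ?subr_1Bi_neq0 //.
  by apply: eq_ReIm => /=; field; rewrite gt_eqF.
split => /=; last exact: is_derive1_atan.
have hd : is_derive u 1 (fun y : R => 1 + y ^+ 2) (0 + 2%:R * u ^+ 1).
  exact: is_derive_addf (is_derive_cst _ _ _) (is_derive_exprn 2 u).
under eq_fun do rewrite mulrC -mulNr.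
apply: (is_derive_eq (is_derive_mull (is_derive_ln_comp hd u1) (- 2^-1))).
by field; rewrite gt_eqF.
Qed.

Lemma clog_expansion n u : 0 <= u ->
  normc (clog u - \sum_(j < n) (u%:C * 'i) ^+ j.+1 / j.+1%:R) <= u ^+ n.+1.
Proof.
move=> u0.
apply: (@is_cderive_normc_le _
  (fun y => clog y - \sum_(j < n) (y%:C * 'i) ^+ j.+1 / j.+1%:R)
  (fun y => 'i * (y%:C * 'i) ^+ n / (1 - y%:C * 'i))
  (fun y => y ^+ n.+1) (fun y => n.+1%:R * y ^+ n) u u0).
- move=> x _.
  have -> : 'i * (x%:C * 'i) ^+ n / (1 - x%:C * 'i) =
      'i / (1 - x%:C * 'i) - \sum_(j < n) (x%:C * 'i) ^+ j * 'i.
    have := subrX1 (x%:C * 'i) n; rewrite -[_ * 'i - 1]opprB mulNr -mulr_suml.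
    set g := \sum_(_ < _) _ => /eqP; rewrite subr_eq => /eqP ->.
    by move: (subr_1Bi_neq0 x); set w := 1 - _ => w0; field.
  apply: is_cderiveD; first exact: is_cderive_clog.
  apply/is_cderiveN/is_cderive_sum => j.
  apply: (is_cderive_eq (is_cderiveM (is_cderive_exprn j.+1 (is_cderive_realM 'i x))
    (is_cderive_cst x _))).
  by rewrite /=; field; rewrite nat1r pnatr_eq0.
- by move=> x _; exact: is_derive_exprn.
- move=> x /andP[x0 _]; rewrite normcM normcV normcM normc_i mul1r normcX normcM.
  rewrite normc_i mulr1 normc_real ger0_norm // (@le_trans _ _ (x ^+ n)) //.
    by rewrite ler_piMr ?exprn_ge0 // invf_le1 ?(lt_le_trans ltr01) // normc_1Bi_ge1.
  by rewrite ler_peMl ?exprn_ge0 // ler1n.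
- rewrite clog0 rmorph0 mul0r big1 => [|j _]; last by rewrite exprS !mul0r.
  by rewrite subr0 normc0 expr0n.
Qed.

End complex_logarithm.

(** * Independence and characteristic functions *)

Lemma expectation_cst (d : measure_display) (T : measurableType d) (R : realType)
    (P : probability T R) (c : R) : \int[P]_w c = c.
Proof. by rewrite Rintegral_cst //= probability_setT mulr1. Qed.

Section independent_pair.
Context (d : measure_display) (T : measurableType d) (R : realType) (P : probability T R).
Implicit Types U V : T -> R.

Definition independent_pair U V := forall A B : set R, measurable A -> measurable B ->
  P (U @^-1` A `&` V @^-1` B) = (P (U @^-1` A) * P (V @^-1` B))%E.

Lemma independent_pair_comp U V (g h : R -> R) : independent_pair U V ->
  measurable_fun setT g -> measurable_fun setT h -> independent_pair (g \o U) (h \o V).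
Proof.
move=> UV mg mh A B mA mB; apply: (UV (g @^-1` A) (h @^-1` B)).
  by rewrite -[X in measurable X]setTI; exact: mg.
by rewrite -[X in measurable X]setTI; exact: mh.
Qed.

Section integrable_product.
Variables U V : T -> R.
Hypotheses (iU : P.-integrable setT (EFin \o U)) (iV : P.-integrable setT (EFin \o V)).
Hypothesis UV : independent_pair U V.

Let mU : measurable_fun setT U.
Proof. exact: integrable_measurable_fun iU. Qed.
Let mV : measurable_fun setT V.
Proof. exact: integrable_measurable_fun iV. Qed.
Let mUV : measurable_fun setT (fun w => (U w, V w)).
Proof. exact: measurable_fun_pair. Qed.

Let U' : {RV P >-> R} := HB.pack U (isMeasurableFun.Build _ _ _ _ U mU).
Let V' : {RV P >-> R} := HB.pack V (isMeasurableFun.Build _ _ _ _ V mV).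
Let UV' : {RV P >-> (R * R)%type} :=
  HB.pack (fun w => (U w, V w)) (isMeasurableFun.Build _ _ _ _ _ mUV).

Let joint_distribution X : measurable X ->
  (distribution P U' \x distribution P V')%E X = distribution P UV' X.
Proof. by apply: product_measure_unique => A B mA mB; exact: UV. Qed.

Let measurable_mul : measurable_fun setT (fun z : R * R => (z.1 * z.2)%:E).
Proof. by apply/measurable_EFinP; exact: measurable_funM. Qed.

Let integrable_mul : (distribution P U' \x distribution P V')%E.-integrable setT
  (fun z : R * R => (z.1 * z.2)%:E).
Proof.
apply/integrable12ltyP => //.
have mabs : measurable_fun setT (fun y : R => `|y|%:E).
  by apply/measurable_EFinP; exact: normr_measurable.
under eq_integral => x _.
  under eq_integral => y _ do rewrite /= normrM EFinM.
  rewrite ge0_integralZl //= (ge0_integral_distribution V') //.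
  over.
have /integrableP[_ hV] := iV; have /integrableP[_ hU] := iU.
rewrite ge0_integralZr //=; last by rewrite integral_ge0.
rewrite (ge0_integral_distribution U') // lte_mul_pinfty //.
  by apply: integral_ge0 => x _; rewrite /= lee_fin.
by rewrite ge0_fin_numE //; apply: integral_ge0 => x _; rewrite /= lee_fin.
Qed.

Lemma integrable_independentM : P.-integrable setT (fun w => (U w * V w)%:E).
Proof.
have /integrableP[_] := integrable_mul.
rewrite (eq_measure_integral (distribution P UV')); last first.
  by move=> A mA _; exact: joint_distribution.
rewrite (ge0_integral_distribution UV') //; last exact: measurableT_comp.
move=> finite; apply/integrableP; split => //.
by apply/measurable_EFinP; exact: measurable_funM.
Qed.

Lemma Rintegral_independentM :
  \int[P]_w (U w * V w) = \int[P]_w U w * \int[P]_w V w.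
Proof.
have fU : (\int[P]_x (U x)%:E)%E \is a fin_num by exact: integrable_fin_num.
have fV : (\int[P]_x (V x)%:E)%E \is a fin_num by exact: integrable_fin_num.
rewrite /Rintegral -fineM //; congr fine.
transitivity (\int[distribution P UV']_z (z.1 * z.2)%:E)%E.
  by rewrite (integral_distribution (X := UV')) //; exact: integrable_independentM.
transitivity (\int[distribution P U' \x distribution P V']_z (z.1 * z.2)%:E)%E.
  by apply: eq_measure_integral => A mA _; exact/esym/joint_distribution.
rewrite -(integral12_prod_meas1 integrable_mul) /fubini_F /=.
have iV' : (distribution P V').-integrable setT (EFin : R -> \bar R).
  by apply: (integrable_pushforward mV).
have iU' : (distribution P U').-integrable setT (EFin : R -> \bar R).
  by apply: (integrable_pushforward mU).
under eq_integral => x _.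
  under eq_integral => y _ do rewrite /= EFinM.
  rewrite integralZl //= (integral_distribution (X := V')) //=.
  rewrite -(fineK fV); over.
rewrite integralZr //= fineK //; congr (_ * _)%E.
by rewrite (integral_distribution (X := U')).
Qed.

End integrable_product.

End independent_pair.

Section complex_expectation.
Context (d : measure_display) (T : measurableType d) (R : realType) (P : probability T R).
Implicit Types (f g : T -> R[i]) (z : R[i]) (X Y : T -> R).

Definition cintegrable f :=
  P.-integrable setT (fun w => (Re (f w))%:E) /\
  P.-integrable setT (fun w => (Im (f w))%:E).

Definition cexpectation f : R[i] := (\int[P]_w Re (f w)) +i* (\int[P]_w Im (f w)).

Lemma cintegrableZ z f : cintegrable f -> cintegrable (fun w => z * f w).
Proof.
case: z => a b [f1 f2]; split.
  under eq_fun do rewrite cReM /=.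
  exact: (integrableB measurableT (integrableZl_EFin a measurableT f1)
    (integrableZl_EFin b measurableT f2)).
under eq_fun do rewrite cImM /=.
exact: (integrableD measurableT (integrableZl_EFin a measurableT f2)
  (integrableZl_EFin b measurableT f1)).
Qed.

Lemma cexpectationD f g : cintegrable f -> cintegrable g ->
  cexpectation (fun w => f w + g w) = cexpectation f + cexpectation g.
Proof.
move=> [f1 f2] [g1 g2]; apply: eq_ReIm; rewrite ?cReD ?cImD /=.
  by under eq_Rintegral do rewrite cReD; rewrite RintegralD.
by under eq_Rintegral do rewrite cImD; rewrite RintegralD.
Qed.

Lemma cexpectationZ z f : cintegrable f ->
  cexpectation (fun w => z * f w) = z * cexpectation f.
Proof.
case: z => a b [f1 f2].
have af1 := integrableZl_EFin a measurableT f1; have af2 := integrableZl_EFin a measurableT f2.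
have bf1 := integrableZl_EFin b measurableT f1; have bf2 := integrableZl_EFin b measurableT f2.
apply: eq_ReIm; rewrite ?cReM ?cImM /= -!RintegralZl //.
  by under eq_Rintegral do rewrite cReM /=; rewrite RintegralB.
by under eq_Rintegral do rewrite cImM /=; rewrite RintegralD.
Qed.

Lemma cexpectation_cst z : cexpectation (fun=> z) = z.
Proof.
by case: z => a b; rewrite /cexpectation /= !expectation_cst.
Qed.

Definition char_fun X t : R[i] := cexpectation (fun w => cexp ((t * X w)%:C * 'i)).

Lemma char_funE X t :
  char_fun X t = (\int[P]_w cos (t * X w)) +i* (\int[P]_w sin (t * X w)).
Proof.
by rewrite /char_fun /cexpectation; congr (_ +i* _); apply: eq_Rintegral => w _;
  rewrite cexp_imag.
Qed.

Lemma integrable_continuous_bounded (g : R -> R) X : continuous g ->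
  (forall x, `|g x| <= 1) -> measurable_fun setT X ->
  P.-integrable setT (fun w => (g (X w))%:E).
Proof.
move=> cg g1 mX; apply: (@integrable_bounded _ _ _ P (g \o X) 1) => [|w]; last exact: g1.
by apply: measurableT_comp => //; exact: continuous_measurable_fun.
Qed.

Lemma cintegrable_cexp_imag X : measurable_fun setT X ->
  cintegrable (fun w => cexp ((X w)%:C * 'i)).
Proof.
move=> mX; split; under eq_fun do rewrite cexp_imag /=.
  by apply: integrable_continuous_bounded => //; [exact: continuous_cos|exact: cos_max].
by apply: integrable_continuous_bounded => //; [exact: continuous_sin|exact: sin_max].
Qed.

Lemma measurable_mull X t : measurable_fun setT X -> measurable_fun setT (fun w => t * X w).
Proof. by move=> mX; exact: measurable_funM. Qed.

Lemma char_fun0 X : char_fun X 0 = 1.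
Proof.
rewrite /char_fun -[RHS]cexpectation_cst; congr cexpectation.
by apply/funext => w; rewrite mul0r mul0r cexp0.
Qed.

Lemma char_funZ X c t : char_fun (fun w => c * X w) t = char_fun X (t * c).
Proof.
by rewrite /char_fun; congr cexpectation; apply/funext => w; rewrite mulrA.
Qed.

Lemma char_funBr X c t : measurable_fun setT X ->
  char_fun (fun w => X w - c) t = cexp (- ((t * c)%:C * 'i)) * char_fun X t.
Proof.
move=> mX; rewrite /char_fun -cexpectationZ; last first.
  by apply: cintegrable_cexp_imag; exact: measurable_mull.
congr cexpectation; apply/funext => w.
by rewrite -cexpD -mulNr -rmorphN -mulrDl -rmorphD /= addrC -mulrN -mulrDr.
Qed.

Lemma char_fun_independentD X Y t : measurable_fun setT X -> measurable_fun setT Y ->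
  independent_pair P X Y -> char_fun (fun w => X w + Y w) t = char_fun X t * char_fun Y t.
Proof.
move=> mX mY XY.
have trigM (g h : R -> R) : continuous g -> continuous h ->
    (forall x, `|g x| <= 1) -> (forall x, `|h x| <= 1) ->
    P.-integrable setT (fun w => (g (t * X w) * h (t * Y w))%:E) /\
    \int[P]_w (g (t * X w) * h (t * Y w)) =
    \int[P]_w g (t * X w) * \int[P]_w h (t * Y w).
  move=> cg ch g1 h1.
  have ig := integrable_continuous_bounded cg g1 (measurable_mull t mX).
  have ih := integrable_continuous_bounded ch h1 (measurable_mull t mY).
  have mt (k : R -> R) : continuous k -> measurable_fun setT (fun x => k (t * x)).
    move=> ck; apply: measurableT_comp; first exact: continuous_measurable_fun.
    exact: measurable_funM.
  have gh := independent_pair_comp XY (mt _ cg) (mt _ ch).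
  by split; [exact: integrable_independentM ig ih gh|exact: Rintegral_independentM ig ih gh].
have cc := (@continuous_cos R, @cos_max R); have ss := (@continuous_sin R, @sin_max R).
have [icc Ecc] := trigM _ _ cc.1 cc.1 cc.2 cc.2.
have [iss Ess] := trigM _ _ ss.1 ss.1 ss.2 ss.2.
have [ics Ecs] := trigM _ _ cc.1 ss.1 cc.2 ss.2.
have [isc Esc] := trigM _ _ ss.1 cc.1 ss.2 cc.2.
rewrite !char_funE; apply: eq_ReIm => /=.
  rewrite -Ecc -Ess -RintegralB //; apply: eq_Rintegral => w _.
  by rewrite mulrDr cosD.
rewrite -Ecs -Esc -RintegralD //; apply: eq_Rintegral => w _.
by rewrite mulrDr sinD addrC.
Qed.

Lemma cintegrable_realM_cexp_imag X Y : P.-integrable setT (EFin \o X) ->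
  measurable_fun setT Y -> cintegrable (fun w => (X w)%:C * cexp ((Y w)%:C * 'i)).
Proof.
move=> iX mY; have mX := integrable_measurable_fun iX.
have trig (g : R -> R) : continuous g -> (forall x, `|g x| <= 1) ->
    P.-integrable setT (fun w => (X w * g (Y w))%:E).
  move=> cg g1; apply: (@integrable_normr_le _ _ _ P setT _ (fun w => `|X w|)) => //.
  - apply: measurable_funM => //; apply: measurableT_comp => //.
    exact: continuous_measurable_fun.
  - by move=> w _; rewrite normrM ler_piMr.
  - exact: integrable_abse iX.
split; under eq_fun do rewrite cexp_imag ?Re_realM ?Im_realM /=.
  by apply: trig; [exact: continuous_cos|exact: cos_max].
by apply: trig; [exact: continuous_sin|exact: sin_max].
Qed.

Lemma is_cderive_char_fun X t : P.-integrable setT (EFin \o X) ->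
  is_cderive t (char_fun X) ('i * cexpectation (fun w => (X w)%:C * cexp ((t * X w)%:C * 'i))).
Proof.
move=> iX; have mX := integrable_measurable_fun iX.
have derive_trig (g dg : R -> R) : continuous g -> (forall x, `|g x| <= 1) ->
    (forall x : R, is_derive x 1 g (dg x)) -> (forall x, `|dg x| <= 1) ->
    is_derive t 1 (fun t => \int[P]_w g (t * X w)) (\int[P]_w (X w * dg (t * X w))).
  move=> cg g1 gd dg1.
  apply: (@is_derive_under_integral _ _ _ P setT (fun t w => g (t * X w))
    (fun t w => X w * dg (t * X w)) (fun w => `|X w|)) => //.
  - by move=> s; exact: integrable_continuous_bounded (measurable_mull s mX).
  - move=> s w _; have sX : is_derive s 1 (fun s => s * X w) (X w).
      by under eq_fun do rewrite mulrC; exact: is_derive_mull_id.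
    by apply: (is_derive_eq (is_derive1_comp (gd _) sX)); rewrite mulrC.
  - exact: integrable_abse iX.
  - by move=> s w _; rewrite normrM ler_piMr.
rewrite -cexpectationZ; last first.
  by apply: cintegrable_realM_cexp_imag => //; exact: measurable_mull.
have -> : (fun w => 'i * ((X w)%:C * cexp ((t * X w)%:C * 'i))) =
    (fun w => (X w * - sin (t * X w)) +i* (X w * cos (t * X w))).
  apply/funext => w; rewrite cexp_imag.
  by apply: eq_ReIm => /=; ring.
split; under eq_fun do rewrite char_funE /=.
  apply: derive_trig (@continuous_cos R) (@cos_max R) _ _ => x.
  by rewrite normrN sin_max.
exact: derive_trig (@continuous_sin R) (@sin_max R) _ (@cos_max R).
Qed.

End complex_expectation.

(** * Truncated exponential of a cumulant series *)

Section weighted_monomials.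
Variable n : nat.
Implicit Types k : {ffun 'I_n -> 'I_n.+1}.

Definition weight k : nat := \sum_(i < n) (i + 1) * k i.

Definition exp_monomial {F : fieldType} (z : 'I_n -> F) k : F :=
  \prod_(i < n) (z i ^+ k i / (k i)`!%:R).

Definition edgeworth_sum {F : fieldType} (z : 'I_n -> F) : F :=
  \sum_(k | (weight k <= n)%N) exp_monomial z k.

Lemma prod_exp_trunc {F : fieldType} (z : 'I_n -> F) :
  \prod_(i < n) exp_trunc n.+1 (z i) = \sum_k exp_monomial z k.
Proof.
exact: (bigA_distr_bigA (fun (i : 'I_n) (j : 'I_n.+1) => z i ^+ j / j`!%:R)).
Qed.

Lemma exp_monomial_scale {F : fieldType} (y : F) (z : 'I_n -> F) k :
  exp_monomial (fun i => y ^+ i.+1 * z i) k = y ^+ weight k * exp_monomial z k.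
Proof.
rewrite /weight -prodrXr -big_split /=; apply: eq_bigr => i _.
by rewrite exprMn -exprM addn1 mulrA.
Qed.

Section real_bounds.
Context {R : realType}.
Implicit Types (b : 'I_n -> R) (z : 'I_n -> R[i]).

Lemma exp_monomial_ge0 b k : (forall i, 0 <= b i) -> 0 <= exp_monomial b k.
Proof. by move=> b0; apply: prodr_ge0 => i _; rewrite divr_ge0 ?exprn_ge0. Qed.

Lemma exp_monomial_le1 b k : (forall i, 0 <= b i <= 1) -> exp_monomial b k <= 1.
Proof.
move=> b01; apply: prodr_ile1 => i _; have /andP[b0 b1] := b01 i.
rewrite divr_ge0 ?exprn_ge0 //= ler_pdivrMr ?ltr0n ?fact_gt0 // mul1r.
by rewrite (@le_trans _ _ 1) ?exprn_ile1 // ler1n fact_gt0.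
Qed.

Lemma normc_exp_monomial_le z b k :
  (forall i, normc (z i) <= b i) -> normc (exp_monomial z k) <= exp_monomial b k.
Proof.
move=> zb; rewrite normc_prod; apply: ler_prod => i _.
rewrite normc_ge0 normcM normcX normcV normc_nat ler_wpM2r ?invr_ge0 //.
by rewrite lerXn2r ?nnegrE ?normc_ge0 // (le_trans (normc_ge0 _) (zb i)).
Qed.

Lemma sum_exp_monomial_le b : (forall i, 0 <= b i) ->
  \sum_k exp_monomial b k <= expR (\sum_(i < n) b i).
Proof.
move=> b0; rewrite -prod_exp_trunc expR_sum; apply: ler_prod => i _.
rewrite exp_trunc_le_expR ?b0 // andbT.
by apply: sumr_ge0 => j _; rewrite divr_ge0 ?exprn_ge0.
Qed.

Lemma normc_heavy_sum_le z (tau y delta : R) :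
  0 <= tau -> 0 <= y <= delta -> 0 < delta <= 1 ->
  (forall i, normc (z i) <= tau * y ^+ i.+1) ->
  normc (\sum_(k | (n < weight k)%N) exp_monomial z k) <=
  (y / delta) ^+ n.+1 * expR (tau * (n%:R * delta)).
Proof.
move=> tau0 /andP[y0 yd] /andP[d0 d1] zb.
pose b (i : 'I_n) := tau * delta ^+ i.+1.
have b0 i : 0 <= b i by rewrite mulr_ge0 ?exprn_ge0 // ltW.
have yd0 : 0 <= y / delta by rewrite divr_ge0 // ltW.
have zb' k : normc (exp_monomial z k) <= (y / delta) ^+ weight k * exp_monomial b k.
  rewrite -exp_monomial_scale; apply: normc_exp_monomial_le => i.
  by rewrite (le_trans (zb i)) // mulrCA -exprMn divfK ?gt_eqF.
rewrite (le_trans (normc_sum _ _ _)) //.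
apply: (@le_trans _ _ (\sum_k (y / delta) ^+ n.+1 * exp_monomial b k)).
  rewrite big_mkcond ler_sum // => k _; case: ifP => [wk|_].
    rewrite (le_trans (zb' k)) // ler_wpM2r ?exp_monomial_ge0 // ler_wiXn2l //.
    by rewrite ler_pdivrMr // mul1r.
  by rewrite mulr_ge0 ?exprn_ge0 ?exp_monomial_ge0.
rewrite -mulr_sumr ler_wpM2l ?exprn_ge0 // (le_trans (sum_exp_monomial_le b0)) //.
rewrite ler_expR (@le_trans _ _ (\sum_(i < n) tau * delta)) //; last first.
  by rewrite sumr_const card_ord -mulrnAr mulr_natl.
by apply: ler_sum => i _; rewrite ler_wpM2l // exprS ler_piMr ?exprn_ile1 ?(ltW d0).
Qed.

End real_bounds.

End weighted_monomials.

Lemma normc_prod_cexpB_exp_trunc {R : realType} (I : Type) (s : seq I) (z : I -> R[i]) m :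
  normc (\prod_(i <- s) cexp (z i) - \prod_(i <- s) exp_trunc m (z i)) <=
  (\sum_(i <- s) normc (z i) ^+ m) * expR (\sum_(i <- s) normc (z i)).
Proof.
rewrite expR_sum; apply: normc_prodB => i; first exact: normc_cexp_le.
  by rewrite (le_trans (normc_exp_trunc _ _)) // exp_trunc_le_expR // normc_ge0.
exact: cexp_trunc_le.
Qed.

Lemma normc_cexpM_cexpB1_le {R : realType} (z w : R[i]) (a b : R) :
  normc z <= a -> normc w <= b -> normc (cexp z * (cexp w - 1)) <= b * expR (a + b).
Proof.
move=> za wb; rewrite normcM expRD mulrCA ler_pM ?normc_ge0 //.
  by rewrite (le_trans (normc_cexp_le _)) // ler_expR.
by rewrite (le_trans (cexpB1_le _)) // ler_pM ?normc_ge0 ?expR_ge0 // ler_expR.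
Qed.

Section edgeworth_truncation.
Context {R : realType} (n : nat).

Definition truncation_radius : R := (4 * n.+1%:R)^-1.

Definition truncation_poly : {poly R} :=
  'X + n%:R%:P * 'X^(n.+1) + (truncation_radius^-1 ^+ n.+1)%:P.

Local Notation delta := truncation_radius.

Lemma truncation_radius_gt0 : 0 < delta.
Proof. by rewrite invr_gt0 mulr_gt0 ?ltr0n. Qed.

Lemma truncation_radius_le1 : delta <= 1.
Proof. by rewrite invf_le1 ?mulr_gt0 ?ltr0n // -natrM ler1n. Qed.

Lemma mulSn_truncation_radius : n%:R * delta + delta = 4^-1.
Proof.
by rewrite -[X in _ + X]mul1r -mulrDl natr1 /delta invfM mulrCA divff ?mulr1.
Qed.

Lemma truncation_polyE tau :
  truncation_poly.[tau] = tau + n%:R * tau ^+ n.+1 + delta^-1 ^+ n.+1.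
Proof. by rewrite !hornerE. Qed.

Lemma truncation_poly_nd tau tau' :
  0 <= tau -> tau <= tau' -> truncation_poly.[tau] <= truncation_poly.[tau'].
Proof.
move=> tau0 tt'; rewrite !truncation_polyE lerD2r lerD // ler_wpM2l //.
by rewrite lerXn2r ?nnegrE // (le_trans tau0).
Qed.

(* The three summands of [truncation_poly] bound, in this order, the error made by
   dropping [rho], by truncating each exponential, and by dropping heavy monomials. *)
Lemma edgeworth_truncation (z : 'I_n -> R[i]) (rho : R[i]) (tau y : R) :
  0 <= tau -> 0 <= y <= delta ->
  (forall i, normc (z i) <= tau * y ^+ i.+1) -> normc rho <= tau * y ^+ n.+1 ->
  normc (cexp (\sum_(i < n) z i + rho) - edgeworth_sum z) <=
  y ^+ n.+1 * truncation_poly.[tau] * expR (tau / 4).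
Proof.
move=> tau0 /andP[y0 yd] zb rhob.
have d0 := truncation_radius_gt0; have d1 := truncation_radius_le1.
have pow_le j : tau * y ^+ j.+1 <= tau * delta.
  rewrite ler_wpM2l // exprS (le_trans _ yd) // ler_piMr // exprn_ile1 //.
  exact: le_trans d1.
have sum_z_le : \sum_(i < n) normc (z i) <= tau * (n%:R * delta).
  rewrite (le_trans (ler_sum _ (fun i _ => le_trans (zb i) (pow_le i)))) //.
  by rewrite sumr_const card_ord -mulrnAr mulr_natl.
have exp_le4 : expR (tau * (n%:R * delta)) <= expR (tau / 4).
  by rewrite ler_expR ler_wpM2l // -mulSn_truncation_radius lerDl ltW.
pose heavy := \sum_(k : {ffun 'I_n -> 'I_n.+1} | (n < weight k)%N) exp_monomial z k.
have split_trunc : \prod_(i < n) exp_trunc n.+1 (z i) = edgeworth_sum z + heavy.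
  rewrite prod_exp_trunc (bigID (fun k => (weight k <= n)%N)) /=; congr (_ + _).
  by apply: eq_bigl => k; rewrite -ltnNge.
have rho_error : normc (cexp (\sum_(i < n) z i) * (cexp rho - 1)) <=
    y ^+ n.+1 * tau * expR (tau / 4).
  rewrite -mulSn_truncation_radius [in leRHS]mulrDr [y ^+ _ * tau]mulrC.
  apply: (le_trans (normc_cexpM_cexpB1_le (le_trans (normc_sum _ _ _) sum_z_le) rhob)).
  by rewrite ler_wpM2l ?mulr_ge0 ?exprn_ge0 // ler_expR lerD2l.
have factor_error :
    normc (\prod_(i < n) cexp (z i) - \prod_(i < n) exp_trunc n.+1 (z i)) <=
    y ^+ n.+1 * (n%:R * tau ^+ n.+1) * expR (tau / 4).
  rewrite (le_trans (normc_prod_cexpB_exp_trunc _ _ _)) // ler_pM ?expR_ge0 //.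
  - by apply: sumr_ge0 => i _; rewrite exprn_ge0 ?normc_ge0.
  - rewrite mulrCA -exprMn mulr_natl -[X in _ *+ X](card_ord n) -sumr_const.
    apply: ler_sum => i _; rewrite lerXn2r ?nnegrE ?normc_ge0 ?mulr_ge0 //.
    rewrite (le_trans (zb i)) // mulrC ler_wpM2r // exprS ler_piMr ?exprn_ile1 //.
    exact: le_trans d1.
  - by rewrite (le_trans _ exp_le4) // ler_expR.
have heavy_error : normc heavy <= y ^+ n.+1 * delta^-1 ^+ n.+1 * expR (tau / 4).
  rewrite -exprMn.
  apply: (le_trans (@normc_heavy_sum_le _ _ z tau y delta tau0 _ _ zb)); rewrite ?y0 ?d0 //.
  by rewrite ler_wpM2l // exprn_ge0 // divr_ge0 // ltW.
have -> : cexp (\sum_(i < n) z i + rho) - edgeworth_sum z =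
    cexp (\sum_(i < n) z i) * (cexp rho - 1) +
    (\prod_(i < n) cexp (z i) - \prod_(i < n) exp_trunc n.+1 (z i) + heavy).
  by rewrite cexpD cexp_sum split_trunc; ring.
rewrite truncation_polyE ![in leRHS]mulrDr ![in leRHS]mulrDl -[leRHS]addrA.
rewrite (le_trans (le_normcD _ _)) // lerD // (le_trans (le_normcD _ _)) //.
exact: lerD.
Qed.

End edgeworth_truncation.

Section edgeworth_poly.
Context {R : realType} (n : nat).
Implicit Types (c : nat -> R) (t : R) (k : {ffun 'I_n -> 'I_n.+1}).

Definition edgeworth_poly c t : R[i] :=
  edgeworth_sum (fun i : 'I_n => (c i)%:C * (t%:C * 'i) ^+ i.+3).

Definition edgeworth_coef c k : R := exp_monomial (fun i : 'I_n => c i) k.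

Definition edgeworth_degree k : nat := \sum_(i < n) (i + 3) * k i.

Lemma edgeworth_polyE c t : edgeworth_poly c t =
  \sum_(k | (weight k <= n)%N) (edgeworth_coef c k)%:C * (t%:C * 'i) ^+ edgeworth_degree k.
Proof.
apply: eq_bigr => k _; rewrite rmorph_prod -prodrXr -big_split /=.
apply: eq_bigr => i _; rewrite rmorphM fmorphV rmorphXn rmorph_nat /= exprMn -exprM.
by rewrite addn3 mulrAC.
Qed.

Lemma weight_le_degree k : (weight k <= edgeworth_degree k)%N.
Proof. by apply: leq_sum => i _; rewrite leq_mul2r leq_add2l orbT. Qed.

Lemma edgeworth_degree_le k : (edgeworth_degree k <= 3 * weight k)%N.
Proof.
rewrite big_distrr; apply: leq_sum => i _.
by rewrite /= mulnA leq_mul2r mulnDr leq_add2r leq_pmull ?orbT.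
Qed.

Lemma ccvg_edgeworth_poly (c_ : nat -> nat -> R) c t :
  (forall i, c_ ^~ i @ \oo --> c i) ->
  ccvg (fun K => edgeworth_poly (c_ K) t) (edgeworth_poly c t).
Proof.
move=> cc; apply: ccvg_sum => k; apply: ccvg_prod => i.
apply: ccvgM; last exact: ccvg_cst.
by apply/ccvgX/ccvgM; [exact: ccvg_real|exact: ccvg_cst].
Qed.

Lemma normc_edgeworth_poly_le c t : 1 <= t -> (forall i, 0 <= c i <= 1) ->
  normc (edgeworth_poly c t) <= #|{ffun 'I_n -> 'I_n.+1}|%:R * t ^+ (3 * n).
Proof.
move=> t1 c01; have t0 : 0 <= t by exact: le_trans t1.
rewrite edgeworth_polyE (le_trans (normc_sum _ _ _)) // mulr_natl -sumr_const.
rewrite big_mkcond ler_sum // => k _; case: ifP => [wk|_]; last exact: exprn_ge0.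
rewrite normcM normcX normcM normc_i !normc_real mulr1 (ger0_norm t0).
have coef_ge0 : 0 <= edgeworth_coef c k.
  by apply: exp_monomial_ge0 => i; have /andP[] := c01 i.
rewrite ger0_norm // -[leRHS]mul1r ler_pM ?exprn_ge0 ?exp_monomial_le1 //.
by rewrite ler_weXn2l // (leq_trans (edgeworth_degree_le k)) // leq_mul2l wk orbT.
Qed.

End edgeworth_poly.

(** * Series of independent random variables *)

Section tail_sums.
Context {R : realType} (v : nat -> R).
Hypotheses (v_ge0 : forall n, 0 <= v n) (v_cvg : cvgn (series v)).

Lemma sum_nat_le_limn_series m n : \sum_(m <= i < n) v i <= limn (series v).
Proof.
have nd_series : nondecreasing_seq (series v) by apply: nondecreasing_series => i _ _.
apply: le_trans (nondecreasing_cvgn_le nd_series v_cvg n); rewrite /series /=.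
have [mn|/ltnW nm] := leqP m n; last by rewrite big_geq // sumr_ge0.
by rewrite [leRHS](@big_cat_nat _ _ _ m) //= lerDr sumr_ge0.
Qed.

Lemma tail_sums_small (e : R) : 0 < e ->
  exists m0, forall m n, (m0 <= m)%N -> \sum_(m <= i < n) v i <= e.
Proof.
move=> e0; have lim_e : limn (series v) - e < limn (series v) by rewrite gtrBl.
have [m0 _ m0P] := cvgr_gt _ v_cvg _ lim_e.
exists m0 => m n mm; have := m0P m mm => /= hm.
have := sum_nat_le_limn_series 0 (maxn m n).
rewrite (@big_cat_nat _ _ _ m) ?leq_maxl //= => hn.
have : \sum_(m <= i < n) v i <= \sum_(m <= i < maxn m n) v i.
  have [//|/ltnW nm] := leqP m n.
  by rewrite big_geq // sumr_ge0.
by rewrite /series /= in hm; lra.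
Qed.

End tail_sums.

Lemma mutually_independent_comp (d : measure_display) (T : measurableType d) (R : realType)
    (P : probability T R) (X : nat -> T -> R) (g : nat -> R -> R) :
  mutually_independent P X -> (forall n, measurable_fun setT (g n)) ->
  mutually_independent P (fun n => g n \o X n).
Proof.
move=> [mX indepX] mg; split=> [n|s B us mB]; first exact: measurableT_comp.
have mgB i : measurable (g i @^-1` B i) by rewrite -[X in measurable X]setTI; exact: mg.
exact: indepX us mgB.
Qed.

Section block_independence.
Context (d : measure_display) (T : measurableType d) (R : realType) (P : probability T R).
Variable X : nat -> T -> R.
Hypothesis indepX : mutually_independent P X.

Let mX n : measurable_fun setT (X n). Proof. by case: indepX => + _; exact. Qed.

Definition rectangles (m k : nat) : set (set T) :=
  [set A | exists2 B : nat -> set R, (forall i, measurable (B i)) &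
     A = \big[setI/setT]_(m <= i < k) (X i @^-1` B i)].

Lemma measurable_rectangles m k A : rectangles m k A -> measurable A.
Proof.
move=> [B mB ->]; apply: bigsetI_measurable => i _.
by rewrite -[X in measurable X]setTI; exact: mX.
Qed.

Lemma rectangles_setI m k : setI_closed (rectangles m k).
Proof.
move=> A1 A2 [B1 mB1 ->] [B2 mB2 ->]; exists (fun i => B1 i `&` B2 i).
  by move=> i; exact: measurableI.
by rewrite -big_split /=; apply: eq_bigr => i _; rewrite preimage_setI.
Qed.

Lemma sigma_rectangles_measurable m k A : <<s rectangles m k >> A -> measurable A.
Proof.
apply: smallest_sub; first exact: sigma_algebra_measurable.
by move=> B; exact: measurable_rectangles.
Qed.

Lemma lambda_system_independent (A : set T) : measurable A ->
  lambda_system setT [set B | measurable B /\ P (A `&` B) = (P A * P B)%E].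
Proof.
move=> mA; apply/dynkin_lambda_system; split => /=.
- by rewrite setIT probability_setT mule1.
- move=> B [mB PAB]; split; first exact: measurableC.
  rewrite -setDE measureD //; last by rewrite (le_lt_trans (probability_le1 _ _)) ?ltry.
  transitivity (P A - P A * P B)%E; first by congr (_ - _)%E; exact: PAB.
  rewrite probability_setC // muleBr ?mule1 //.
  exact: fin_num_measure.
- move=> F tF FP; have mF i := (FP i).1; split; first exact: bigcupT_measurable.
  rewrite setI_bigcupr measure_bigcup //=; last 2 first.
  + by move=> i _; exact: measurableI.
  + by apply: trivIset_setIl.
  rewrite measure_bigcup //=.
  rewrite -(fineK (fin_num_measure P A mA)) -nneseriesZl //.
  by apply: eq_eseriesr => i _; rewrite fineK ?fin_num_measure //; exact: (FP i).2.
Qed.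

Lemma rectangles_independent m k l A B : (m <= k <= l)%N ->
  rectangles m k A -> rectangles k l B -> P (A `&` B) = (P A * P B)%E.
Proof.
move=> /andP[mk kl] [BA mBA ->] [BB mBB ->].
have rectP (i j : nat) (C : nat -> set R) : (forall i, measurable (C i)) ->
   P (\big[setI/setT]_(i <= n < j) (X n @^-1` C n)) = (\prod_(i <= n < j) P (X n @^-1` C n))%E.
  by move=> mC; case: indepX => _ -> //; exact: iota_uniq.
rewrite !rectP //; pose C i := if (i < k)%N then BA i else BB i.
have EA : \big[setI/setT]_(m <= i < k) (X i @^-1` BA i) =
    \big[setI/setT]_(m <= i < k) (X i @^-1` C i).
  by rewrite !big_nat; apply: eq_bigr => i /andP[_ ik]; rewrite /C ik.
have EB : \big[setI/setT]_(k <= i < l) (X i @^-1` BB i) =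
    \big[setI/setT]_(k <= i < l) (X i @^-1` C i).
  by rewrite !big_nat; apply: eq_bigr => i /andP[ik _]; rewrite /C ltnNge ik.
rewrite EA EB -big_cat_nat // rectP; last by move=> i; rewrite /C; case: ifP.
rewrite (@big_cat_nat _ _ _ k) //=; congr (_ * _)%E; rewrite !big_nat; apply: eq_bigr.
  by move=> i /andP[_ ik]; rewrite /C ik.
by move=> i /andP[ik _]; rewrite /C ltnNge ik.
Qed.

Lemma sigma_rectangles_independent m k l A B : (m <= k <= l)%N ->
  <<s rectangles m k >> A -> <<s rectangles k l >> B ->
  P (A `&` B) = (P A * P B)%E.
Proof.
move=> mkl sA sB.
have rectangle_sigma A' B' : rectangles m k A' -> <<s rectangles k l >> B' ->
    P (A' `&` B') = (P A' * P B')%E.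
  move=> rA' sB'; have mA' := measurable_rectangles rA'.
  suff : <<s rectangles k l >> `<=` [set B | measurable B /\ P (A' `&` B) = (P A' * P B)%E].
    by move=> /(_ _ sB')[].
  apply: lambda_system_subset => //; first exact: rectangles_setI.
  - exact: lambda_system_independent.
  - move=> B'' rB''; split; first exact: measurable_rectangles rB''.
    exact: (rectangles_independent mkl rA' rB'').
have mB := sigma_rectangles_measurable sB.
suff : <<s rectangles m k >> `<=` [set A | measurable A /\ P (B `&` A) = (P B * P A)%E].
  by move=> /(_ _ sA)[_]; rewrite setIC muleC.
apply: lambda_system_subset => //; first exact: rectangles_setI.
- exact: lambda_system_independent.
- move=> A' rA'; split; first exact: measurable_rectangles rA'.
  by rewrite setIC rectangle_sigma // muleC.
Qed.

Definition block_measurable m k (f : T -> R) :=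
  @measurable_fun _ _ (g_sigma_algebraType (rectangles m k)) R setT f.

Lemma block_measurable_coord m k i : (m <= i < k)%N -> block_measurable m k (X i).
Proof.
move=> mik _ B mB; rewrite setTI; apply: sub_sigma_algebra.
exists (fun j => if j == i then B else setT); first by move=> j; case: ifP.
rewrite (bigD1_seq i) ?iota_uniq ?mem_index_iota //= eqxx big1 ?setIT //.
by move=> j /negbTE ->; rewrite preimage_setT.
Qed.

Definition psum m k w := \sum_(m <= i < k) X i w.

Lemma psum_geq m k w : (k <= m)%N -> psum m k w = 0.
Proof. by move=> km; rewrite /psum big_geq. Qed.

Lemma psum_recr m k w : (m <= k)%N -> psum m k.+1 w = psum m k w + X k w.
Proof. by move=> mk; rewrite /psum big_nat_recr. Qed.

Lemma psum_cat m k l w : (m <= k <= l)%N -> psum m l w = psum m k w + psum k l w.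
Proof. by move=> /andP[mk kl]; rewrite /psum (@big_cat_nat _ _ _ k). Qed.

Lemma block_measurable_psum m k (a b : nat) : (m <= a)%N -> (b <= k)%N ->
  block_measurable m k (psum a b).
Proof.
move=> ma bk; rewrite /block_measurable /psum /index_iota.
have : forall i, i \in iota a (b - a) -> (m <= i < k)%N.
  by move=> i; rewrite mem_iota => /andP[ai ib]; lia.
elim: (iota a (b - a)) => [|i s ih] imk.
  by under eq_fun do rewrite big_nil; exact: measurable_cst.
under eq_fun do rewrite big_cons; apply: measurable_funD.
  by apply: block_measurable_coord; apply: imk; rewrite inE eqxx.
by apply: ih => j js; apply: imk; rewrite inE js orbT.
Qed.

Lemma block_preimage m k f (B : set R) : block_measurable m k f -> measurable B ->
  <<s rectangles m k >> (f @^-1` B).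
Proof. by move=> mf mB; rewrite -[f @^-1` B]setTI; exact: mf. Qed.

Lemma measurable_psum m k : measurable_fun setT (psum m k).
Proof.
move=> _ B mB; rewrite setTI; apply: (sigma_rectangles_measurable (m := m) (k := k)).
by apply: block_preimage => //; exact: block_measurable_psum.
Qed.

Lemma psum_independent_next m k : (m <= k)%N -> independent_pair P (psum m k) (X k).
Proof.
move=> mk A B mA mB.
apply: (sigma_rectangles_independent (m := m) (k := k) (l := k.+1)).
- by rewrite mk leqnSn.
- by apply: block_preimage => //; exact: block_measurable_psum.
- by apply: block_preimage => //; apply: block_measurable_coord; rewrite leqnn ltnSn.
Qed.

Lemma char_fun_psum m k t : char_fun P (psum m k) t = \prod_(m <= i < k) char_fun P (X i) t.
Proof.
have psum_nil j : (j <= m)%N -> char_fun P (psum m j) t = 1.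
  move=> jm; rewrite (_ : psum m j = fun w => 0 * X 0 w).
    by rewrite char_funZ mulr0 char_fun0.
  by apply/funext => w; rewrite psum_geq // mul0r.
elim: k => [|k ih]; first by rewrite big_geq // psum_nil.
have [mk|km] := leqP m k; last by rewrite big_geq // psum_nil.
have -> : psum m k.+1 = fun w => psum m k w + X k w.
  by apply/funext => w; rewrite psum_recr.
rewrite big_nat_recr //= -ih char_fun_independentD //.
  exact: measurable_psum.
exact: psum_independent_next.
Qed.

Definition exceed (e : R) m k := [set w | e < `|psum m k w|].

Lemma block_exceed e m k a b : (m <= a)%N -> (b <= k)%N ->
  <<s rectangles m k >> (exceed e a b).
Proof.
move=> ma bk; rewrite (_ : exceed e a b = psum a b @^-1` (~` `[- e, e])); last first.
  by apply/seteqP; split => w /=; rewrite /exceed /= in_itv /= -ler_norml ltNge => /negP.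
by apply: block_preimage; [exact: block_measurable_psum|exact: measurableC].
Qed.

Lemma measurable_exceed e m k : measurable (exceed e m k).
Proof. exact: (sigma_rectangles_measurable (block_exceed e (leqnn m) (leqnn k))). Qed.

End block_independence.

Section random_series.
Context (d : measure_display) (T : measurableType d) (R : realType) (P : probability T R).
Variables (Z : nat -> T -> R) (v : nat -> R).
Hypothesis indepZ : mutually_independent P Z.
Hypothesis iZ : forall n, P.-integrable setT (EFin \o Z n).
Hypothesis iZ2 : forall n, P.-integrable setT (fun w => (Z n w ^+ 2)%:E).
Hypothesis meanZ : forall n, \int[P]_w Z n w = 0.
Hypothesis varZ : forall n, \int[P]_w (Z n w ^+ 2) = v n.

Local Notation psum := (psum Z).
Local Notation exceed := (exceed Z).

Lemma variance_ge0 n : 0 <= v n.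
Proof. by rewrite -varZ; apply: Rintegral_ge0 => w _; exact: sqr_ge0. Qed.

Lemma psum_moments m j :
  [/\ P.-integrable setT (EFin \o psum m (m + j)),
      P.-integrable setT (fun w => (psum m (m + j) w ^+ 2)%:E) &
      \int[P]_w (psum m (m + j) w ^+ 2) = \sum_(m <= i < m + j) v i].
Proof.
elim: j => [|j [i1 i2 E2]].
  have psum0 : psum m (m + 0) = cst 0 by apply/funext => w; rewrite psum_geq ?addn0.
  rewrite psum0 addn0 big_geq // /cst expr0n Rintegral_cst // mul0r.
  by split => //; exact: integrable0.
rewrite addnS; set k := (m + j)%N in i1 i2 E2 *; have mk : (m <= k)%N := leq_addr _ _.
have ind := psum_independent_next indepZ mk.
have iM := integrable_independentM i1 (iZ k) ind.
have iM2 := integrableZl_EFin 2 measurableT iM.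
have iM2Z : P.-integrable setT (EFin \o (fun w => 2 * (psum m k w * Z k w) + Z k w ^+ 2)).
  exact: (integrableD measurableT iM2 (iZ2 k)).
have sqrE w : psum m k.+1 w ^+ 2 =
    psum m k w ^+ 2 + (2 * (psum m k w * Z k w) + Z k w ^+ 2).
  by rewrite psum_recr //; ring.
split.
- rewrite (_ : _ \o _ = EFin \o (fun w => psum m k w + Z k w)); last first.
    by apply/funext => w /=; rewrite psum_recr.
  exact: (integrableD measurableT i1 (iZ k)).
- under eq_fun do rewrite sqrE.
  exact: (integrableD measurableT i2 iM2Z).
- under eq_Rintegral do rewrite sqrE.
  rewrite (RintegralD measurableT i2 iM2Z) (RintegralD measurableT iM2 (iZ2 k)).
  rewrite RintegralZl // E2 varZ.
  by rewrite (Rintegral_independentM i1 (iZ k) ind) meanZ !mulr0 add0r big_nat_recr.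
Qed.

Lemma psum_chebyshev m k e : (m <= k)%N -> 0 < e ->
  (P (exceed e m k) <= ((\sum_(m <= i < k) v i) / e ^+ 2)%:E)%E.
Proof.
move=> mk e0; have [_] := psum_moments m (k - m); rewrite subnKC // => i2 E2.
set A := exceed e m k; have mA : measurable A by exact: (measurable_exceed indepZ).
rewrite mulrC EFinM lee_pdivlMl ?exprn_gt0 // -integral_cst // -E2 /Rintegral.
rewrite fineK; last exact: integrable_fin_num.
have mS : measurable_fun setT (fun w => (psum m k w ^+ 2)%:E) by have /measurable_int := i2.
apply: (@le_trans _ _ (\int[P]_(w in A) (psum m k w ^+ 2)%:E)%E).
  apply: ge0_le_integral => //=.
  - by move=> w _; rewrite lee_fin sqr_ge0.
  - exact: measurable_funTS.
  - move=> w /= ew; rewrite lee_fin -[leRHS]real_normK ?num_real //.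
    by rewrite lerXn2r ?nnegrE // ltW.
apply: ge0_subset_integral => //.
by move=> w _; rewrite lee_fin sqr_ge0.
Qed.

Lemma prob_small_increment m k e : (m <= k)%N -> 0 < e ->
  \sum_(m <= i < k) v i <= e ^+ 2 / 2 -> (2^-1%:E <= P (~` exceed e m k))%E.
Proof.
move=> mk e0 Ve; have mE := measurable_exceed indepZ e m k.
rewrite probability_setC //; have := psum_chebyshev mk e0.
rewrite -(fineK (fin_num_measure P _ mE)) -EFinB !lee_fin => /le_trans bnd.
have : fine (P (exceed e m k)) <= 2^-1.
  by apply: bnd; rewrite ler_pdivrMr ?exprn_gt0 // mulrC.
by move=> h; lra.
Qed.

Section first_exceedance.
Variables (m n : nat) (e : R).
Hypotheses (mn : (m <= n)%N) (e0 : 0 < e) (small_variance : \sum_(m <= i < n) v i <= e ^+ 2 / 2).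

Let exceed2 j := exceed (2 * e) m (m + j).
Let first_exceed := seqDU exceed2.
Let small_after j := ~` exceed e (m + j) n.

Let block_first_exceed j : <<s rectangles Z m (m + j) >> (first_exceed j).
Proof.
apply: (@measurableD _ (g_sigma_algebraType (rectangles Z m (m + j)))).
  exact: block_exceed.
apply: (@bigsetU_measurable _ (g_sigma_algebraType (rectangles Z m (m + j)))) => i _.
by apply: block_exceed => //; rewrite leq_add2l ltnW.
Qed.

Let measurable_first_exceed j : measurable (first_exceed j).
Proof. exact: (sigma_rectangles_measurable indepZ (@block_first_exceed j)). Qed.

Let measurable_small_after j : measurable (small_after j).
Proof. by apply: measurableC; exact: (measurable_exceed indepZ). Qed.

Let index_le (j : 'I_(n - m).+1) : (m + j <= n)%N.
Proof. by have := ltn_ord j; rewrite ltnS => jn; rewrite -leq_subRL. Qed.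

Let prob_small_after (j : 'I_(n - m).+1) : (2^-1%:E <= P (small_after j))%E.
Proof.
apply: prob_small_increment => //; apply: le_trans small_variance.
rewrite [leRHS](@big_cat_nat _ _ _ (m + j)) ?leq_addr //= lerDr sumr_ge0 // => i _.
exact: variance_ge0.
Qed.

Let first_exceed_small_after (j : 'I_(n - m).+1) :
  first_exceed j `&` small_after j `<=` exceed e m n.
Proof.
move=> w [[/= exceed_j _]]; rewrite /small_after /= => /negP; rewrite -leNgt => small_j.
rewrite /exceed /= (@psum_cat _ _ _ Z m (m + j) n) ?leq_addr ?index_le //.
have := lerB_normD (psum m (m + j) w) (psum (m + j) n w).
by move: exceed_j small_j; rewrite /exceed2 /exceed /=; lra.
Qed.

Let sum_first_exceed_small_after_le :
  (\sum_(i < (n - m).+1) P (first_exceed i `&` small_after i) <=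
   ((\sum_(m <= i < n) v i) / e ^+ 2)%:E)%E.
Proof.
rewrite -(@measure_bigsetU _ _ _ P (fun i => first_exceed i `&` small_after i)); last 2 first.
- by move=> i; exact: measurableI.
- by apply: trivIset_setIr; exact: trivIset_seqDU.
apply: le_trans (psum_chebyshev mn e0); apply: le_measure.
- by rewrite inE; apply: bigsetU_measurable => i _; exact: measurableI.
- by rewrite inE; exact: (measurable_exceed indepZ).
- rewrite -(bigcup_mkord _ (fun i => first_exceed i `&` small_after i)) => w [i /= il].
  exact: (first_exceed_small_after (j := Ordinal il)).
Qed.

Let half_sum_first_exceed_le : (2^-1%:E * \sum_(i < (n - m).+1) P (first_exceed i) <=
  \sum_(i < (n - m).+1) P (first_exceed i `&` small_after i))%E.
Proof.
rewrite ge0_sume_distrr //; apply: lee_sum => i _.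
rewrite (sigma_rectangles_independent indepZ (m := m) (k := m + i) (l := n)).
- by rewrite muleC lee_wpmul2l // prob_small_after.
- by rewrite leq_addr index_le.
- exact: block_first_exceed.
- apply: (@measurableC _ (g_sigma_algebraType (rectangles Z (m + i) n))).
  exact: block_exceed.
Qed.

(* At the first time [|psum m _|] exceeds [2 e], independence of the remaining increment
   gives probability at least [1 / 2] to [|psum m n| > e]. *)
Lemma ottaviani : (P (\big[setU/set0]_(j < (n - m).+1) exceed (2 * e) m (m + j)) <=
  (2 * (\sum_(m <= i < n) v i) / e ^+ 2)%:E)%E.
Proof.
rewrite (bigsetU_seqDU exceed2) (measure_bigsetU _ measurable_first_exceed); last first.
  exact: trivIset_seqDU.
have := le_trans half_sum_first_exceed_le sum_first_exceed_small_after_le.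
by rewrite lee_pdivrMl // -EFinM mulrA.
Qed.

End first_exceedance.

Definition tail_exceed e m := \bigcup_j exceed e m (m + j).

Lemma measurable_tail_exceed e m : measurable (tail_exceed e m).
Proof. by apply: bigcupT_measurable => j; exact: (measurable_exceed indepZ). Qed.

Lemma prob_tail_exceed_le m e delta : 0 < e ->
  (forall n, \sum_(m <= i < n) v i <= delta) -> delta <= e ^+ 2 / 2 ->
  (P (tail_exceed (2 * e) m) <= (2 * delta / e ^+ 2)%:E)%E.
Proof.
move=> e0 vd de; rewrite /tail_exceed -bigcup_bigsetU_bigcup.
pose F j := \big[setU/set0]_(i < j.+1) exceed (2 * e) m (m + i).
have mF j : measurable (F j).
  by apply: bigsetU_measurable => i _; exact: (measurable_exceed indepZ).
have ndF : {homo F : i j / (i <= j)%N >-> (i <= j)%O}.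
  move=> i j ij; apply/subsetPset.
  exact: (subset_bigsetU (F := fun i => exceed (2 * e) m (m + i))).
have cvgF : (P \o F) x @[x --> \oo] --> P (\bigcup_n F n).
  by apply: nondecreasing_cvg_mu => //; exact: bigcupT_measurable.
rewrite -(cvg_lim _ cvgF) //.
apply: lime_le; first by apply: cvgP; exact: cvgF.
apply: nearW => j; have mj := leq_addr j m.
have := ottaviani mj e0 (le_trans (vd _) de); rewrite addKn.
move=> /le_trans; apply; rewrite lee_fin ler_wpM2r ?invr_ge0 ?sqr_ge0 //.
by rewrite ler_wpM2l.
Qed.

Hypothesis v_cvg : cvgn (series v).

Definition divergence_set := \bigcup_p \bigcap_m tail_exceed (2 * p.+1%:R^-1) m.

Let measurable_bigcap_tail_exceed e : measurable (\bigcap_m tail_exceed e m).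
Proof. by apply: bigcapT_measurable => m; exact: measurable_tail_exceed. Qed.

Lemma measurable_divergence_set : measurable divergence_set.
Proof. by apply: bigcupT_measurable. Qed.

Lemma divergence_set_null : P divergence_set = 0%E.
Proof.
apply/(negligibleP _ measurable_divergence_set); apply: negligible_bigcup => p.
apply/negligibleP => //; apply/eqP; rewrite eq_le measure_ge0 andbT.
apply/lee_addgt0Pr => x x0; rewrite add0e.
set e : R := p.+1%:R^-1; have e0 : 0 < e by rewrite invr_gt0.
pose delta := Num.min (e ^+ 2 / 2) (x * e ^+ 2 / 2).
have d0 : 0 < delta by rewrite lt_min !divr_gt0 ?mulr_gt0 ?exprn_gt0.
have [m0 m0P] := tail_sums_small variance_ge0 v_cvg d0.
apply: (@le_trans _ _ (P (tail_exceed (2 * e) m0))).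
  apply: le_measure; rewrite ?inE //; first exact: measurable_tail_exceed.
  by move=> w /(_ m0 I).
apply: le_trans (prob_tail_exceed_le e0 (fun n => m0P m0 n (leqnn _)) _) _.
  by rewrite /delta ge_min lexx.
rewrite lee_fin ler_pdivrMr ?exprn_gt0 // mulrC -ler_pdivlMr //.
by rewrite /delta ge_min lexx orbT.
Qed.

Lemma cvgn_psum_notin_divergence M w : cvgn (fun K => psum M K w) -> ~ divergence_set w.
Proof.
move=> /cvg_ex[l /= /cvgrPdist_lt psum_l] [p _ exceed_w].
have e0 : (0 : R) < p.+1%:R^-1 by rewrite invr_gt0.
have [m0 _ m0P] := psum_l _ e0.
pose m := maxn m0 M; have [j _] := exceed_w m I.
rewrite /exceed /=; apply/negP; rewrite -leNgt.
have near_m := m0P m (leq_maxl _ _).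
have near_mj : `|l - psum M (m + j) w| < p.+1%:R^-1.
  by apply: m0P => /=; rewrite (leq_trans (leq_maxl m0 M)) // leq_addr.
have -> : psum m (m + j) w = (l - psum M m w) - (l - psum M (m + j) w).
  by rewrite (@psum_cat _ _ _ Z M m (m + j)) ?leq_maxr ?leq_addr //; ring.
by rewrite (le_trans (ler_normB _ _)) // mulr_natl mulr2n ltW // ltrD.
Qed.

Lemma notin_divergence_cvgn_psum M w : ~ divergence_set w -> cvgn (fun K => psum M K w).
Proof.
move=> Nw; apply/cauchy_cvgP/cauchy_exP => e e0.
have [p pe] : exists p, 2 * p.+1%:R^-1 < e :> R.
  near \oo => p; exists p; rewrite mulrC ltr_pdivrMl // -ltr_pdivrMr //.
  apply: (@lt_trans _ _ p%:R); last by rewrite ltr_nat.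
  by near: p; exact: nbhs_infty_gtr.
have [m mP] : exists m, forall j, `|psum m (m + j) w| <= 2 * p.+1%:R^-1.
  apply: contrapT => /forallNP h; apply: Nw; exists p => // m _.
  by have /existsNP[j /negP] := h m; rewrite -ltNge => ?; exists j.
pose x := if (M <= m)%N then psum M m w else - psum m M w.
exists x; exists (maxn m M) => // K /=; rewrite geq_max => /andP[mK MK].
rewrite /ball /= (_ : x - psum M K w = - psum m K w).
  by rewrite normrN (le_lt_trans _ pe) // -(subnKC mK).
rewrite /x; case: ifPn => [Mm|].
  by rewrite (@psum_cat _ _ _ Z M m K) ?Mm //; ring.
by rewrite -ltnNge => /ltnW mM; rewrite (@psum_cat _ _ _ Z m M K) ?mM //; ring.
Unshelve. all: by end_near. Qed.

Definition series_lim M w := limn (fun K => psum M K w).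

Lemma measurable_series_lim M : measurable_fun setT (series_lim M).
Proof.
have mN := measurable_divergence_set.
rewrite -(setUv divergence_set); apply/measurable_funU => //; first exact: measurableC.
split.
  apply: (@eq_measurable_fun _ _ _ _ _ (fun=> point)) => [w|]; last exact: measurable_cst.
  rewrite inE => Nw; apply/esym/dvgP.
  by move=> /cvgn_psum_notin_divergence.
apply: (@measurable_fun_cvg _ _ _ _ (psum M)).
  by move=> K; apply: measurable_funTS; exact: (measurable_psum indepZ).
by move=> w /(@notin_divergence_cvgn_psum M).
Qed.

Lemma ae_cvg_series_lim M :
  {ae P, forall w, setT w -> psum M K w @[K --> \oo] --> series_lim M w}.
Proof.
exists divergence_set; split; [exact: measurable_divergence_set|exact: divergence_set_null|].
by move=> w /= /not_implyP[_ h]; apply: contrapT => /(@notin_divergence_cvgn_psum M).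
Qed.

Lemma cvg_expectation_series M (h : R -> R) : continuous h -> (forall x, `|h x| <= 1) ->
  \int[P]_w h (psum M K w) @[K --> \oo] --> \int[P]_w h (series_lim M w).
Proof.
move=> ch h1; have mh : measurable_fun setT h by exact: continuous_measurable_fun.
have mhS K : measurable_fun setT (fun w => (h (psum M K w))%:E).
  by apply/measurable_EFinP; apply: measurableT_comp => //; exact: (measurable_psum indepZ).
have mhL : measurable_fun setT (fun w => (h (series_lim M w))%:E).
  by apply/measurable_EFinP; apply: measurableT_comp => //; exact: measurable_series_lim.
have i1 : P.-integrable setT (cst 1%:E) by exact: finite_measure_integrable_cst.
have hae : {ae P, forall w, setT w ->
    (h (psum M K w))%:E @[K --> \oo] --> (h (series_lim M w))%:E}.
  apply: filterS (ae_cvg_series_lim M) => w /(_ I) cw _.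
  by apply: cvg_EFin; [exact: nearW|apply: continuous_cvg => //; exact: ch].
have hb : {ae P, forall w K, setT w -> (`|(h (psum M K w))%:E| <= cst 1%:E w)%E}.
  by apply: aeW => w K _; rewrite /= lee_fin.
have [hi _ hc] := dominated_convergence measurableT mhS mhL hae i1 hb.
by apply: fine_cvg; rewrite fineK //; exact: integrable_fin_num.
Qed.

Lemma ccvg_char_fun_series M t :
  ccvg (fun K => char_fun P (psum M K) t) (char_fun P (series_lim M) t).
Proof.
have trig (h : R -> R) : continuous h -> (forall x, `|h x| <= 1) ->
    \int[P]_w h (t * psum M K w) @[K --> \oo] --> \int[P]_w h (t * series_lim M w).
  move=> ch h1; apply: (cvg_expectation_series (h := fun x => h (t * x))) => // x.
  apply: (@continuous_comp _ _ _ (fun x : R => t * x) h); last exact: ch.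
  by apply: cvgMr; exact: cvg_id.
split; under eq_fun do rewrite char_funE /=; rewrite char_funE /=.
  by apply: trig; [exact: continuous_cos|exact: cos_max].
by apply: trig; [exact: continuous_sin|exact: sin_max].
Qed.

Lemma integral_abs_psum_le m j :
  (\int[P]_w `|psum m (m + j) w|%:E <= (1 + limn (series v))%:E)%E.
Proof.
have [i1 i2 E2] := psum_moments m j.
have mS := measurable_psum indepZ m (m + j).
apply: (@le_trans _ _ (\int[P]_w (1 + (psum m (m + j) w ^+ 2)%:E))%E).
  apply: ge0_le_integral => //.
  - by apply/measurable_EFinP; exact: measurableT_comp.
  - by apply: emeasurable_funD => //; have /measurable_int := i2.
  - move=> w _; rewrite -EFinD lee_fin -[X in _ + X]real_normK ?num_real //.
    by set y := `|_|; have := sqr_ge0 (y - 1); nra.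
rewrite ge0_integralD //; last 2 first.
- by move=> w _; rewrite lee_fin sqr_ge0.
- by have /measurable_int := i2.
have -> : (\int[P]__ 1 = 1)%E by rewrite integral_cst // mul1e; exact: probability_setT.
rewrite -[X in (_ + X)%E]fineK; last exact: integrable_fin_num.
rewrite -/(Rintegral _ _ _) E2 -EFinD lee_fin lerD2l.
by apply: sum_nat_le_limn_series => // n; exact: variance_ge0.
Qed.

Lemma integrable_series_lim M : P.-integrable setT (EFin \o series_lim M).
Proof.
have mN := measurable_divergence_set; have mNC := measurableC mN.
have mY : measurable_fun setT (EFin \o series_lim M).
  by apply/measurable_EFinP; exact: measurable_series_lim.
apply/(negligible_integrable mN measurableT mY divergence_set_null).
rewrite setTD; apply/integrableP; split; first exact: measurable_funTS.
pose f j w := `|psum M (M + j) w|%:E.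
have mf j : measurable_fun setT (f j).
  apply/measurable_EFinP.
  by apply: measurableT_comp; [exact: normr_measurable|exact: (measurable_psum indepZ)].
have f0 j w : (0 <= f j w)%E by rewrite lee_fin.
have := fatou P mNC (fun j => measurable_funTS (mf j)) (fun j w _ => f0 j w).
rewrite (eq_integral (fun w => `|(EFin \o series_lim M) w|%E)); last first.
  move=> w; rewrite inE => /(@notin_divergence_cvgn_psum M) cw.
  have fw : f j w @[j --> \oo] --> `|series_lim M w|%:E.
    apply: cvg_EFin; first exact: nearW.
    by apply: cvg_norm; under eq_fun do rewrite addnC; move: cw; rewrite -(cvg_shiftn M).
  by rewrite is_cvg_limn_einfE; [exact/cvg_lim|apply/cvg_ex; eexists; exact: fw].
move=> /le_lt_trans; apply; apply: (@le_lt_trans _ _ (1 + limn (series v))%:E); last exact: ltry.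
rewrite limn_einf_lim; apply: lime_le; first exact: is_cvg_einfs.
apply: nearW => j; apply: (@le_trans _ _ (\int[P]_(w in ~` divergence_set) f j w)%E).
  by apply: ereal_inf_lbound; exists j => /=.
apply: le_trans (integral_abs_psum_le M j).
by apply: ge0_subset_integral.
Qed.

End random_series.

(** * The gamma law *)

Section density.
Local Open Scope ereal_scope.
Context (d : measure_display) (T : measurableType d) (R : realType).
Variables (mu nu : {measure set T -> \bar R}) (g : T -> R).
Hypotheses (g0 : forall x, (0 <= g x)%R) (mg : measurable_fun setT g).
Hypothesis nuE : forall A, measurable A -> nu A = \int[mu]_(x in A) (g x)%:E.

Import HBNNSimple.

Let integral_density_nnsfun (h : {nnsfun T >-> R}) :
  \int[nu]_x (h x)%:E = \int[mu]_x ((h x)%:E * (g x)%:E).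
Proof.
transitivity (\sum_(k \in range h) k%:E * nu (h @^-1` [set k])).
  by rewrite integralT_nnsfun sintegralE.
have mfib k : measurable (h @^-1` [set k]) by exact: measurable_funPTI.
have indicE' k x : (k * \1_(h @^-1` [set k]) x)%:E * (g x)%:E =
   k%:E * ((fun x => (g x)%:E) \_ (h @^-1` [set k])) x.
  rewrite patchE indicE; case: ifPn => _ /=; first by rewrite mulr1.
  by rewrite mulr0 mul0e mule0.
transitivity (\sum_(k \in range h) \int[mu]_x
    (k%:E * ((fun x => (g x)%:E) \_ (h @^-1` [set k])) x)); last first.
  rewrite -ge0_integral_fsum //; last 2 first.
  - move=> k; apply: measurable_funeM; apply/(measurable_restrict _ _ _) => //.
    by apply: measurable_funTS; exact/measurable_EFinP.
  - move=> k x _; rewrite -indicE' -EFinM lee_fin mulr_ge0 //.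
    exact: nnfun_muleindic_ge0.
  apply: eq_integral => x _; rewrite [in RHS]fimfunE -fsumEFin //.
  rewrite ge0_mule_fsuml; last by move=> k; exact: nnfun_muleindic_ge0.
  by apply: eq_fsbigr => k _; rewrite -indicE'.
apply: eq_fsbigr => k; rewrite inE => -[y _ <-].
rewrite ge0_integralZl //=; last 3 first.
- apply/(measurable_restrict _ _ _) => //.
  by apply: measurable_funTS; exact/measurable_EFinP.
- by move=> x _; rewrite patchE; case: ifPn => // _; rewrite lee_fin.
- by rewrite lee_fin.
by rewrite nuE // -integral_mkcond.
Qed.

Lemma ge0_integral_density (h : T -> \bar R) : measurable_fun setT h ->
  (forall x, 0 <= h x) -> \int[nu]_x h x = \int[mu]_x (h x * (g x)%:E).
Proof.
move=> mh h0; pose f_ := nnsfun_approx measurableT mh.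
transitivity (limn (fun n => \int[nu]_x (f_ n x)%:E)).
  rewrite -monotone_convergence //.
  - apply: eq_integral => y _; apply/esym/cvg_lim => //.
    by apply: cvg_nnsfun_approx.
  - by move=> n; exact/measurable_EFinP/measurable_funP.
  - by move=> n y _; rewrite lee_fin.
  - by move=> y _ m n mn; rewrite lee_fin; exact/lefP/nd_nnsfun_approx.
rewrite [X in limn X](_ : _ = (fun n => \int[mu]_x ((f_ n x)%:E * (g x)%:E))); last first.
  by apply/funext => n; exact: integral_density_nnsfun.
rewrite -monotone_convergence //; last 3 first.
- move=> n; apply: emeasurable_funM; last exact/measurable_EFinP.
  by apply/measurable_EFinP/measurable_funP.
- by move=> n x _; rewrite mule_ge0 // lee_fin.
- move=> x _ m n mn; rewrite lee_wpmul2r ?lee_fin //.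
  exact/lefP/nd_nnsfun_approx.
apply: eq_integral => x _; apply/cvg_lim => //.
by apply: cvgeMr => //; apply: cvg_nnsfun_approx.
Qed.

End density.

Section law_with_density.
Context (R : realType) (d : measure_display) (T : measurableType d) (P : probability T R).
Local Notation mu := (@lebesgue_measure R).
Variables (X : T -> R) (D : set R) (g : R -> R).
Hypotheses (mX : measurable_fun setT X) (mD : measurable D).
Hypotheses (g0 : forall x, 0 <= g x) (mg : measurable_fun setT g).
Hypothesis lawX : forall B : set R, measurable B ->
  P (X @^-1` B) = (\int[mu]_(x in B `&` D) (g x)%:E)%E.

Let X' : {RV P >-> measurableTypeR R} :=
  HB.pack (X : T -> measurableTypeR R)
    (isMeasurableFun.Build _ _ _ (measurableTypeR R) X mX).

Lemma ge0_expectation_density (h : R -> R) : measurable_fun setT h -> (forall x, 0 <= h x) ->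
  (\int[P]_v (h (X v))%:E = \int[mu]_(x in D) (h x * g x)%:E)%E.
Proof.
move=> mh h0.
transitivity (\int[distribution P X']_x (h x)%:E)%E.
  by rewrite (ge0_integral_distribution X') //; exact/measurable_EFinP.
rewrite (@ge0_integral_density _ _ _ mu (distribution P X') (g \_ D)) //.
- rewrite [RHS]integral_mkcond; apply: eq_integral => x _.
  by rewrite /patch; case: ifPn => _ //; rewrite mule0.
- by move=> x; rewrite patchE; case: ifPn.
- by apply/(measurable_restrict _ _ _) => //; exact: measurable_funTS.
- move=> A mA; transitivity (P (X @^-1` A)) => //; rewrite lawX // integral_mkcondr.
  by apply: eq_integral => x _; rewrite /patch; case: ifPn.
- exact/measurable_EFinP.
Qed.

Lemma integrable_density (h : R -> R) : measurable_fun setT h ->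
  mu.-integrable D (fun x => (h x * g x)%:E) -> P.-integrable setT (fun v => (h (X v))%:E).
Proof.
move=> mh /integrableP[_ finite]; apply/integrableP; split.
  by apply/measurable_EFinP; exact: measurableT_comp.
rewrite (@ge0_expectation_density (fun x => `|h x|)) //; last exact: measurableT_comp.
by under eq_integral do rewrite -[X in _ * X]ger0_norm // -normrM.
Qed.

Lemma expectation_density (h : R -> R) : measurable_fun setT h ->
  \int[P]_v h (X v) = \int[mu]_(x in D) (h x * g x).
Proof.
move=> mh; rewrite /Rintegral integralE [in RHS]integralE; congr (fine (_ - _)).
  rewrite (_ : (fun v => (h (X v))%:E)^\+%E = fun v => (Num.max (h (X v)) 0)%:E); last first.
    by apply/funext => v; rewrite funeposE EFin_max.
  rewrite (@ge0_expectation_density (fun x => Num.max (h x) 0)) //.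
  - by apply: eq_integral => x _; rewrite funeposE -EFin_max maxr_pMl // mul0r.
  - exact: measurable_maxr.
  - by move=> x; rewrite le_max lexx orbT.
rewrite (_ : (fun v => (h (X v))%:E)^\-%E = fun v => (Num.max (- h (X v)) 0)%:E); last first.
  by apply/funext => v; rewrite funenegE EFin_max EFinN.
rewrite (@ge0_expectation_density (fun x => Num.max (- h x) 0)) //.
- by apply: eq_integral => x _; rewrite funenegE -EFinN -EFin_max maxr_pMl // mul0r mulNr.
- by apply: measurable_maxr => //; exact: measurableT_comp.
- by move=> x; rewrite le_max lexx orbT.
Qed.

End law_with_density.

Section gamma_weight.
Context {R : realType}.
Implicit Types (s b x : R).
Local Notation mu := (@lebesgue_measure R).

Definition gamma_weight b s x := x `^ s * expR (- (b * x)).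

Lemma gamma_weight_ge0 b s x : 0 <= gamma_weight b s x.
Proof. by rewrite mulr_ge0 ?powR_ge0 ?expR_ge0. Qed.

Lemma measurable_gamma_weight b s : measurable_fun setT (gamma_weight b s).
Proof.
apply: measurable_funM; first exact: measurable_powR.
by apply: measurableT_comp => //; apply: measurableT_comp => //; exact: measurable_funM.
Qed.

Lemma gamma_weightS b s x : 0 < x -> gamma_weight b (s + 1) x = x * gamma_weight b s x.
Proof.
move=> x0; rewrite /gamma_weight powRD; last by rewrite (gt_eqF x0) implybT.
by rewrite powRr1 ?(ltW x0) // mulrA [x * _]mulrC.
Qed.

Lemma is_derive_gamma_weight b s x : 0 < x ->
  is_derive x 1 (gamma_weight b (s + 1))
    ((s + 1) * gamma_weight b s x - b * gamma_weight b (s + 1) x).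
Proof.
move=> x0; have hp := is_derive1_powR (s + 1) x0.
have he := is_derive_expR_comp (is_deriveN (is_derive_mull_id b x)).
by apply: (is_derive_eq (is_derive_mulf hp he)); rewrite /gamma_weight addrK; ring.
Qed.

Lemma continuous_gamma_weight b s x : 0 < x -> {for x, continuous (gamma_weight b s)}.
Proof.
move=> x0; have := is_derive_gamma_weight b (s - 1) x0; rewrite subrK.
exact: is_derive_continuous.
Qed.

Lemma gamma_weight_bounded b s : 0 < b -> 0 <= s ->
  exists2 C : R, 0 <= C & forall x, 0 < x -> gamma_weight b s x <= C.
Proof.
move=> b0 s0; pose m := Num.bound s.
have sm : s <= m%:R by exact/ltW/archi_boundP.
have [C C0 CP] := poly_expRN_bounded (1 + 'X^m) b0; exists C => // x x0.
apply: le_trans (CP x (ltW x0)); rewrite ler_wpM2r ?expR_ge0 // !hornerE.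
have xm0 : 0 <= x ^+ m by rewrite exprn_ge0 // ltW.
rewrite ger0_norm ?addr_ge0 //; have [x1|/ltW x1] := leP x 1.
  by rewrite (@le_trans _ _ 1) ?lerDl // -[leRHS](powRr0 x) ger_powR // x0.
by rewrite (@le_trans _ _ (x ^+ m)) ?lerDr // -(powR_mulrn m (ltW x0)) ler_powR.
Qed.

Lemma cvg_gamma_weight0 b s : 0 < s -> gamma_weight b s x @[x --> 0^'+] --> 0.
Proof.
move=> s0; rewrite -[X in _ --> X](mul0r (expR (- (b * 0)))).
apply: cvgM; first exact: powR_cvg0.
apply: cvg_at_right_filter; apply: continuous_cvg; first exact: continuous_expR.
by apply: cvgN; apply: cvgMr; exact: cvg_id.
Qed.

Lemma cvg_gamma_weighty b s : 0 < b -> 0 <= s -> gamma_weight b s x @[x --> +oo] --> 0.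
Proof.
move=> b0 s0; have [|C C0 CP] := @gamma_weight_bounded b (s + 1) b0; first exact: addr_ge0.
apply/cvgr0Pnorm_le => e e0; near=> x.
have x0 : 0 < x by near: x; exact: nbhs_pinfty_gt.
rewrite ger0_norm ?gamma_weight_ge0 // -(ler_pM2l x0) -gamma_weightS // (le_trans (CP x x0)) //.
rewrite -ler_pdivrMr //; near: x; apply: nbhs_pinfty_ge; exact: num_real.
Unshelve. all: by end_near. Qed.

(* [gamma_weight b s] is dominated by the derivative of
   [(gamma_weight b (s + 1) x - 2 C expR (- (b / 2) x)) / (s + 1)], where [C] bounds
   [gamma_weight (b / 2) (s + 1)]. *)
Lemma gamma_weight_integrable b s : 0 < b -> - 1 < s ->
  mu.-integrable `]0, +oo[ (EFin \o gamma_weight b s).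
Proof.
move=> b0; rewrite -subr_gt0 opprK => s0; have b2 : 0 < b / 2 by rewrite divr_gt0.
have [C C0 CP] := gamma_weight_bounded b2 (ltW s0).
pose F x := (s + 1)^-1 * (gamma_weight b (s + 1) x - 2 * C * expR (- (b / 2 * x))).
pose f x := gamma_weight b s x +
  b / (s + 1) * (C * expR (- (b / 2 * x)) - gamma_weight b (s + 1) x).
have dE x : is_derive x 1 (fun y => expR (- (b / 2 * y))) (- (b / 2) * expR (- (b / 2 * x))).
  exact: is_derive_expR_comp (is_deriveN (is_derive_mull_id (b / 2) x)).
have weight_le_f x : 0 < x -> gamma_weight b s x <= f x.
  move=> x0; rewrite lerDl mulr_ge0 ?divr_ge0 ?(ltW b0) ?(ltW s0) // subr_ge0.
  have -> : gamma_weight b (s + 1) x = gamma_weight (b / 2) (s + 1) x * expR (- (b / 2 * x)).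
    rewrite /gamma_weight -mulrA -expRD; congr (_ * expR _).
    by rewrite -opprD -mulrDl -splitr.
  by rewrite ler_wpM2r ?expR_ge0 // CP.
apply: (@integrable_normr_le _ _ _ mu _ _ f) => //.
- by apply: measurable_funTS; exact: measurable_gamma_weight.
- move=> x /=; rewrite in_itv /= andbT => x0.
  by rewrite ger0_norm ?gamma_weight_ge0 // weight_le_f.
apply: (@ge0_integrable_derive_Ioy _ f F 0 ((s + 1)^-1 * (0 - 2 * C * expR (- (b / 2 * 0))))
  ((s + 1)^-1 * (0 - 2 * C * 0))).
- move=> x x0; apply: (is_derive_eq (is_derive_mull (is_derive_subf
    (is_derive_gamma_weight b s x0) (is_derive_mull (dE x) (2 * C))) _)).
  by rewrite /f; field; exact: lt0r_neq0.
- move=> x x0; apply: cvgD; first exact: continuous_gamma_weight.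
  apply: cvgMr; apply: cvgB; last exact: continuous_gamma_weight.
  by apply: cvgMr; exact: is_derive_continuous (dE x).
- apply: cvgMr; apply: cvgB; first exact: cvg_gamma_weight0.
  by apply: cvgMr; apply: cvg_at_right_filter; exact: is_derive_continuous (dE 0).
- apply: cvgMr; apply: cvgB; first exact: cvg_gamma_weighty (ltW s0).
  apply: cvgMr; have := cvg_gamma_weighty b2 (lexx 0).
  by rewrite /gamma_weight; under eq_fun do rewrite powRr0 mul1r.
- by move=> x x0; rewrite (le_trans _ (weight_le_f x x0)) // gamma_weight_ge0.
Qed.

End gamma_weight.

Section gamma_law.
Context {R : realType} (d : measure_display) (T : measurableType d) (P : probability T R).
Variables (r : R) (X : T -> R).
Hypotheses (r0 : 0 < r) (mX : measurable_fun setT X) (lawX : has_gamma_rr_law P r X).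
Local Notation mu := (@lebesgue_measure R).
Local Notation D := (`]0, +oo[%classic : set R).
Local Notation pdf := (gamma_rr_pdf r).

Let c := r `^ r / Gamma_fun r.

Let c_ge0 : 0 <= c.
Proof.
rewrite divr_ge0 ?powR_ge0 // /Gamma_fun; apply: Rintegral_ge0 => x _.
by rewrite mulr_ge0 ?powR_ge0 ?expR_ge0.
Qed.

Lemma gamma_pdfE : pdf = fun x => c * gamma_weight r (r - 1) x.
Proof. by apply/funext => x; rewrite /gamma_rr_pdf /gamma_weight mulrA. Qed.

Lemma gamma_pdf_ge0 x : 0 <= pdf x.
Proof. by rewrite gamma_pdfE mulr_ge0 ?gamma_weight_ge0. Qed.

Lemma measurable_gamma_pdf : measurable_fun setT pdf.
Proof. by rewrite gamma_pdfE; apply: measurable_funM => //; exact: measurable_gamma_weight. Qed.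

Let integrable_gamma := integrable_density mX (measurable_itv _) gamma_pdf_ge0
  measurable_gamma_pdf lawX.
Let expectation_gamma := expectation_density mX (measurable_itv _) gamma_pdf_ge0
  measurable_gamma_pdf lawX.

Lemma gamma_moment_integrable k : mu.-integrable D (fun x => (x ^+ k * pdf x)%:E).
Proof.
apply: (@eq_integrable _ _ _ mu D _ (EFin \o (fun x => c * gamma_weight r (r - 1 + k%:R) x))) => //.
  move=> x; rewrite inE /= in_itv /= andbT => x0; congr EFin.
  rewrite gamma_pdfE /gamma_weight -(powR_mulrn k (ltW x0)) powRD; last first.
    by rewrite (gt_eqF x0) implybT.
  by ring.
apply: integrableZl_EFin => //; apply: gamma_weight_integrable => //.
by rewrite addrAC -subr_gt0 opprK subrK ltr_wpDr.
Qed.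

Lemma gamma_power_integrable k : P.-integrable setT (fun v => (X v ^+ k)%:E).
Proof.
apply: (integrable_gamma (h := fun x => x ^+ k)); first exact: exprn_measurable.
exact: gamma_moment_integrable.
Qed.

Lemma gamma_integrable : P.-integrable setT (EFin \o X).
Proof. by have := gamma_power_integrable 1. Qed.

Section stein.
Variables (h dh : R -> R) (A : R).
Hypotheses (hd : forall x : R, is_derive x 1 h (dh x)) (cdh : continuous dh).
Hypotheses (hA : forall x, 0 < x -> `|h x| <= A * (1 + x))
           (dhA : forall x, 0 < x -> `|dh x| <= A).

Let H x := (r - r * x) * h x + x * dh x.

Let A_ge0 : 0 <= A. Proof. by rewrite (le_trans _ (dhA ltr01)). Qed.

Let continuous_h : continuous h. Proof. by move=> x; exact: is_derive_continuous (hd x). Qed.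

Let continuous_H : continuous H.
Proof.
move=> x; apply: cvgD; apply: cvgM; [|exact: continuous_h|exact: cvg_id|exact: cdh].
by apply: cvgB; [exact: cvg_cst|apply: cvgMr; exact: cvg_id].
Qed.

Let measurable_H : measurable_fun setT H. Proof. exact: continuous_measurable_fun. Qed.

Let normr_H_le x : 0 < x -> `|H x| <= (2 * r * A + A) * (1 + x ^+ 2).
Proof.
move=> x0; rewrite (le_trans (ler_normD _ _)) // !normrM (gtr0_norm x0).
have rx : `|r - r * x| <= r * (1 + x).
  by rewrite (le_trans (ler_normB _ _)) // normrM !gtr0_norm // mulrDr mulr1.
apply: (le_trans (lerD (ler_pM (normr_ge0 _) (normr_ge0 _) rx (hA x0))
  (ler_wpM2l (ltW x0) (dhA x0)))).
have rA : 0 <= r * A by rewrite mulr_ge0 // ltW.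
rewrite -subr_ge0 (_ : _ - _ = r * A * (x - 1) ^+ 2 +
  A * ((x - 2^-1) ^+ 2 + 3 / 4)); last by field.
by apply: addr_ge0; apply: mulr_ge0; rewrite ?sqr_ge0 // addr_ge0 ?sqr_ge0 ?divr_ge0.
Qed.

Let integrable_H_pdf : mu.-integrable D (EFin \o (fun x => H x * pdf x)).
Proof.
apply: (@integrable_normr_le _ _ _ mu D _
  (fun x => (2 * r * A + A) * (x ^+ 0 * pdf x + x ^+ 2 * pdf x))) => //.
- apply: measurable_funTS; apply: measurable_funM => //; exact: measurable_gamma_pdf.
- move=> x /=; rewrite in_itv /= andbT => x0.
  rewrite expr0 -mulrDl [leRHS]mulrA normrM (ger0_norm (gamma_pdf_ge0 _)).
  by rewrite ler_wpM2r ?gamma_pdf_ge0 // normr_H_le.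
- apply: integrableZl_EFin => //.
  apply: (@integrableD _ _ _ mu D _ (fun x => (x ^+ 0 * pdf x)%:E)
    (fun x => (x ^+ 2 * pdf x)%:E)) => //; exact: gamma_moment_integrable.
Qed.

Let primitive x := c * gamma_weight r r x * h x.

Let is_derive_primitive (x : R) : 0 < x -> is_derive x 1 primitive (H x * pdf x).
Proof.
move=> x0; have := is_derive_gamma_weight r (r - 1) x0; rewrite subrK => dw.
apply: (is_derive_eq (is_derive_mulf (is_derive_mull dw c) (hd x))).
have -> : gamma_weight r r x = x * gamma_weight r (r - 1) x.
  by rewrite -gamma_weightS // subrK.
by rewrite gamma_pdfE /H; ring.
Qed.

Let cvg_primitive0 : primitive x @[x --> 0^'+] --> 0.
Proof.
rewrite -[X in _ --> X](mul0r (h 0)); apply: cvgM; last first.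
  by apply: cvg_at_right_filter; exact: continuous_h.
by rewrite -[X in _ --> X](mulr0 c); apply: cvgMr; exact: cvg_gamma_weight0.
Qed.

Let cvg_primitivey : primitive x @[x --> +oo] --> 0.
Proof.
apply/norm_cvg0P.
apply: (@squeeze_cvgr _ _ _ _ (cst 0)
  (fun x => c * A * (gamma_weight r r x + gamma_weight r (r + 1) x))).
- near=> x; have x0 : 0 < x by near: x; exact: nbhs_pinfty_gt.
  have cw0 : 0 <= c * gamma_weight r r x by rewrite mulr_ge0 ?gamma_weight_ge0.
  rewrite normr_ge0 /= normrM (ger0_norm cw0) (le_trans (ler_wpM2l cw0 (hA x0))) //.
  by rewrite gamma_weightS // le_eqVlt; apply/orP; left; apply/eqP; ring.
- exact: cvg_cst.
- rewrite -(mulr0 (c * A)); apply: cvgMr; rewrite -[X in _ --> X](addr0 0).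
  apply: cvgD; apply: cvg_gamma_weighty => //; rewrite ?addr_ge0 // ltW //.
Unshelve. all: by end_near. Qed.

Lemma gamma_stein : \int[P]_v ((r - r * X v) * h (X v) + X v * dh (X v)) = 0.
Proof.
rewrite (expectation_gamma measurable_H) -[RHS](subrr 0).
apply: (Rintegral_derive_Ioy is_derive_primitive _ cvg_primitive0 cvg_primitivey) => //.
move=> x x0; apply: cvgM; first exact: continuous_H.
by rewrite gamma_pdfE; apply: cvgMr; exact: continuous_gamma_weight.
Qed.

End stein.

Lemma gamma_mean : \int[P]_v X v = 1.
Proof.
have := @gamma_stein (cst 1) (cst 0) 1.
move=> /(_ (fun x => is_derive_cst _ _ _) (fun x => cvg_cst _)) stein.
have {}stein : \int[P]_v (r - r * X v) = 0.
  rewrite -[RHS]stein; first by apply: eq_Rintegral => v _; rewrite mulr1 mulr0 addr0.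
    by move=> x x0; rewrite normr1 mul1r lerDl ltW.
  by move=> x x0; rewrite normr0.
have i1 := gamma_integrable.
move: stein; rewrite RintegralB //; last 2 first.
- exact: finite_measure_integrable_cst.
- exact: integrableZl_EFin.
rewrite RintegralZl // expectation_cst => /eqP.
by rewrite -{1}(mulr1 r) -mulrBr mulf_eq0 (gt_eqF r0) /= subr_eq0 => /eqP.
Qed.

Lemma gamma_second_moment : \int[P]_v (X v ^+ 2) = 1 + r^-1.
Proof.
have i1 := gamma_integrable; have i2 := gamma_power_integrable 2.
have := @gamma_stein id (cst 1) 1 (fun x => is_derive_id x 1) (fun x => cvg_cst _).
move=> stein; have {}stein : \int[P]_v ((r + 1) * X v - r * X v ^+ 2) = 0.
  rewrite -[RHS]stein; first by apply: eq_Rintegral => v _; rewrite /cst /=; ring.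
    by move=> x x0; rewrite gtr0_norm // mul1r lerDr.
  by move=> x x0; rewrite normr1.
move: stein; rewrite RintegralB //; [|exact: integrableZl_EFin|exact: integrableZl_EFin].
rewrite !RintegralZl // gamma_mean mulr1 => /eqP; rewrite subr_eq0 => /eqP rE.
by apply: (mulfI (lt0r_neq0 r0)); rewrite -rE mulrDr mulr1 mulfV ?gt_eqF.
Qed.

Let char_fun_stein t : r%:C * char_fun P X t =
  (r%:C - t%:C * 'i) * cexpectation P (fun w => (X w)%:C * cexp ((t * X w)%:C * 'i)).
Proof.
have mtX := measurable_mull t mX.
have iE := cintegrable_cexp_imag P mtX.
have iXE := cintegrable_realM_cexp_imag gamma_integrable mtX.
apply/eqP; rewrite -subr_eq0 -mulNr -!cexpectationZ // -cexpectationD //;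
  [|exact: cintegrableZ|exact: cintegrableZ].
have growth (g dg : R -> R) : (forall x, `|g x| <= 1) -> (forall x, `|dg x| <= 1) ->
    (forall x, 0 < x -> `|g (t * x)| <= (1 + `|t|) * (1 + x)) /\
    (forall x, 0 < x -> `|t * dg (t * x)| <= 1 + `|t|).
  move=> g1 dg1; split=> x x0.
    by rewrite (le_trans (g1 _)) // mulr_ege1 ?lerDl // ltW.
  by rewrite normrM (@le_trans _ _ `|t|) ?lerDr // ler_piMr.
have stein (g dg : R -> R) : (forall x, `|g x| <= 1) -> (forall x, `|dg x| <= 1) ->
    (forall x : R, is_derive x 1 g (dg x)) -> continuous dg ->
    \int[P]_w ((r - r * X w) * g (t * X w) + X w * (t * dg (t * X w))) = 0.
  move=> g1 dg1 gd cdg; have [gA dgA] := growth g dg g1 dg1.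
  apply: (@gamma_stein (fun x => g (t * x)) (fun x => t * dg (t * x)) (1 + `|t|)) => //.
    move=> x; rewrite mulrC; exact: is_derive1_comp (gd _) (is_derive_mull_id t x).
  move=> x; apply: cvgMr; apply: (@continuous_comp _ _ _ (fun x : R => t * x) dg); last exact: cdg.
  by apply: cvgMr; exact: cvg_id.
have sinN1 (x : R) : `|- sin x| <= 1 by rewrite normrN sin_max.
have stein_cos := stein cos _ (@cos_max R) sinN1 (@is_derive_cos R).
have stein_sin := stein sin _ (@sin_max R) (@cos_max R) (@is_derive_sin R) (@continuous_cos R).
rewrite (_ : (fun w => _) = fun w =>
    ((r - r * X w) * cos (t * X w) + X w * (t * - sin (t * X w))) +i*
    ((r - r * X w) * sin (t * X w) + X w * (t * cos (t * X w)))); last first.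
  by apply/funext => w; rewrite cexp_imag; apply: eq_ReIm => /=; ring.
rewrite /cexpectation /= stein_sin stein_cos //.
by move=> x; apply: cvgN; exact: continuous_sin.
Qed.

(* By the Stein identity the characteristic function [f] satisfies
   [f' = 'i f / (1 - 'i t / r)], so that its quotient by the candidate is constant. *)
Lemma gamma_char_fun t : char_fun P X t = cexp (r%:C * clog (r^-1 * t)).
Proof.
have rn : r%:C != 0 :> R[i] by rewrite fmorph_eq0 gt_eqF.
pose Q t := char_fun P X t * cexp (- (r%:C * clog (r^-1 * t))).
have dQ s : is_cderive s Q 0.
  have dlog : is_cderive s (fun t => - (r%:C * clog (r^-1 * t)))
      (- ('i / (1 - (r^-1 * s)%:C * 'i))).
    apply: (is_cderive_eq (is_cderiveN (is_cderiveZ _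
      (is_cderive_comp (is_derive_mull_id r^-1 s) (is_cderive_clog _))))).
    by rewrite mulrA -rmorphM /= mulfV ?gt_eqF // mul1r.
  apply: (is_cderive_eq (is_cderiveM (is_cderive_char_fun s gamma_integrable)
    (is_cderive_cexp dlog))).
  have -> : char_fun P X s = (1 - (r^-1 * s)%:C * 'i) *
      cexpectation P (fun w => (X w)%:C * cexp ((s * X w)%:C * 'i)).
    apply: (mulfI rn); rewrite char_fun_stein mulrA; congr (_ * _).
    by rewrite mulrBr mulr1 mulrA -rmorphM /= mulrA mulfV ?mul1r ?gt_eqF.
  by move: (subr_1Bi_neq0 (r^-1 * s)); set u := 1 - _ => u0; field.
have Q1 : Q t = 1.
  by rewrite (is_cderive_0_is_cst dQ t 0) /Q char_fun0 mulr0 clog0 mulr0 oppr0 cexp0 mulr1.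
rewrite -[RHS]mul1r -Q1 /Q -mulrA -cexpD addNr cexp0 mulr1 //.
Qed.

End gamma_law.

(** * Fourier integrals of Gaussian functions *)

Section normal_cdf.
Context {R : realType}.
Local Notation mu := (@lebesgue_measure R).
Local Notation Phi := (@std_normal_cdf R).
Local Notation phi := (@std_normal_pdf R).

Lemma std_normal_pdfE : phi = normal_pdf 0 1.
Proof.
rewrite normal_pdfE ?oner_eq0 //; apply/funext => x.
by rewrite /std_normal_pdf /normal_peak /normal_fun subr0 expr1n mul1r mulrC.
Qed.

Lemma continuous_std_normal_pdf : continuous phi.
Proof. by rewrite std_normal_pdfE; apply: continuous_normal_pdf; rewrite oner_eq0. Qed.

Lemma integrable_std_normal_pdf : mu.-integrable setT (EFin \o phi).
Proof. by rewrite std_normal_pdfE; exact: integrable_normal_pdf. Qed.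

Lemma is_derive_std_normal_cdf (x : R) : is_derive x 1 Phi (phi x).
Proof.
have ip : mu.-integrable [set` Interval -oo%O (BRight (x + 1))] (EFin \o phi).
  by apply: integrableS integrable_std_normal_pdf.
have xx : x < x + 1 by rewrite ltrDl.
have [||dx ex] := continuous_FTC1 xx ip; [by rewrite ltNyr|exact: continuous_std_normal_pdf|].
by split; [exact: dx|rewrite -derive1E; exact: ex].
Qed.

Lemma continuous_std_normal_cdf : continuous Phi.
Proof. by move=> x; exact: is_derive_continuous (is_derive_std_normal_cdf x). Qed.

Let idR : measurableTypeR R -> R := idfun.
#[local] HB.instance Definition _ :=
  @isMeasurableFun.Build _ _ _ _ idR (@measurable_id _ _ setT).
Let idRV : {RV (normal_prob (0 : R) 1) >-> R} := idR.

Let cdf_idRV : cdf idRV = EFin \o Phi.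
Proof.
apply/funext => x; rewrite /std_normal_cdf /Rintegral /cdf /distribution /pushforward /=.
rewrite preimage_id /normal_prob std_normal_pdfE fineK //.
apply: integrable_fin_num => //; apply: (@integrableS _ _ _ mu setT) => //.
exact: integrable_normal_pdf.
Qed.

Let PhiE x : (Phi x)%:E = cdf idRV x. Proof. by rewrite cdf_idRV. Qed.

Lemma std_normal_cdf_ge0 x : 0 <= Phi x.
Proof. by rewrite -lee_fin PhiE cdf_ge0. Qed.

Lemma std_normal_cdf_le1 x : Phi x <= 1.
Proof. by rewrite -lee_fin PhiE cdf_le1. Qed.

Lemma std_normal_cdf_nd : {homo Phi : x y / x <= y}.
Proof. by move=> x y xy; rewrite -lee_fin !PhiE; exact: cdf_nondecreasing. Qed.

Lemma cvg_std_normal_cdfy : Phi x @[x --> +oo] --> (1 : R).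
Proof. by have := @cvg_cdfy1 _ _ _ _ idRV; rewrite cdf_idRV => /fine_cvg. Qed.

Lemma cvg_std_normal_cdfNy : Phi x @[x --> -oo] --> (0 : R).
Proof. by have := @cvg_cdfNy0 _ _ _ _ idRV; rewrite cdf_idRV => /fine_cvg. Qed.

Lemma std_normal_cdf0 : Phi 0 = 2^-1.
Proof.
pose F x := Phi x + Phi (- x).
have dF (y : R) : is_derive y 1 F 0.
  have dN := is_derive1_comp (is_derive_std_normal_cdf (- y)) (is_deriveNid y 1).
  apply: (is_derive_eq (is_derive_addf (is_derive_std_normal_cdf y) dN)).
  by rewrite {2}/std_normal_pdf sqrrN mulrN1 subrr.
have F_cvg1 : F x @[x --> +oo] --> (1 + 0 : R).
  apply: cvgD; first exact: cvg_std_normal_cdfy.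
  by have /cvgNy_compNP := cvg_std_normal_cdfNy.
have F_cst : F = cst (F 0) by apply/funext => y; exact: is_derive_0_is_cst.
have : F 0 = 1 + 0.
  by apply: cvg_unique F_cvg1 => //; rewrite {1}F_cst; exact: cvg_cst.
by rewrite /F oppr0; lra.
Qed.

End normal_cdf.

Section fourier_integrand.
Context {R : realType}.
Implicit Types (f g : R -> R[i]) (x t : R).

(* Gil-Pelaez inversion: if [f] is a characteristic function, then formally
   [2^-1 + pi^-1 * int_0^oo fourier_integrand f x] is its distribution function at [x]. *)
Definition fourier_integrand f x t : R := - Im (cexp (- ((t * x)%:C * 'i)) * f t) / t.

Lemma fourier_integrandE f x t :
  fourier_integrand f x t = (sin (t * x) * Re (f t) - cos (t * x) * Im (f t)) / t.
Proof.
rewrite /fourier_integrand -mulNr -rmorphN /= cexp_imag cosN sinN cImM /=; congr (_ / _).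
by ring.
Qed.

Lemma fourier_integrandB f g x t :
  fourier_integrand f x t - fourier_integrand g x t =
  fourier_integrand (fun t => f t - g t) x t.
Proof. by rewrite !fourier_integrandE; case: (f t) (g t) => [a b] [c e] /=; ring. Qed.

Lemma fourier_integrandZ (h : R -> R) f x t :
  fourier_integrand (fun t => (h t)%:C * f t) x t = h t * fourier_integrand f x t.
Proof. by rewrite !fourier_integrandE Re_realM Im_realM; ring. Qed.

Lemma fourier_integrand_sum (I : Type) (s : seq I) (f : I -> R -> R[i]) x t :
  fourier_integrand (fun t => \sum_(i <- s) f i t) x t =
  \sum_(i <- s) fourier_integrand (f i) x t.
Proof.
elim: s => [|i s ih].
  by rewrite big_nil fourier_integrandE big_nil /= !mulr0 subrr mul0r.
rewrite big_cons -ih !fourier_integrandE big_cons.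
by case: (f i t) (\sum_(_ <- s) _) => [a b] [c e] /=; ring.
Qed.

Lemma normr_fourier_integrand_le f x t : 0 < t ->
  `|fourier_integrand f x t| <= normc (f t) / t.
Proof.
move=> t0; rewrite normrM normrN [`|t^-1|]gtr0_norm ?invr_gt0 //.
rewrite ler_wpM2r ?invr_ge0 ?(ltW t0) // (le_trans (le_normr_Im _)) //.
by rewrite normcM -mulNr -rmorphN normc_cexp_imag mul1r.
Qed.

Lemma is_derive_fourier_integrand f (x t : R) : 0 < t ->
  is_derive x 1 (fun x => fourier_integrand f x t)
    (- fourier_integrand (fun t => t%:C * 'i * f t) x t).
Proof.
move=> t0; have d_exp : is_cderive x (fun x => cexp (- ((t * x)%:C * 'i)))
    (- (t%:C * 'i) * cexp (- ((t * x)%:C * 'i))).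
  apply: is_cderive_cexp; under eq_fun do rewrite rmorphM /= -mulrA mulrCA -mulrN.
  apply: (is_cderive_eq (is_cderiveM (is_cderive_real (is_derive_id x 1)) (is_cderive_cst x _))).
  by rewrite mulr0 addr0 mul1r.
have [_ dIm] := is_cderiveM d_exp (is_cderive_cst x (f t)).
rewrite /fourier_integrand; under eq_fun do rewrite mulrC.
have := is_derive_mull (is_derive_mull dIm (- 1)) t^-1.
under eq_fun do rewrite mulN1r; move=> h; apply: (is_derive_eq h).
set E := cexp _; case: E (f t) => [a b] [c e] /=; field; exact: lt0r_neq0.
Qed.

Lemma measurable_fourier_integrand f x : measurable_fun setT (fun t => Re (f t)) ->
  measurable_fun setT (fun t => Im (f t)) ->
  measurable_fun (`]0, +oo[ : set R) (fourier_integrand f x).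
Proof.
move=> mRe mIm.
have mtrig (g : R -> R) : continuous g -> measurable_fun setT (fun t => g (t * x)).
  move=> cg; apply: measurableT_comp; first exact: continuous_measurable_fun.
  exact: measurable_funM.
apply: (@eq_measurable_fun _ _ _ _ _
  (fun t => (sin (t * x) * Re (f t) - cos (t * x) * Im (f t)) * t `^ (- 1))).
  move=> t; rewrite inE /= in_itv /= andbT => t0.
  by rewrite fourier_integrandE powR_inv1 // ltW.
apply: measurable_funTS; apply: measurable_funM; last exact: measurable_powR.
apply: measurable_funB; apply: measurable_funM => //; apply: mtrig.
  exact: continuous_sin.
exact: continuous_cos.
Qed.

Lemma is_cderive_measurable f (df : R -> R[i]) : (forall t, is_cderive t f (df t)) ->
  measurable_fun setT (fun t => Re (f t)) /\ measurable_fun setT (fun t => Im (f t)).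
Proof.
move=> fd; split; apply: continuous_measurable_fun => t; have [dRe dIm] := fd t.
  exact: is_derive_continuous dRe.
exact: is_derive_continuous dIm.
Qed.

Definition fourier_monomial j t : R[i] := (t%:C * 'i) ^+ j.

Lemma fourier_integrand_monomial0 x t :
  fourier_integrand (fourier_monomial 0) x t = sin (t * x) / t.
Proof. by rewrite fourier_integrandE /= mulr1 mulr0 subr0. Qed.

Lemma fourier_integrand_monomial1 x t : 0 < t ->
  fourier_integrand (fourier_monomial 1) x t = - cos (t * x).
Proof.
by move=> t0; rewrite fourier_integrandE /fourier_monomial expr1 /=; field; exact: lt0r_neq0.
Qed.

Lemma fourier_integrand_monomial2 x t : 0 < t ->
  fourier_integrand (fourier_monomial 2) x t = - (t * sin (t * x)).
Proof.
by move=> t0; rewrite fourier_integrandE /fourier_monomial expr2 /=; field; exact: lt0r_neq0.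
Qed.

Lemma normr_sin_le (y : R) : `|sin y| <= `|y|.
Proof.
wlog y0 : y / 0 <= y.
  move=> le_y; have [/le_y//|yN] := leP 0 y; rewrite -normrN -sinN -[leRHS]normrN.
  by apply: le_y; rewrite oppr_ge0 ltW.
rewrite [leRHS]ger0_norm // ler_norml; apply/andP; split.
  have := @is_derive_ge0_le R (fun y => sin y + y) (fun y => cos y + 1) 0 y y0.
  rewrite sin0 addr0 -subr_ge0 subr0 -[- y <= _]subr_ge0 opprK; apply.
  by move=> u _; rewrite -lerBlDr sub0r cos_geN1.
have := @is_derive_ge0_le R (fun y => y - sin y) (fun y => 1 - cos y) 0 y y0.
rewrite sin0 subr0 subr_ge0; apply.
by move=> u _; rewrite subr_ge0 cos_le1.
Qed.

Lemma normr_fourier_integrand0_le x t : 0 < t ->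
  `|fourier_integrand (fourier_monomial 0) x t| <= `|x|.
Proof.
move=> t0; rewrite fourier_integrand_monomial0 normrM [`|t^-1|]gtr0_norm ?invr_gt0 //.
by rewrite ler_pdivrMr // (le_trans (normr_sin_le _)) // normrM (gtr0_norm t0) mulrC.
Qed.

Lemma normr_fourier_integrandS_le j x t : 0 < t ->
  `|fourier_integrand (fourier_monomial j.+1) x t| <= t ^+ j.
Proof.
move=> t0; apply: (le_trans (normr_fourier_integrand_le _ _ t0)).
by rewrite normcX normcM normc_i normc_real mulr1 gtr0_norm // exprSr mulfK ?gt_eqF.
Qed.

Lemma normr_fourier_integrand_monomial_le j x t : 0 < t ->
  `|fourier_integrand (fourier_monomial j) x t| <= `|x| + t ^+ j.-1.
Proof.
move=> t0; case: j => [|j].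
  by rewrite (le_trans (normr_fourier_integrand0_le _ _)) // lerDl.
by rewrite (le_trans (normr_fourier_integrandS_le _ _ _)) // lerDr.
Qed.

Lemma measurable_fourier_monomial j :
  measurable_fun setT (fun t => Re (fourier_monomial j t)) /\
  measurable_fun setT (fun t => Im (fourier_monomial j t)).
Proof. exact: is_cderive_measurable (fun t => is_cderive_exprn j (is_cderive_realM 'i t)). Qed.

End fourier_integrand.

Section gaussian_integrals.
Context {R : realType}.
Local Notation mu := (@lebesgue_measure R).
Local Notation D := (`]0, +oo[%classic : set R).
Local Notation Phi := (@std_normal_cdf R).
Local Notation phi := (@std_normal_pdf R).
Implicit Types (e t x : R).

Lemma integrable_oneDsqrV : mu.-integrable D (EFin \o (fun t => (1 + t ^+ 2)^-1)).
Proof.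
have p (t : R) : 0 <= (1 + t ^+ 2)^-1 by rewrite invr_ge0 addr_ge0 ?sqr_ge0.
have i0 : mu.-integrable `[0, +oo[ (fun t => ((1 + t ^+ 2)^-1)%:E).
  apply/integrableP; split.
    apply: measurable_funTS; apply/measurable_EFinP; apply: continuous_measurable_fun.
    exact: continuous_oneDsqrV.
  under eq_integral do rewrite gee0_abs ?lee_fin //.
  by have := @integral0y_oneDsqr R; rewrite /oneDsqr => ->; exact: ltry.
apply: (@integrableS _ _ _ mu `[0, +oo[ D) => // x /=.
by rewrite !in_itv /= !andbT; exact: ltW.
Qed.

Lemma Rintegral_oneDsqrV : \int[mu]_(t in D) (1 + t ^+ 2)^-1 = pi / 2.
Proof.
rewrite /Rintegral integral_itv_obnd_cbnd; last first.
  apply: measurable_funTS; apply/measurable_EFinP; apply: continuous_measurable_fun.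
  exact: continuous_oneDsqrV.
by have := @integral0y_oneDsqr R; rewrite /oneDsqr => ->.
Qed.

Definition gauss e t := expR (- ((e * t) ^+ 2 / 2)).

Lemma gauss_ge0 e t : 0 <= gauss e t. Proof. exact: expR_ge0. Qed.

Lemma gauss_le1 e t : gauss e t <= 1.
Proof. by rewrite -[leRHS]expR0 ler_expR oppr_le0 divr_ge0 ?sqr_ge0. Qed.

Lemma gaussC e t : gauss e t = gauss t e.
Proof. by rewrite /gauss [e * t]mulrC. Qed.

Lemma gauss1 t : gauss 1 t = expR (- (t ^+ 2 / 2)).
Proof. by rewrite /gauss mul1r. Qed.

Lemma is_derive_gauss (e t : R) : is_derive t 1 (gauss e) (- (e ^+ 2 * t * gauss e t)).
Proof.
have h := is_derive_mull (is_derive_exprn_comp (is_derive_mull_id e t) 2) (- 2^-1).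
rewrite (_ : gauss e = fun y => expR (- 2^-1 * (e * y) ^+ 2)); last first.
  by apply/funext => y; rewrite /gauss mulNr mulrC.
by apply: (is_derive_eq (is_derive_expR_comp h)); rewrite expr1; field.
Qed.

Lemma continuous_gauss e : continuous (gauss e).
Proof. by move=> t; exact: is_derive_continuous (is_derive_gauss e t). Qed.

Lemma measurable_gauss e : measurable_fun setT (gauss e).
Proof. by apply: continuous_measurable_fun; exact: continuous_gauss. Qed.

Lemma poly_gauss_scaled_bounded e (p : {poly R}) : 0 < e ->
  exists2 C : R, 0 <= C & forall t, 0 <= t -> `|p.[t]| * gauss e t <= C.
Proof.
move=> e0; have [|C C0 CP] := poly_gauss_bounded p (_ : 0 < e ^+ 2 / 2).
  by rewrite divr_gt0 ?exprn_gt0.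
by exists C => // t t0; rewrite /gauss exprMn mulrAC CP.
Qed.

Lemma gauss_moment_integrable e k : 0 < e ->
  mu.-integrable D (EFin \o (fun t => t ^+ k * gauss e t)).
Proof.
move=> e0; have [C C0 CP] := poly_gauss_scaled_bounded ('X^k * (1 + 'X^2)) e0.
apply: (@integrable_normr_le _ _ _ mu D _ (fun t => C * (1 + t ^+ 2)^-1)) => //.
- apply: measurable_funTS; apply: measurable_funM; first exact: exprn_measurable.
  exact: measurable_gauss.
- move=> t /=; rewrite in_itv /= andbT => /ltW t0.
  have p : 0 < 1 + t ^+ 2 by rewrite ltr_pwDl // sqr_ge0.
  have tk : 0 <= t ^+ k by rewrite exprn_ge0.
  rewrite ger0_norm ?mulr_ge0 ?gauss_ge0 // ler_pdivlMr // (le_trans _ (CP t t0)) //.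
  by rewrite !hornerE ger0_norm ?mulr_ge0 ?(ltW p) // mulrAC.
- by apply: integrableZl_EFin => //; exact: integrable_oneDsqrV.
Qed.

Lemma gauss_integrable e : 0 < e -> mu.-integrable D (EFin \o gauss e).
Proof.
move=> /(gauss_moment_integrable 0); apply: eq_integrable => // t _ /=.
by rewrite expr0 mul1r.
Qed.

Lemma cvg_gaussy e : 0 < e -> gauss e t @[t --> +oo] --> 0.
Proof.
move=> e0; have [C C0 CP] := poly_gauss_scaled_bounded 'X e0.
apply/cvgr0Pnorm_le => d d0; near=> t.
have t0 : 0 < t by near: t; exact: nbhs_pinfty_gt.
rewrite ger0_norm ?gauss_ge0 // -(ler_pM2l t0).
have := CP t (ltW t0); rewrite hornerX gtr0_norm // => /le_trans; apply.
by rewrite -ler_pdivrMr //; near: t; apply: nbhs_pinfty_ge; exact: num_real.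
Unshelve. all: by end_near. Qed.

Let s2pi : R := Num.sqrt (pi *+ 2).
Let s2pi_gt0 : 0 < s2pi. Proof. by rewrite sqrtr_gt0 mulrn_wgt0 // pi_gt0. Qed.
Let s2pi_sqr : s2pi ^+ 2 = 2 * pi.
Proof. by rewrite /s2pi sqr_sqrtr; [rewrite mulr_natl|apply: mulrn_wge0; exact: pi_ge0]. Qed.

Lemma gaussE e t : gauss e t = s2pi * phi (e * t).
Proof. by rewrite /std_normal_pdf mulrC divfK ?gt_eqF // /gauss mulNr. Qed.

Lemma integral_gauss e : 0 < e -> \int[mu]_(t in D) gauss e t = s2pi / (2 * e).
Proof.
move=> e0; have -> : s2pi / (2 * e) = s2pi / e * 1 - s2pi / e * Phi (e * 0).
  by rewrite mulr0 std_normal_cdf0; field; rewrite gt_eqF.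
apply: (@Rintegral_derive_Ioy _ (gauss e) (fun t => s2pi / e * Phi (e * t)) 0
  (s2pi / e * Phi (e * 0)) (s2pi / e * 1)).
- move=> t t0.
  have h := is_derive1_comp (is_derive_std_normal_cdf (e * t)) (is_derive_mull_id e t).
  apply: (is_derive_eq (is_derive_mull h (s2pi / e))).
  by rewrite gaussE; field; rewrite gt_eqF.
- by move=> t _; exact: continuous_gauss.
- apply: cvg_at_right_filter; apply: cvgMr.
  apply: (@continuous_comp _ _ _ (fun u : R => e * u)); last exact: continuous_std_normal_cdf.
  by apply: cvgMr; exact: cvg_id.
- apply: cvgMr; apply: (@cvg_comp _ _ _ (fun t => e * t) Phi); last exact: cvg_std_normal_cdfy.
  by apply: gt0_cvgMry => //; exact: cvg_id.
- exact: gauss_integrable.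
Qed.

Definition gauss_integral j e x :=
  \int[mu]_(t in D) (fourier_integrand (fourier_monomial j) x t * gauss e t).

Lemma integrable_gauss_integral j e x : 0 < e ->
  mu.-integrable D (EFin \o (fun t => fourier_integrand (fourier_monomial j) x t * gauss e t)).
Proof.
move=> e0; have [mRe mIm] := @measurable_fourier_monomial R j.
apply: (@integrable_normr_le _ _ _ mu D _
  (fun t => `|x| * gauss e t + t ^+ j.-1 * gauss e t)) => //.
- apply: measurable_funM; first exact: measurable_fourier_integrand.
  by apply: measurable_funTS; exact: measurable_gauss.
- move=> t /=; rewrite in_itv /= andbT => t0; have G0 := gauss_ge0 e t.
  rewrite normrM (ger0_norm G0) -mulrDl.
  by rewrite ler_wpM2r // normr_fourier_integrand_monomial_le.
- apply: (@integrableD _ _ _ mu D _ (fun t => (`|x| * gauss e t)%:E)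
    (fun t => (t ^+ j.-1 * gauss e t)%:E)) => //; last exact: gauss_moment_integrable.
  by apply: integrableZl_EFin => //; exact: gauss_integrable.
Qed.

Lemma is_derive_gauss_integral j e (x : R) : 0 < e ->
  is_derive x 1 (gauss_integral j e) (- gauss_integral j.+1 e x).
Proof.
move=> e0; have fourierS y t : - fourier_integrand (fourier_monomial j.+1) y t =
    - fourier_integrand (fun t => t%:C * 'i * fourier_monomial j t) y t.
  by rewrite /fourier_integrand /fourier_monomial exprS.
have -> : - gauss_integral j.+1 e x =
    \int[mu]_(t in D) (- fourier_integrand (fourier_monomial j.+1) x t * gauss e t).
  rewrite /gauss_integral -mulN1r -RintegralZl //; last exact: integrable_gauss_integral.
  by apply: eq_Rintegral => t _; rewrite mulN1r mulNr.
apply: (@is_derive_under_integral _ _ _ mu D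
  (fun x t => fourier_integrand (fourier_monomial j) x t * gauss e t)
  (fun x t => - fourier_integrand (fourier_monomial j.+1) x t * gauss e t)
  (fun t => t ^+ j * gauss e t)) => //.
- by move=> y; exact: integrable_gauss_integral.
- move=> y t /=; rewrite in_itv /= andbT => t0; under eq_fun do rewrite mulrC.
  rewrite fourierS mulrC; apply: is_derive_mull; exact: is_derive_fourier_integrand.
- exact: gauss_moment_integrable.
- move=> y t /=; rewrite in_itv /= andbT => t0.
  rewrite normrM normrN (ger0_norm (gauss_ge0 _ _)) ler_wpM2r ?gauss_ge0 //.
  exact: normr_fourier_integrandS_le.
Qed.

Lemma gauss_integral_ode e x : 0 < e -> e ^+ 2 * gauss_integral 2 e x = x * gauss_integral 1 e x.
Proof.
move=> e0; apply/eqP; rewrite -subr_eq0; apply/eqP.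
pose k j t := fourier_integrand (fourier_monomial j) x t * gauss e t.
have ik j (c : R) : mu.-integrable D (EFin \o (fun t => c * k j t)).
  by apply: integrableZl_EFin => //; exact: integrable_gauss_integral.
rewrite /gauss_integral -!RintegralZl //; [|exact: integrable_gauss_integral..].
rewrite -/(k 1%N) -/(k 2%N) -RintegralB //; [|exact: ik..].
pose f t := x * cos (t * x) * gauss e t - e ^+ 2 * t * sin (t * x) * gauss e t.
have kE t : t \in D -> e ^+ 2 * k 2%N t - x * k 1%N t = f t.
  rewrite inE /= in_itv /= andbT => t0.
  by rewrite /k fourier_integrand_monomial1 // fourier_integrand_monomial2 // /f; ring.
transitivity (\int[mu]_(t in D) f t); first by apply: eq_Rintegral => t /kE.
rewrite -[RHS](subrr 0).
have tx (t : R) : is_derive t 1 (fun t => t * x) x.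
  by under eq_fun do rewrite mulrC; exact: is_derive_mull_id.
have d_sin (t : R) : is_derive t 1 (fun t => sin (t * x)) (cos (t * x) * x).
  exact: (@is_derive1_comp _ sin _ _ _ _ (is_derive_sin _) (tx t)).
have d_cos (t : R) : is_derive t 1 (fun t => cos (t * x)) (- sin (t * x) * x).
  exact: (@is_derive1_comp _ cos _ _ _ _ (is_derive_cos _) (tx t)).
apply: (@Rintegral_derive_Ioy _ _ (fun t => sin (t * x) * gauss e t) 0 0 0).
- move=> t _; apply: (is_derive_eq (is_derive_mulf (d_sin t) (is_derive_gauss e t))).
  by rewrite /f /=; ring.
- move=> t _; apply: cvgB; (apply: cvgM; last exact: continuous_gauss).
    by apply: cvgMr; exact: is_derive_continuous (d_cos t).
  apply: cvgM; last exact: is_derive_continuous (d_sin t).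
  by apply: cvgMr; exact: cvg_id.
- apply: cvg_at_right_filter; rewrite -[X in _ --> X](mul0r (gauss e 0)).
  apply: cvgM; last exact: continuous_gauss.
  suff : sin (t * x) @[t --> (0 : R)] --> sin (0 * x) by rewrite mul0r sin0.
  exact: is_derive_continuous (d_sin 0).
- apply/norm_cvg0P; apply: (@squeeze_cvgr _ _ _ _ (cst 0) (gauss e)).
  + apply: nearW => t; rewrite normr_ge0 /= normrM (ger0_norm (gauss_ge0 e t)).
    by rewrite ler_piMl ?gauss_ge0 // sin_max.
  + exact: cvg_cst.
  + exact: cvg_gaussy.
- apply: (@eq_integrable _ _ _ mu D _ (fun t => (e ^+ 2 * k 2%N t)%:E - (x * k 1%N t)%:E)%E) => //.
    by move=> t tD; rewrite -EFinB kE.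
  by apply: integrableB => //; exact: ik.
Qed.

Lemma gauss_integral1E e x : 0 < e -> gauss_integral 1 e x = - (pi / e * phi (e^-1 * x)).
Proof.
move=> e0; pose F x := gauss_integral 1 e x * expR (2^-1 * (e^-1 * x) ^+ 2).
have dF (y : R) : is_derive y 1 F 0.
  have h := is_derive_mull (is_derive_exprn_comp (is_derive_mull_id e^-1 y) 2) (2^-1).
  apply: (is_derive_eq (is_derive_mulf (is_derive_gauss_integral 1 y e0) (is_derive_expR_comp h))).
  have -> : gauss_integral 2 e y = e ^- 2 * (y * gauss_integral 1 e y).
    by rewrite -gauss_integral_ode // mulrA mulVf ?mul1r // sqrf_eq0 gt_eqF.
  by rewrite expr1; field; rewrite gt_eqF.
have F0 : F 0 = - (s2pi / (2 * e)).
  rewrite /F mulr0 expr0n mulr0 expR0 mulr1 /gauss_integral -integral_gauss //.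
  rewrite -mulN1r -RintegralZl //; last exact: gauss_integrable.
  apply: eq_Rintegral => t; rewrite inE /= in_itv /= andbT => t0.
  by rewrite fourier_integrand_monomial1 // mulr0 cos0.
have : F x = - (s2pi / (2 * e)) by rewrite (is_derive_0_is_cst x 0 dF).
move=> /(congr1 (fun z => z * expR (- (2^-1 * (e^-1 * x) ^+ 2)))).
rewrite /F -[X in X = _ -> _]mulrA expRxMexpNx_1 mulr1 => ->.
rewrite /std_normal_pdf -/s2pi mulNr [- _ ^+ 2 / 2]mulNr [_ / 2]mulrC; congr (- _).
have -> : pi = s2pi ^+ 2 / 2 by rewrite s2pi_sqr; field.
by field; rewrite !gt_eqF.
Qed.

Lemma gauss_integral0E e x : 0 < e -> gauss_integral 0 e x = pi * (Phi (e^-1 * x) - 2^-1).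
Proof.
move=> e0; pose F x := gauss_integral 0 e x - pi * Phi (e^-1 * x).
have dF (y : R) : is_derive y 1 F 0.
  have h := is_derive1_comp (is_derive_std_normal_cdf (e^-1 * y)) (is_derive_mull_id e^-1 y).
  apply: (is_derive_eq (is_derive_subf (is_derive_gauss_integral 0 y e0) (is_derive_mull h pi))).
  by rewrite gauss_integral1E // opprK; field; rewrite gt_eqF.
have F0 : F 0 = - (pi / 2).
  rewrite /F mulr0 std_normal_cdf0 /gauss_integral (@eq_Rintegral _ _ _ mu D (cst 0)).
    by rewrite Rintegral_cst // mul0r sub0r.
  by move=> t _; rewrite fourier_integrand_monomial0 mulr0 sin0 !mul0r.
have : F x = - (pi / 2) by rewrite (is_derive_0_is_cst x 0 dF).
by rewrite /F mulrBr => /eqP; rewrite subr_eq => /eqP ->; rewrite addrC.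
Qed.

Local Notation g := (fun y : R => expR (- (y ^+ 2) / 2)).

Lemma gauss_integral_derive1n j x :
  gauss_integral j.+1 1 x = - (pi / s2pi) * (-1) ^+ j * (g^`(j))%classic x.
Proof.
elim: j x => [|j ih] x.
  rewrite derive1n0 expr0 mulr1 gauss_integral1E // /std_normal_pdf -/s2pi invr1 mul1r.
  by field; rewrite gt_eqF.
set c : R := - (pi / s2pi) * (-1) ^+ j in ih.
have c0 : c != 0 by rewrite mulf_neq0 ?signr_eq0 // oppr_eq0 mulf_neq0 ?invr_eq0 ?gt_eqF // pi_gt0.
have gE : (g^`(j))%classic = fun x => c^-1 * gauss_integral j.+1 1 x.
  by apply/funext => y; rewrite ih mulrA mulVf // mul1r.
rewrite derive1nS gE derive1E.
have [_ ->] := is_derive_mull (is_derive_gauss_integral j.+1 x ltr01) c^-1.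
by rewrite exprS [X in _ = X * _]mulrCA -/c mulN1r mulNr !mulrN opprK mulVKf.
Qed.

Lemma gauss_integral_hermite j x : gauss_integral j.+1 1 x = - (pi * (phi x * hermite j x)).
Proof.
rewrite gauss_integral_derive1n /std_normal_pdf -/s2pi /hermite.
have expRK : expR (- (x ^+ 2) / 2) * expR (x ^+ 2 / 2) = 1 :> R.
  by rewrite -expRD mulNr addNr expR0.
transitivity (- (pi / s2pi * (-1) ^+ j * (g^`(j))%classic x *
   (expR (- (x ^+ 2) / 2) * expR (x ^+ 2 / 2)))); last by ring.
by rewrite expRK; ring.
Qed.

End gaussian_integrals.

(** * Fourier inversion by Gaussian smoothing *)

Section smoothing.
Context {R : realType} (d : measure_display) (T : measurableType d) (P : probability T R).
Variable X : T -> R.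
Hypothesis iX : P.-integrable setT (EFin \o X).
Local Notation mu := (@lebesgue_measure R).
Local Notation D := (`]0, +oo[%classic : set R).
Local Notation Phi := (@std_normal_cdf R).

Let mX : measurable_fun setT X.
Proof. exact: integrable_measurable_fun iX. Qed.

Let integrable_shift (x : R) : P.-integrable setT (EFin \o (fun v => x - X v)).
Proof.
have ix : P.-integrable setT (fun v : T => x%:E) by exact: finite_measure_integrable_cst.
exact: (integrableB measurableT ix iX).
Qed.

Lemma fourier_integrand_char_fun x t : fourier_integrand (char_fun P X) x t =
  \int[P]_v fourier_integrand (fourier_monomial 0) (x - X v) t.
Proof.
have trig (g : R -> R) : continuous g -> (forall x, `|g x| <= 1) ->
    P.-integrable setT (EFin \o (fun v => g (t * X v))).
  move=> cg g1; exact: (integrable_continuous_bounded P cg g1 (measurable_mull t mX)).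
have icos := trig _ (@continuous_cos R) (@cos_max R).
have isin := trig _ (@continuous_sin R) (@sin_max R).
have icos' := integrableZl_EFin (t^-1 * sin (t * x)) measurableT icos.
have isin' := integrableZl_EFin (t^-1 * cos (t * x)) measurableT isin.
rewrite fourier_integrandE char_funE /= mulrC mulrBr !mulrA -!RintegralZl // -RintegralB //.
apply: eq_Rintegral => v _.
by rewrite fourier_integrand_monomial0 mulrBr sinB; ring.
Qed.

Section fubini.
Variables (x e : R).
Hypothesis e0 : 0 < e.

Let kernel v t := fourier_integrand (fourier_monomial 0) (x - X v) t * gauss e t.

Let f (z : measurableTypeR R * T) : R :=
  sin ((z.1 : R) * (x - X z.2)) * (z.1 : R) `^ (- 1) * gauss e z.1 * \1_D z.1.

Let mf : measurable_fun setT f.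
Proof.
have m1 : measurable_fun setT (fun z : measurableTypeR R * T => (z.1 : R)).
  exact: measurable_fst.
have m2 : measurable_fun setT (fun z : measurableTypeR R * T => X z.2).
  by apply: measurableT_comp => //; exact: measurable_snd.
have comp1 (g : R -> R) : measurable_fun setT g ->
    measurable_fun setT (fun z : measurableTypeR R * T => g z.1).
  move=> mg; exact: (@measurableT_comp _ _ _ _ _ _ (g : measurableTypeR R -> R)).
apply: measurable_funM; last by apply: (comp1 (\1_D)); exact: measurable_indic.
apply: measurable_funM; last by apply: (comp1 (gauss e)); exact: measurable_gauss.
apply: measurable_funM; last by apply: (comp1 (fun u => u `^ (- 1))); exact: measurable_powR.
apply: measurableT_comp; first by apply: continuous_measurable_fun; exact: continuous_sin.
by apply: measurable_funM => //; exact: measurable_funB.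
Qed.

Let fE v t : f (t, v) = (kernel v \_ D) t.
Proof.
rewrite /f /= patchE indicE; case: ifPn => tD; last by rewrite mulr0.
rewrite mulr1 /kernel fourier_integrand_monomial0 powR_inv1 //.
by move: tD; rewrite inE /= in_itv /= andbT; exact: ltW.
Qed.

Let integral_kernel v : (\int[mu]_t (f (t, v))%:E = (gauss_integral 0 e (x - X v))%:E)%E.
Proof.
rewrite /gauss_integral /Rintegral fineK; last first.
  by apply: integrable_fin_num => //; exact: integrable_gauss_integral.
rewrite [RHS]integral_mkcond; apply: eq_integral => t _.
by rewrite fE /patch; case: ifPn.
Qed.

Let integral_abs_kernel_le v :
  (\int[mu]_t `|(f (t, v))%:E| <= (`|x - X v| * \int[mu]_(t in D) gauss e t)%:E)%E.
Proof.
have iG := gauss_integrable e0.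
have -> : (\int[mu]_t `|(f (t, v))%:E| = \int[mu]_(t in D) `|(kernel v t)%:E|)%E.
  rewrite [RHS]integral_mkcond; apply: eq_integral => t _.
  by rewrite fE /patch; case: ifPn => // _; exact: abse0.
have iGX : mu.-integrable D (EFin \o (fun t => `|x - X v| * gauss e t)).
  exact: integrableZl_EFin.
rewrite -RintegralZl // /Rintegral fineK; last exact: integrable_fin_num.
have ik := integrable_gauss_integral 0 (x - X v) e0.
apply: ge0_le_integral => //.
- by apply: measurableT_comp => //; have /measurable_int := ik.
- by have /measurable_int := iGX.
- move=> t /=; rewrite in_itv /= andbT => t0; rewrite lee_fin normrM.
  by rewrite (ger0_norm (gauss_ge0 _ _)) ler_wpM2r ?gauss_ge0 // normr_fourier_integrand0_le.
Qed.

Let integrable_f : (mu \x P)%E.-integrable setT (EFin \o f).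
Proof.
apply/(@integrable21ltyP _ _ (measurableTypeR R) T R mu P (EFin \o f)).
  exact/measurable_EFinP.
set K := \int[mu]_(t in D) gauss e t.
have iK : P.-integrable setT (EFin \o (fun v => K * `|x - X v|)).
  by apply: integrableZl_EFin => //; exact: integrable_abse (integrable_shift x).
apply: (@le_lt_trans _ _ (\int[P]_v (K * `|x - X v|)%:E)%E); last first.
  by have := integrable_fin_num measurableT iK; rewrite fin_numE -ltey => /andP[].
apply: ge0_le_integral => //.
- by move=> v _; exact: integral_ge0.
- apply: (@measurable_fun_fubini_tonelli_G _ _ (measurableTypeR R) T R mu
    (fun z => `|(f z)%:E|%E)) => //.
  by apply: measurableT_comp => //; exact/measurable_EFinP.
- by have /measurable_int := iK.
- by move=> v _; rewrite mulrC; exact: integral_abs_kernel_le.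
Qed.

Let expectation_kernel t : (\int[P]_v (f (t, v))%:E =
  ((fun t => (fourier_integrand (char_fun P X) x t * gauss e t)%:E) \_ D) t)%E.
Proof.
rewrite patchE; case: ifPn => tD; last first.
  by rewrite (eq_integral (cst 0%E)) ?integral0 // => v _; rewrite fE patchE (negbTE tD).
have t0 : 0 < t by move: tD; rewrite inE /= in_itv /= andbT.
have ik : P.-integrable setT
    (EFin \o (fun v => fourier_integrand (fourier_monomial 0) (x - X v) t)).
  apply: (@integrable_normr_le _ _ _ P setT _ (fun v => `|x - X v|)) => //.
  - apply: (@eq_measurable_fun _ _ _ _ _ (fun v => sin (t * (x - X v)) * t^-1)) => [v _|].
      by rewrite fourier_integrand_monomial0.
    apply: measurable_funM => //; apply: measurableT_comp.
      by apply: continuous_measurable_fun; exact: continuous_sin.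
    by apply: measurable_funM => //; exact: measurable_funB.
  - by move=> v _; exact: normr_fourier_integrand0_le.
  - exact: integrable_abse (integrable_shift x).
rewrite fourier_integrand_char_fun mulrC -RintegralZl // /Rintegral fineK; last first.
  by apply: integrable_fin_num => //; exact: integrableZl_EFin.
by apply: eq_integral => v _; rewrite fE patchE tD /kernel mulrC.
Qed.

Lemma integrable_smoothed_char_fun : mu.-integrable D
  (EFin \o (fun t => fourier_integrand (char_fun P X) x t * gauss e t)).
Proof.
apply/integrable_mkcond => //.
have <- : fubini_F P (EFin \o f) =
    (EFin \o (fun t => fourier_integrand (char_fun P X) x t * gauss e t)) \_ D.
  by apply/funext => t; exact: expectation_kernel.
exact: integrable_fubini_F integrable_f.
Qed.

Lemma expectation_gauss_integral : \int[P]_v gauss_integral 0 e (x - X v) =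
  \int[mu]_(t in D) (fourier_integrand (char_fun P X) x t * gauss e t).
Proof.
rewrite /Rintegral; congr fine; rewrite [RHS]integral_mkcond.
transitivity (\int[P]_v \int[mu]_t (f (t, v))%:E)%E.
  by apply: eq_integral => v _; rewrite integral_kernel.
rewrite -(@Fubini _ _ (measurableTypeR R) T R mu P _ integrable_f).
by apply: eq_integral => t _; exact: expectation_kernel.
Qed.

End fubini.

Let integrable_smoothing (a b : R) : P.-integrable setT (EFin \o (fun v => Phi (a * (b - X v)))).
Proof.
apply: (@integrable_bounded _ _ _ P _ 1) => [|v].
  apply: measurableT_comp; last by apply: measurable_funM => //; exact: measurable_funB.
  by apply: continuous_measurable_fun; exact: continuous_std_normal_cdf.
by rewrite ger0_norm ?std_normal_cdf_ge0 // std_normal_cdf_le1.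
Qed.

Lemma smoothed_cdf_fourier x e : 0 < e -> \int[P]_v Phi (e^-1 * (x - X v)) =
  2^-1 + pi^-1 * \int[mu]_(t in D) (fourier_integrand (char_fun P X) x t * gauss e t).
Proof.
move=> e0; rewrite -expectation_gauss_integral //.
have iPhi := integrable_smoothing e^-1 x.
have ih : P.-integrable setT (fun v : T => (2^-1 : R)%:E) by exact: finite_measure_integrable_cst.
under [in RHS]eq_Rintegral do rewrite gauss_integral0E //.
rewrite RintegralZl //; last exact: (integrableB measurableT iPhi ih).
rewrite mulKf ?gt_eqF ?pi_gt0 //.
by rewrite RintegralB // expectation_cst addrC subrK.
Qed.

Section sandwich.
Variables (x e b : R).
Hypothesis e0 : 0 < e.

Let A := [set v | X v <= x].

Let mA : measurable A.
Proof.
by rewrite (_ : A = X @^-1` `]-oo, x]) // -[X @^-1` _]setTI; exact: mX.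
Qed.

Let integrable_indicA : P.-integrable setT (EFin \o (\1_A : T -> R)).
Proof.
apply: (@integrable_bounded _ _ _ P _ 1) => [|v]; first exact: measurable_indic.
by rewrite indicE; case: (_ \in _); rewrite ?normr1 ?normr0.
Qed.

Let probA : fine (P A) = \int[P]_v \1_A v.
Proof. by rewrite /Rintegral integral_indic // setIT. Qed.

Lemma cdf_le_smoothed :
  fine (P A) * Phi (e^-1 * b) <= \int[P]_v Phi (e^-1 * (x + b - X v)).
Proof.
rewrite probA mulrC -RintegralZl //; apply: le_Rintegral => //.
  exact: integrableZl_EFin.
move=> v _; rewrite indicE; case: (boolP (v \in A)) => vA; last first.
  by rewrite mulr0 std_normal_cdf_ge0.
rewrite mulr1 std_normal_cdf_nd // ler_pM2l ?invr_gt0 //.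
by move: vA; rewrite inE /A /= => vA; rewrite addrAC lerDr subr_ge0.
Qed.

Lemma smoothed_le_cdf :
  \int[P]_v Phi (e^-1 * (x - b - X v)) <= fine (P A) + Phi (- (e^-1 * b)).
Proof.
have ic : P.-integrable setT (fun v : T => (Phi (- (e^-1 * b)))%:E).
  exact: finite_measure_integrable_cst.
have -> : fine (P A) + Phi (- (e^-1 * b)) = \int[P]_v (\1_A v + Phi (- (e^-1 * b))).
  by rewrite probA RintegralD // expectation_cst.
apply: le_Rintegral => //; first exact: (integrableD measurableT integrable_indicA ic).
move=> v _; rewrite indicE; case: (boolP (v \in A)) => vA.
  by rewrite (le_trans (std_normal_cdf_le1 _)) // lerDl std_normal_cdf_ge0.
rewrite add0r std_normal_cdf_nd // -mulrN ler_pM2l ?invr_gt0 //.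
move: vA; rewrite notin_setE /A /= => /negP; rewrite -ltNge => vA.
by rewrite addrAC -[leRHS]add0r lerD2r subr_le0 ltW.
Qed.

End sandwich.

Section comparison.
Variables (g : R -> R[i]) (h : R -> R).
Hypothesis char_fun_near : forall t, 0 < t -> normc (char_fun P X t - g t) <= t * h t.
Hypothesis ih : mu.-integrable D (EFin \o h).
Hypothesis ig : forall x, mu.-integrable D (EFin \o fourier_integrand g x).

Let G x := \int[mu]_(t in D) fourier_integrand g x t.
Hypothesis continuous_G : continuous G.

Let gauss_bound (k : R -> R) e t : `|k t * gauss e t| <= `|k t|.
Proof. by rewrite normrM ler_piMr // ger0_norm ?gauss_ge0 ?gauss_le1. Qed.

Let integrable_gaussM (k : R -> R) e : mu.-integrable D (EFin \o k) ->
  mu.-integrable D (EFin \o (fun t => k t * gauss e t)).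
Proof.
move=> ik; apply: (@integrable_normr_le _ _ _ mu D _ (fun t => `|k t|)) => //.
- apply: measurable_funM; first exact: integrable_measurable_fun ik.
  by apply: measurable_funTS; exact: measurable_gauss.
- exact: integrable_abse ik.
Qed.

Let smoothed_dist_le x e : 0 < e ->
  `|\int[P]_v Phi (e^-1 * (x - X v)) -
    (2^-1 + pi^-1 * \int[mu]_(t in D) (fourier_integrand g x t * gauss e t))| <=
  pi^-1 * \int[mu]_(t in D) h t.
Proof.
move=> e0; rewrite smoothed_cdf_fourier // opprD addrACA subrr add0r -mulrBr normrM.
rewrite gtr0_norm ?invr_gt0 ?pi_gt0 // ler_pM2l ?invr_gt0 ?pi_gt0 //.
have iX' := integrable_smoothed_char_fun x e0; have ig' := integrable_gaussM e (ig x).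
have id : mu.-integrable D (EFin \o (fun t =>
    fourier_integrand (char_fun P X) x t * gauss e t - fourier_integrand g x t * gauss e t)).
  exact: (integrableB _ iX' ig').
rewrite -RintegralB // (le_trans (le_normr_Rintegral _ id)) //.
apply: le_Rintegral => //; first exact: (integrable_abse id).
move=> t /=; rewrite in_itv /= andbT => t0.
rewrite -mulrBl fourier_integrandB (le_trans (gauss_bound _ _ _)) //.
rewrite (le_trans (normr_fourier_integrand_le _ _ t0)) // ler_pdivrMr // mulrC.
exact: char_fun_near.
Qed.

Let cvg_smoothed x :
  \int[mu]_(t in D) (fourier_integrand g x t * gauss n.+1%:R^-1 t) @[n --> \oo] --> G x.
Proof.
pose f_ n t := (fourier_integrand g x t * gauss n.+1%:R^-1 t)%:E.
have mf_ n : measurable_fun D (f_ n).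
  by have /measurable_int := integrable_gaussM n.+1%:R^-1 (ig x).
have /measurable_int mg := ig x.
have f_cvg : {ae mu, forall t, D t -> f_ ^~ t @ \oo --> (fourier_integrand g x t)%:E}.
  apply: aeW => t _; apply: cvg_EFin; first exact: nearW.
  rewrite -[X in _ --> X]mulr1; apply: cvgMr.
  have gauss0 : gauss t 0 = 1 by rewrite /gauss mulr0 expr0n mul0r oppr0 expR0.
  rewrite -[X in _ --> X]gauss0; under eq_fun do rewrite gaussC.
  exact: (cvg_comp _ _ (@cvg_harmonic R) (@continuous_gauss R t 0)).
have f_bound : {ae mu, forall t n, D t -> (`|f_ n t| <= `|(fourier_integrand g x t)%:E|)%E}.
  by apply: aeW => t n _; rewrite /f_ /= lee_fin.
have iabs := integrable_abse (ig x).
have [_ _ cvgf] := @dominated_convergence _ _ R mu D (measurable_itv _) _ _ _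
  mf_ mg f_cvg iabs f_bound.
apply: (@fine_cvg _ _ _ _ (fun n => (\int[mu]_(t in D) f_ n t)%E)).
by rewrite fineK //; apply: integrable_fin_num => //; exact: ig.
Qed.

Let K := pi^-1 * \int[mu]_(t in D) h t.
Let H x := 2^-1 + pi^-1 * G x.
Let F x := fine (P [set v | X v <= x]).

Let cvg_smoothed_inversion y : 2^-1 + pi^-1 *
  \int[mu]_(t in D) (fourier_integrand g y t * gauss n.+1%:R^-1 t) @[n --> \oo] --> H y.
Proof. by apply: cvgD; [exact: cvg_cst|apply: cvgMr; exact: cvg_smoothed]. Qed.

Let harmonic_gt0 n : 0 < n.+1%:R^-1 :> R. Proof. by rewrite invr_gt0. Qed.

Let cvg_scaled_pinfty (b : R) : 0 < b -> (n.+1%:R^-1)^-1 * b @[n --> \oo] --> +oo.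
Proof.
move=> b0; apply/cvgryPge => A; near=> n; rewrite invrK -ler_pdivrMr //.
rewrite (@le_trans _ _ n%:R) ?ler_nat //; near: n; exact: nbhs_infty_ger.
Unshelve. all: by end_near. Qed.

Let cdf_le_shifted x (b : R) : 0 < b -> F x <= H (x + b) + K.
Proof.
move=> b0; rewrite -[F x]mulr1.
apply: (@ler_cvg_to _ \oo _ _ (fun n => F x * Phi ((n.+1%:R^-1)^-1 * b))
  (fun n => 2^-1 + pi^-1 *
     \int[mu]_(t in D) (fourier_integrand g (x + b) t * gauss n.+1%:R^-1 t) + K)).
- by apply: cvgMr; apply: cvg_comp (cvg_scaled_pinfty b0) _; exact: cvg_std_normal_cdfy.
- by apply: cvgD; [exact: cvg_smoothed_inversion|exact: cvg_cst].
- apply: nearW => n; apply: (le_trans (cdf_le_smoothed x b (harmonic_gt0 n))).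
  have := smoothed_dist_le (x + b) (harmonic_gt0 n).
  by rewrite ler_norml => /andP[_]; rewrite lerBlDr [X in _ <= X -> _]addrC.
Qed.

Let shifted_le_cdf x (b : R) : 0 < b -> H (x - b) - K <= F x.
Proof.
move=> b0; rewrite -[leRHS]addr0.
apply: (@ler_cvg_to _ \oo _ _ (fun n => 2^-1 + pi^-1 *
     \int[mu]_(t in D) (fourier_integrand g (x - b) t * gauss n.+1%:R^-1 t) - K)
   (fun n => F x + Phi (- ((n.+1%:R^-1)^-1 * b)))).
- by apply: cvgB; [exact: cvg_smoothed_inversion|exact: cvg_cst].
- apply: cvgD; first exact: cvg_cst.
  apply: (@cvg_comp _ _ _ _ (fun y => Phi (- y)) _ _ _ (cvg_scaled_pinfty b0)).
  by have /cvgNy_compNP := @cvg_std_normal_cdfNy R.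
- apply: nearW => n; apply: le_trans (smoothed_le_cdf x b (harmonic_gt0 n)).
  have := smoothed_dist_le (x - b) (harmonic_gt0 n).
  by rewrite ler_norml => /andP[+ _]; rewrite lerBrDr [X in X <= _ -> _]addrC.
Qed.

Let cvg_H_shift x (s : R) : H (x + s * n.+1%:R^-1) @[n --> \oo] --> H x.
Proof.
apply: cvgD; first exact: cvg_cst.
apply: cvgMr; apply: continuous_cvg; first exact: continuous_G.
rewrite -[X in _ --> X]addr0; apply: cvgD; first exact: cvg_cst.
by rewrite -[X in _ --> X](mulr0 s); apply: cvgMr; exact: cvg_harmonic.
Qed.

Lemma cdf_fourier_distance x : `|F x - H x| <= K.
Proof.
rewrite ler_norml; apply/andP; split.
- rewrite lerBrDr addrC.
  apply: (@ler_cvg_to _ \oo _ _ (fun n => H (x + -1 * n.+1%:R^-1) - K) (cst (F x))).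
  + by apply: cvgB; [exact: cvg_H_shift|exact: cvg_cst].
  + exact: cvg_cst.
  + by apply: nearW => n; rewrite mulN1r; exact: shifted_le_cdf.
- rewrite lerBlDr addrC.
  apply: (@ler_cvg_to _ \oo _ _ (cst (F x)) (fun n => H (x + 1 * n.+1%:R^-1) + K)).
  + exact: cvg_cst.
  + by apply: cvgD; [exact: cvg_H_shift|exact: cvg_cst].
  + by apply: nearW => n; rewrite mul1r; exact: cdf_le_shifted.
Qed.

End comparison.

End smoothing.

(** * Characteristic functions of sums of gamma variables *)

Section clog_cumulants.
Context {R : realType}.
Implicit Types u t : R.

Lemma clog_cumulant_expansion n u : 0 <= u ->
  normc (clog u - u%:C * 'i -
    ((- (u ^+ 2 / 2))%:C + \sum_(i < n) (u%:C * 'i) ^+ i.+3 / i.+3%:R)) <= u ^+ n.+3.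
Proof.
move=> u0; apply: le_trans (clog_expansion n.+2 u0); rewrite 2!big_ord_recl /= divr1 expr1.
have -> : (u%:C * 'i) ^+ 2 / 2 = (- (u ^+ 2 / 2))%:C :> R[i].
  by rewrite exprMn sqr_i mulrN1 mulNr -rmorphXn -(rmorph_nat (real_complex R)) -fmorphV
    -rmorphM -rmorphN.
by rewrite le_eqVlt; apply/orP; left; apply/eqP; congr normc; rewrite -!addrA !opprD.
Qed.

End clog_cumulants.

Section gamma_sums.
Context {R : realType}.
Variables (r : R) (a : nat -> R) (M : nat).
Hypotheses (r0 : 0 <= r) (a_le_sup : forall n, (M <= n)%N -> 0 <= a n <= a M).
Implicit Types (t : R) (K k m : nat).

Definition power_sum K k := r * \sum_(M <= n < K) a n ^+ k.

Definition gamma_cf K t : R[i] :=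
  cexp (\sum_(M <= n < K) r%:C * (clog (a n * t) - (a n * t)%:C * 'i)).

Lemma sup_weight_ge0 : 0 <= a M.
Proof. by have /andP[a0 aM] := a_le_sup (leqnn M); exact: le_trans aM. Qed.

Lemma power_sum_nd k : nondecreasing_seq (power_sum ^~ k).
Proof.
move=> K L KL; rewrite ler_wpM2l // nondecreasing_series // => n Mn _.
by have /andP[a0 _] := a_le_sup Mn; rewrite exprn_ge0.
Qed.

Lemma power_sum_ge0 K k : 0 <= power_sum K k.
Proof.
rewrite mulr_ge0 // big_nat sumr_ge0 // => n /andP[Mn _].
by have /andP[a0 _] := a_le_sup Mn; rewrite exprn_ge0.
Qed.

Lemma power_sum_le K k : power_sum K k.+2 <= a M ^+ k * power_sum K 2.
Proof.
rewrite /power_sum mulrCA ler_wpM2l // mulr_sumr ler_sum_nat // => n /andP[Mn _].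
have /andP[a0 an] := a_le_sup Mn; rewrite -addn2 exprD ler_wpM2r ?exprn_ge0 //.
by rewrite lerXn2r // nnegrE sup_weight_ge0.
Qed.

Lemma sum_cumulant_terms K n t :
  \sum_(M <= m < K) r%:C * ((- ((a m * t) ^+ 2 / 2))%:C +
    \sum_(i < n) ((a m * t)%:C * 'i) ^+ i.+3 / i.+3%:R) =
  (- (power_sum K 2 * t ^+ 2 / 2))%:C +
  \sum_(i < n) (power_sum K i.+3 / i.+3%:R)%:C * (t%:C * 'i) ^+ i.+3.
Proof.
under eq_bigr do rewrite mulrDr; rewrite big_split /=; congr (_ + _).
  rewrite -mulr_sumr -rmorph_sum -rmorphM /=; congr (_%:C).
  rewrite sumrN mulrN -mulr_suml; under eq_bigr do rewrite exprMn.
  by rewrite -mulr_suml /power_sum !mulrA.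
under eq_bigr do rewrite mulr_sumr; rewrite exchange_big /=; apply: eq_bigr => i _.
move: i.+3 => k; rewrite /power_sum !rmorphM /= fmorphV rmorph_nat rmorph_sum mulr_sumr !mulr_suml.
apply: eq_bigr => m _; rewrite rmorphXn rmorphM /= -[_ * 'i]mulrA exprMn.
by rewrite !mulrA [RHS]mulrAC.
Qed.

Lemma gamma_cf_log_expansion K n t : 0 <= t -> exists2 rho,
  \sum_(M <= m < K) r%:C * (clog (a m * t) - (a m * t)%:C * 'i) =
   (- (power_sum K 2 * t ^+ 2 / 2))%:C +
   (\sum_(i < n) (power_sum K i.+3 / i.+3%:R)%:C * (t%:C * 'i) ^+ i.+3 + rho) &
  normc rho <= power_sum K 2 * t ^+ 2 * (t * a M) ^+ n.+1.
Proof.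
move=> t0; pose main m : R[i] := (- ((a m * t) ^+ 2 / 2))%:C +
  \sum_(i < n) ((a m * t)%:C * 'i) ^+ i.+3 / i.+3%:R.
exists (\sum_(M <= m < K) r%:C * (clog (a m * t) - (a m * t)%:C * 'i - main m)).
  rewrite addrA -sum_cumulant_terms -big_split /=; apply: eq_bigr => m _.
  by rewrite -mulrDr; congr (_ * _); rewrite /main [RHS]addrC subrK.
have -> : power_sum K 2 * t ^+ 2 * (t * a M) ^+ n.+1 =
    \sum_(M <= m < K) r * (a m ^+ 2 * (t ^+ 2 * (t * a M) ^+ n.+1)).
  by rewrite /power_sum -mulr_sumr -mulr_suml !mulrA.
rewrite (le_trans (normc_sum _ _ _)) // ler_sum_nat // => m /andP[Mm _].
have /andP[am0 am] := a_le_sup Mm; rewrite normcM normc_real ger0_norm // ler_wpM2l //.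
rewrite (le_trans (clog_cumulant_expansion _ _)) ?mulr_ge0 //.
rewrite (exprD _ 2 n.+1) exprMn mulrA ler_wpM2l //.
  by rewrite mulr_ge0 ?exprn_ge0.
by rewrite mulrC lerXn2r ?nnegrE ?mulr_ge0 ?sup_weight_ge0 // ler_wpM2l.
Qed.

Lemma gamma_cf_estimate K n t : 0 <= t -> t * a M <= truncation_radius n ->
  power_sum K 2 <= 1 ->
  normc (gamma_cf K t - (expR (- (power_sum K 2 * t ^+ 2 / 2)))%:C *
    edgeworth_poly n (fun i => power_sum K i.+3 / i.+3%:R) t) <=
  (t * a M) ^+ n.+1 * (truncation_poly n).[t ^+ 2] * expR (- (power_sum K 2 * t ^+ 2 / 4)).
Proof.
move=> t0 ted p1; have [rho logE rho_le] := gamma_cf_log_expansion K n t0.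
have e0 := sup_weight_ge0.
rewrite /gamma_cf logE cexpD cexp_real -mulrBr normcM normc_real ger0_norm ?expR_ge0 //.
set p := power_sum K 2 in rho_le p1 *; set tau := p * t ^+ 2.
have p0 : 0 <= p by exact: power_sum_ge0.
have tau0 : 0 <= tau by rewrite mulr_ge0 ?sqr_ge0.
have te0 : 0 <= t * a M by rewrite mulr_ge0.
have term_le (i : 'I_n) :
    normc ((power_sum K i.+3 / i.+3%:R)%:C * (t%:C * 'i) ^+ i.+3) <= tau * (t * a M) ^+ i.+1.
  rewrite normcM normcX normcM normc_i !normc_real mulr1 !ger0_norm //; last first.
    by rewrite divr_ge0 ?power_sum_ge0.
  rewrite [leRHS](_ : _ = a M ^+ i.+1 * p * t ^+ i.+3); last first.
    by rewrite /tau exprMn (exprD _ 2 i.+1); ring.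
  rewrite ler_wpM2r ?exprn_ge0 // (le_trans _ (power_sum_le _ _)) //.
  by rewrite ler_piMr ?power_sum_ge0 // invf_le1 ?ler1n ?ltr0n.
have te_radius : 0 <= t * a M <= truncation_radius n by rewrite te0.
have trunc := edgeworth_truncation tau0 te_radius term_le rho_le.
apply: (le_trans (ler_wpM2l (expR_ge0 _) trunc)).
rewrite mulrCA -expRD (_ : - (tau / 2) + tau / 4 = - (tau / 4)); last by field.
rewrite ler_wpM2r ?expR_ge0 // ler_wpM2l ?exprn_ge0 // truncation_poly_nd //.
by rewrite ler_piMl ?sqr_ge0.
Qed.

Lemma gamma_cf_decay K m b t : 0 <= b -> (M + m <= K)%N ->
  (forall n, (M <= n < M + m)%N -> b <= a n) ->
  normc (gamma_cf K t) <= expR (- (r * m%:R / 2 * ln (1 + (b * t) ^+ 2))).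
Proof.
move=> b0 MmK ab; rewrite normc_cexp ler_expR -mulr_sumr Re_realM.
rewrite (raddf_sum (@complex.Re R)).
have ln_ge0' (x : R) : 0 <= ln (1 + x ^+ 2) by rewrite ln_ge0 // lerDl sqr_ge0.
under eq_bigr do rewrite raddfB /= mulr0 mul0r subr0 oppr0 addr0.
rewrite sumrN mulrN lerN2 -mulrA -mulrA ler_wpM2l // -mulr_suml.
rewrite mulrCA mulrC ler_pM2r ?invr_gt0 //.
rewrite (@big_cat_nat _ _ _ (M + m)%N) ?leq_addr //= -[leLHS]addr0 lerD ?sumr_ge0 //.
rewrite mulr_natl -[m in leLHS](addKn M) -sumr_const_nat ler_sum_nat // => n nM.
rewrite ler_ln ?posrE ?ltr_pwDl ?sqr_ge0 // lerD2l !exprMn ler_wpM2r ?sqr_ge0 //.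
by rewrite lerXn2r // ?nnegrE ?ab // (le_trans b0) ?ab.
Qed.

End gamma_sums.

Definition gamma_cumulant {R : realType} (r : R) (a : nat -> R) M k : R :=
  r * tailsum M (fun n => a n ^+ k) / k%:R.

Record normalized_weights {R : realType} (r c1 c2 : R) (M : nat) (a : nat -> R) : Prop := {
  weights_sup : forall m, (M <= m)%N -> 0 <= a m <= a M;
  weights_block : forall m, (M <= m < M + M)%N -> c1 * a M <= a m;
  weights_scale : c2 <= M%:R * a M ^+ 2;
  weights_unit : (fun K => power_sum r a M K 2) @ \oo --> (1 : R) }.

Definition edgeworth_char_fun {R : realType} n (c : nat -> R) t : R[i] :=
  (gauss 1 t)%:C * edgeworth_poly n c t.

Section normalized_weights.
Context {R : realType}.
Variables (r c1 c2 : R) (M : nat) (a : nat -> R) (phi : R -> R[i]).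
Hypotheses (r0 : 0 < r) (c10 : 0 < c1) (c20 : 0 < c2).
Hypothesis a_normal : normalized_weights r c1 c2 M a.
Hypothesis phi_lim : forall t, ccvg (fun K => gamma_cf r a M K t) (phi t).

Let a_le_sup := weights_sup a_normal.

Lemma sup_weight_gt0 : 0 < a M.
Proof.
rewrite lt_neqAle (sup_weight_ge0 a_le_sup) andbT eq_sym.
apply: contraTneq (weights_scale a_normal).
by move=> ->; rewrite expr0n mulr0 -ltNge.
Qed.

Lemma power_sum2_le1 K : power_sum r a M K 2 <= 1.
Proof.
have unit_cvg := weights_unit a_normal; rewrite -(cvg_lim (@Rhausdorff R) unit_cvg).
apply: (nondecreasing_cvgn_le (power_sum_nd (ltW r0) a_le_sup 2)).
by apply/cvg_ex; exists 1; exact: unit_cvg.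
Qed.

Lemma power_sum_le_expr K k : power_sum r a M K k.+2 <= a M ^+ k.
Proof.
rewrite (le_trans (power_sum_le (ltW r0) a_le_sup K k)) // ler_piMr ?power_sum2_le1 //.
by rewrite exprn_ge0 // ltW // sup_weight_gt0.
Qed.

Lemma cvg_sum_weights k :
  (fun K => \sum_(M <= n < K) a n ^+ k.+2) @ \oo --> tailsum M (fun n => a n ^+ k.+2).
Proof.
apply: nondecreasing_is_cvgn.
  by apply: nondecreasing_series => n Mn _; have /andP[a0 _] := a_le_sup Mn; rewrite exprn_ge0.
exists (r^-1 * a M ^+ k) => _ [K _ <-].
by rewrite -(ler_pM2l r0) mulVKf ?gt_eqF //; exact: power_sum_le_expr.
Qed.

Lemma cvg_gamma_cumulant k :
  (fun K => power_sum r a M K k.+2 / k.+2%:R) @ \oo --> gamma_cumulant r a M k.+2.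
Proof. by apply: cvgMl; apply: cvgMr; exact: cvg_sum_weights. Qed.

Lemma gamma_cumulant_ge0_le1 k : a M <= 1 -> 0 <= gamma_cumulant r a M k.+2 <= 1.
Proof.
move=> a1; have power_sum01 K : 0 <= power_sum r a M K k.+2 / k.+2%:R <= 1.
  rewrite divr_ge0 ?(power_sum_ge0 (ltW r0) a_le_sup) //= ler_pdivrMr ?ltr0n // mul1r.
  rewrite (@le_trans _ _ 1) ?ler1n // (le_trans (power_sum_le_expr K k)) //.
  by rewrite exprn_ile1 // ltW // sup_weight_gt0.
apply/andP; split.
  apply: (cvgr_to_ge (@cvg_gamma_cumulant k)).
  by apply: nearW => K; have /andP[] := power_sum01 K.
apply: (cvgr_to_le (@cvg_gamma_cumulant k)).
by apply: nearW => K; have /andP[] := power_sum01 K.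
Qed.

Local Notation kappa := (fun i => gamma_cumulant r a M i.+3).

Lemma gamma_cf_limit_estimate n t : 0 <= t -> t * a M <= truncation_radius n ->
  normc (phi t - edgeworth_char_fun n kappa t) <=
  (t * a M) ^+ n.+1 * (truncation_poly n).[t ^+ 2] * expR (- (t ^+ 2 / 4)).
Proof.
move=> t0 ted.
have cvg_exp (c : R) : expR (- (power_sum r a M K 2 * t ^+ 2 / c)) @[K --> \oo] -->
    expR (- (t ^+ 2 / c)).
  rewrite -[X in - (X / c)]mul1r; apply: continuous_cvg; first exact: continuous_expR.
  by apply: cvgN; apply: cvgMl; apply: cvgMl; exact: weights_unit a_normal.
have estimate K := gamma_cf_estimate (ltW r0) a_le_sup t0 ted (power_sum2_le1 K).
apply: (normc_le_ccvg _ _ (nearW _ estimate)); last by apply: cvgMr; exact: cvg_exp.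
apply: ccvgD (phi_lim t) _; apply: ccvgN; apply: ccvgM.
  by rewrite gauss1; apply: ccvg_real; exact: cvg_exp.
by apply: ccvg_edgeworth_poly => i; exact: cvg_gamma_cumulant.
Qed.

Lemma gamma_cf_limit_decay t :
  normc (phi t) <= expR (- (r * M%:R / 2 * ln (1 + (c1 * a M * t) ^+ 2))).
Proof.
apply: (normc_le_ccvg (phi_lim t) (cvg_cst _)); near=> K.
have ca0 : 0 <= c1 * a M by rewrite mulr_ge0 ?ltW // sup_weight_gt0.
apply: (gamma_cf_decay (ltW r0) t ca0 _ (weights_block a_normal)).
by near: K; exact: nbhs_infty_ge.
Unshelve. all: by end_near. Qed.

End normalized_weights.

Lemma expR_ln_decay {R : realType} (A l0 y : R) : 1 <= A -> 0 < y -> l0 <= ln (1 + y) ->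
  expR (- (A * ln (1 + y))) <= expR l0 * expR (- (A * l0)) / y.
Proof.
move=> A1 y0 ly; rewrite (_ : A * ln (1 + y) = (A - 1) * ln (1 + y) + ln (1 + y)); last by ring.
have y1 : 0 < 1 + y by rewrite addr_gt0.
rewrite opprD expRD [expR (- ln _)]expRN lnK ?posrE //.
rewrite ler_pM ?expR_ge0 ?invr_ge0 ?(ltW y1) //; last by rewrite lef_pV2 ?posrE // lerDr.
rewrite -expRD ler_expR (_ : l0 - A * l0 = - ((A - 1) * l0)); last by ring.
by rewrite lerN2 ler_wpM2l // subr_ge0.
Qed.

Lemma expRN_inv_sqr_le {R : realType} k (b e : R) : 0 < b -> 0 < e <= 1 ->
  expR (- (b / e ^+ 2)) <= k`!%:R / b ^+ k * e ^+ k.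
Proof.
move=> b0 /andP[e0 e1]; have e2 : 0 < e ^+ 2 by rewrite exprn_gt0.
have h := exprn_expRN_le k b0 (ltW (_ : 0 < e ^- 2)).
have {h} : e ^- 2 ^+ k * expR (- (b / e ^+ 2)) <= k`!%:R / b ^+ k by apply: h; rewrite invr_gt0.
rewrite exprVn mulrC ler_pdivrMr ?exprn_gt0 // => /le_trans; apply.
by rewrite ler_wpM2l ?divr_ge0 ?exprn_ge0 ?(ltW b0) // -exprM ler_wiXn2l ?(ltW e0) // leq_pmull.
Qed.

Section edgeworth_bounds.
Context {R : realType}.
Variables (r c1 c2 : R) (n : nat).
Hypotheses (r0 : 0 < r) (c10 : 0 < c1) (c20 : 0 < c2).
Local Notation delta := (@truncation_radius R n).

Let small_t_char_fun_bound : exists2 C : R, 0 <= C & forall M a phi t,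
  normalized_weights r c1 c2 M a -> (forall t, ccvg (fun K => gamma_cf r a M K t) (phi t)) ->
  0 < t -> t * a M <= delta ->
  normc (phi t - edgeworth_char_fun n (fun i => gamma_cumulant r a M i.+3) t) <=
  C * a M ^+ n.+1 * (t / (1 + t ^+ 2)).
Proof.
have [|C C0 CP] := @poly_gauss_bounded R ((1 + 'X^2) * 'X^n * (truncation_poly n \Po 'X^2)) 4^-1.
  by rewrite invr_gt0.
exists C => // M a phi t a_normal phi_lim t0 ted; have a0 := sup_weight_gt0 c20 a_normal.
have p : 0 < 1 + t ^+ 2 by rewrite ltr_pwDl // sqr_ge0.
apply: (le_trans (gamma_cf_limit_estimate r0 c20 a_normal phi_lim (ltW t0) ted)).
have -> : (t * a M) ^+ n.+1 * (truncation_poly n).[t ^+ 2] * expR (- (t ^+ 2 / 4)) =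
    (t ^+ n * (truncation_poly n).[t ^+ 2] * expR (- (t ^+ 2 / 4))) * (a M ^+ n.+1 * t).
  by rewrite exprMn [t ^+ n.+1]exprS; ring.
have -> : C * a M ^+ n.+1 * (t / (1 + t ^+ 2)) = C / (1 + t ^+ 2) * (a M ^+ n.+1 * t).
  by field; rewrite gt_eqF.
rewrite ler_wpM2r ?mulr_ge0 ?exprn_ge0 ?(ltW a0) ?(ltW t0) // ler_pdivlMr //.
apply: le_trans (CP t (ltW t0)); rewrite mulrAC [4^-1 * _]mulrC ler_wpM2r ?expR_ge0 //.
by rewrite (le_trans _ (ler_norm _)) // !hornerE horner_comp !hornerE mulrC mulrA.
Qed.

Let large_t_char_fun_bound : exists2 C : R, 0 <= C & forall M a phi t,
  normalized_weights r c1 c2 M a -> (forall t, ccvg (fun K => gamma_cf r a M K t) (phi t)) ->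
  1 <= r * M%:R / 2 -> 0 < a M <= 1 -> delta < t * a M ->
  normc (phi t) <= C * a M ^+ n.+1 / t ^+ 2.
Proof.
pose l0 : R := ln (1 + (c1 * delta) ^+ 2).
have d0 : 0 < delta := truncation_radius_gt0 n.
have l00 : 0 < l0 by rewrite ln_gt0 // ltrDl exprn_gt0 // mulr_gt0.
pose b := l0 * r * c2 / 2; have b0 : 0 < b by rewrite !mulr_gt0.
exists (expR l0 * ((n.+3)`!%:R / b ^+ n.+3) / c1 ^+ 2).
  by rewrite !mulr_ge0 ?invr_ge0 ?exprn_ge0 ?expR_ge0 ?ltW.
move=> M a phi t a_normal phi_lim A1 /andP[a0 a1] dte.
have t0 : 0 < t by rewrite -(pmulr_lgt0 _ a0) (lt_trans d0).
set A := r * M%:R / 2 in A1; pose y := (c1 * a M * t) ^+ 2.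
have y0 : 0 < y by rewrite exprn_gt0 // !mulr_gt0.
have l0y : l0 <= ln (1 + y).
  rewrite ler_ln ?posrE ?ltr_pwDl ?sqr_ge0 // lerD2l lerXn2r ?nnegrE ?mulr_ge0 ?ltW //.
  by rewrite -mulrA ltr_pM2l // [a M * t]mulrC.
apply: (le_trans (gamma_cf_limit_decay r0 c10 c20 a_normal phi_lim t)).
apply: (le_trans (expR_ln_decay A1 y0 l0y)).
have Al0 : expR (- (A * l0)) <= (n.+3)`!%:R / b ^+ n.+3 * a M ^+ n.+3.
  apply: le_trans (expRN_inv_sqr_le n.+3 b0 (_ : 0 < a M <= 1)); last by rewrite a0.
  rewrite ler_expR lerN2 ler_pdivrMr ?exprn_gt0 // /b /A.
  rewrite (_ : r * M%:R / 2 * l0 * a M ^+ 2 = l0 * r / 2 * (M%:R * a M ^+ 2)); last by ring.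
  by rewrite mulrAC ler_wpM2l ?divr_ge0 ?mulr_ge0 ?(ltW l00) ?(ltW r0) // (weights_scale a_normal).
apply: (le_trans (ler_wpM2r _ (ler_wpM2l (expR_ge0 l0) Al0))); first by rewrite invr_ge0 ltW.
rewrite le_eqVlt; apply/orP; left; apply/eqP; rewrite (exprD (a M) 2 n.+1) /y.
move: (expR l0) (n.+3)`!%:R (b ^+ n.+3) (lt0r_neq0 (exprn_gt0 n.+3 b0)) (a M ^+ n.+1).
by move=> E f B B0 x; field; rewrite B0 !gt_eqF.
Qed.

Let large_t_poly_bound : exists2 C : R, 0 <= C & forall (s : nat -> R) (e t : R),
  (forall i, 0 <= s i <= 1) -> 0 < e <= 1 -> delta < t * e -> 1 <= t ->
  normc (edgeworth_char_fun n s t) <= C * e ^+ n.+1 * (t / (1 + t ^+ 2)).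
Proof.
pose N : R := #|{ffun 'I_n -> 'I_n.+1}|%:R.
have d0 : 0 < delta := truncation_radius_gt0 n.
have [|B B0 BP] := @poly_gauss_bounded R ((1 + 'X^2) * 'X^(n + 3 * n)) 2^-1.
  by rewrite invr_gt0.
exists (N / delta ^+ n.+1 * B); first by rewrite mulr_ge0 ?divr_ge0 ?exprn_ge0 ?ler0n ?(ltW d0).
move=> s e t s01 /andP[e0 _] dte t1; have t0 : 0 < t by exact: lt_le_trans t1.
have p : 0 < 1 + t ^+ 2 by rewrite ltr_pwDl // sqr_ge0.
rewrite /edgeworth_char_fun normcM normc_real ger0_norm ?gauss_ge0 //.
apply: (le_trans (ler_wpM2l (gauss_ge0 1 t) (normc_edgeworth_poly_le n t1 s01))).
have te1 : 1 <= (t * e / delta) ^+ n.+1.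
  by rewrite exprn_ege1 // ler_pdivlMr // mul1r ltW.
have NG0 : 0 <= gauss 1 t * (N * t ^+ (3 * n)).
  by rewrite !mulr_ge0 ?gauss_ge0 ?exprn_ge0 ?(ltW t0).
apply: (le_trans (ler_peMr NG0 te1)).
have -> : gauss 1 t * (N * t ^+ (3 * n)) * (t * e / delta) ^+ n.+1 =
    t ^+ (n + 3 * n) * gauss 1 t * (N / delta ^+ n.+1 * (e ^+ n.+1 * t)).
  by rewrite exprD expr_div_n exprMn [t ^+ n.+1]exprS; ring.
have -> : N / delta ^+ n.+1 * B * e ^+ n.+1 * (t / (1 + t ^+ 2)) =
    B / (1 + t ^+ 2) * (N / delta ^+ n.+1 * (e ^+ n.+1 * t)) by ring.
rewrite ler_wpM2r ?mulr_ge0 ?invr_ge0 ?exprn_ge0 ?(ltW d0) ?(ltW e0) ?(ltW t0) //.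
rewrite ler_pdivlMr //; apply: le_trans (BP t (ltW t0)).
rewrite gauss1 mulrAC [2^-1 * _]mulrC ler_wpM2r ?expR_ge0 //.
by rewrite (le_trans _ (ler_norm _)) // !hornerE mulrC.
Qed.

Lemma edgeworth_char_fun_bound : exists2 C : R, 0 <= C & forall M a phi,
  normalized_weights r c1 c2 M a -> (forall t, ccvg (fun K => gamma_cf r a M K t) (phi t)) ->
  1 <= r * M%:R / 2 -> a M <= delta -> forall t, 0 < t ->
  normc (phi t - edgeworth_char_fun n (fun i => gamma_cumulant r a M i.+3) t) <=
  C * a M ^+ n.+1 * (t / (1 + t ^+ 2)).
Proof.
have [Bsmall Bsmall0 small] := small_t_char_fun_bound.
have [Bphi Bphi0 large_phi] := large_t_char_fun_bound.
have [Bpoly Bpoly0 large_poly] := large_t_poly_bound.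
exists (Bsmall + (Bphi * 2 + Bpoly)) => [|M a phi a_normal phi_lim A1 ad t t0].
  by rewrite !addr_ge0 ?mulr_ge0.
have a0 := sup_weight_gt0 c20 a_normal.
have a1 : a M <= 1 := le_trans ad (truncation_radius_le1 n).
have a01 : 0 < a M <= 1 by rewrite a0.
have tt0 : 0 <= t / (1 + t ^+ 2) by rewrite divr_ge0 ?(ltW t0) // addr_ge0 ?sqr_ge0.
have at0 : 0 <= a M ^+ n.+1 * (t / (1 + t ^+ 2)) by rewrite mulr_ge0 // exprn_ge0 // ltW.
rewrite -!mulrA; have [ted|dte] := leP (t * a M) delta.
  apply: (le_trans (small _ _ _ _ a_normal phi_lim t0 ted)).
  by rewrite -mulrA ler_wpM2r // lerDl addr_ge0 // mulr_ge0.
have t1 : 1 <= t by rewrite -(ler_pM2r a0) mul1r (le_trans ad) // ltW.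
have inv_sqr_le : (t ^+ 2)^-1 <= 2 * (t / (1 + t ^+ 2)).
  rewrite mulrA ler_pdivlMr ?ltr_pwDl ?sqr_ge0 // mulrC ler_pdivrMr ?exprn_gt0 //.
  have t2 : 1 <= t ^+ 2 by exact: exprn_ege1.
  have t3 : t ^+ 2 <= t * t ^+ 2 by rewrite ler_peMl ?sqr_ge0.
  by lra.
have s01 i : 0 <= gamma_cumulant r a M i.+3 <= 1.
  exact: (gamma_cumulant_ge0_le1 r0 c20 a_normal).
rewrite (le_trans (le_normcD _ _)) // normcN mulrDl.
apply: (@le_trans _ _ ((Bphi * 2 + Bpoly) * (a M ^+ n.+1 * (t / (1 + t ^+ 2))))); last first.
  by rewrite lerDr mulr_ge0.
rewrite mulrDl lerD //; last first.
  by rewrite (le_trans (large_poly _ _ _ s01 a01 dte t1)) // -[leLHS]mulrA.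
apply: (le_trans (large_phi _ _ _ _ a_normal phi_lim A1 a01 dte)).
by rewrite -!mulrA ler_wpM2l // mulrCA ler_wpM2l // exprn_ge0 // ltW.
Qed.

End edgeworth_bounds.

(** * Tails of regularly varying sequences *)

Section tailsum.
Context {R : realType} (v : nat -> R).

Lemma cvg_tailsum M : cvgn (series v) ->
  (fun K => \sum_(M <= n < K) v n) @ \oo --> tailsum M v.
Proof. by rewrite -(is_cvg_series_restrict M). Qed.

Lemma sum_le_tailsum M K : (forall n, 0 <= v n) -> cvgn (series v) ->
  \sum_(M <= n < K) v n <= tailsum M v.
Proof.
move=> v0 v_cvg; apply: nondecreasing_cvgn_le; first by apply: nondecreasing_series => n _ _.
exact: cvg_tailsum.
Qed.

Lemma tailsumZ (c : R) M : cvgn (fun K => \sum_(M <= n < K) v n) ->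
  tailsum M (fun n => c * v n) = c * tailsum M v.
Proof.
move=> v_cvg; apply: cvg_lim => //.
by under eq_fun do rewrite -mulr_sumr; apply: cvgMr.
Qed.

End tailsum.

Section dyadic_sums.
Context {R : realType} (b : nat -> R) (rho : R) (N : nat).
Hypotheses (N_gt0 : (0 < N)%N) (rho1 : rho < 1) (b_ge0 : forall n, 0 <= b n).
Hypothesis b_ni : forall m n, (N <= m)%N -> (m <= n)%N -> b n <= b m.
Hypothesis b_double : forall n, (N <= n)%N -> 2 * b (2 * n)%N <= rho * b n.

Lemma dyadic_block_le n : (N <= n)%N -> \sum_(n <= i < 2 * n) b i <= n%:R * b n.
Proof.
move=> Nn; rewrite (@le_trans _ _ (\sum_(n <= i < 2 * n) b n)) //.
  by apply: ler_sum_nat => i /andP[ni _]; exact: b_ni.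
by rewrite sumr_const_nat mul2n -addnn addnK mulr_natl.
Qed.

Lemma sum_dyadic_le j n : (N <= n)%N ->
  \sum_(n <= i < 2 ^ j * n) b i <= (1 - rho)^-1 * (n%:R * b n).
Proof.
have rho_inv0 : 0 <= (1 - rho)^-1 by rewrite invr_ge0 subr_ge0 ltW.
elim: j n => [|j ih] n Nn; first by rewrite mul1n big_geq // !mulr_ge0.
have n2n : (n <= 2 * n)%N by rewrite leq_pmull.
rewrite expnSr -mulnA (@big_cat_nat _ _ _ (2 * n)) ?leq_pmull ?expn_gt0 //=.
apply: (le_trans (lerD (dyadic_block_le Nn) (ih _ (leq_trans Nn n2n)))).
rewrite [leRHS](_ : _ = n%:R * b n + (1 - rho)^-1 * (n%:R * (rho * b n))); last first.
  by field; rewrite gt_eqF // subr_gt0.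
by rewrite lerD2l ler_wpM2l // natrM -mulrA mulrCA ler_wpM2l // b_double.
Qed.

Lemma sum_halving_le M K : (N <= M)%N ->
  \sum_(M <= n < K) b n <= (1 - rho)^-1 * (M%:R * b M).
Proof.
move=> NM; apply: le_trans (sum_dyadic_le K NM).
apply: (nondecreasing_series (P := xpredT)) => //.
by rewrite (leq_trans (ltnW (ltn_expl K (ltnSn 1)))) // leq_pmulr // (leq_trans N_gt0).
Qed.

End dyadic_sums.

Record dyadic_regular {R : realType} (c C : R) (lam : nat -> R) (M : nat) : Prop := {
  regular_gt0 : (0 < M)%N;
  regular_block : forall m, (M <= m < M + M)%N -> c * lam M <= lam m;
  regular_tail : c ^+ 2 * (M%:R * lam M ^+ 2) <= tailsum M (fun n => lam n ^+ 2) <=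
    C * (M%:R * lam M ^+ 2) }.

Section regular_variation.
Context {R : realType} (gam : R) (l : R -> R) (lam : nat -> R).
Hypothesis l_slow : slowly_varying l.
Hypothesis lamE : forall n, (0 < n)%N -> lam n = l n%:R * n%:R `^ (- gam).

Lemma cvg_regular_variation_ratio m : (0 < m)%N ->
  lam (m * n)%N / lam n @[n --> \oo] --> (m%:R : R) `^ (- gam).
Proof.
move=> m0; have [_ /(_ m%:R)] := l_slow; rewrite ltr0n => /(_ m0) l_ratio.
have l_ratio_nat : l (m%:R * n%:R) / l n%:R @[n --> \oo] --> (1 : R).
  exact: (cvg_comp _ (fun x => l (m%:R * x) / l x) (@cvgr_idn R) l_ratio).
rewrite -[X in _ --> X]mul1r.
apply: (@cvg_trans _ (l (m%:R * n%:R) / l n%:R * m%:R `^ (- gam) @[n --> \oo]));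
  last by apply: cvgMl.
apply: near_eq_cvg; near=> n.
have n0 : (0 < n)%N by near: n; exact: nbhs_infty_gt.
rewrite !lamE ?muln_gt0 ?m0 // natrM powRM // -mulf_div; congr (_ * _).
by rewrite mulfK // gt_eqF // powR_gt0 // ltr0n.
Unshelve. all: by end_near. Qed.

Hypothesis gam_gt : 1 / 2 < gam.
Hypothesis lam_gt0 : forall n, (0 < n)%N -> 0 < lam n.

Lemma regular_variation_doubling : exists rho c : R, [/\ rho < 1, 0 < c &
  \forall n \near \oo, [/\ (0 < n)%N, c * lam n <= lam (2 * n)%N &
    2 * lam (2 * n)%N ^+ 2 <= rho * lam n ^+ 2]].
Proof.
have ratio := cvg_regular_variation_ratio (ltn0Sn 1); set q := _ `^ _ in ratio.
have q0 : 0 < q by rewrite powR_gt0.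
have q2 : 2 * q ^+ 2 < 1.
  rewrite -powR_mulrn ?powR_ge0 // -powRrM -{1}(powRr1 (ler0n R 2)).
  rewrite -powRD ?pnatr_eq0 ?implybT //.
  rewrite /powR pnatr_eq0 /= -[ltRHS]expR0 ltr_expR pmulr_llt0 ?ln_gt0 ?ltr1n //.
  by move: gam_gt; lra.
have ratio_sqr : 2 * (lam (2 * n)%N / lam n) ^+ 2 @[n --> \oo] --> 2 * q ^+ 2.
  by apply: cvgMr; apply: cvgM.
exists ((1 + 2 * q ^+ 2) / 2), (q / 2); split; [lra|by rewrite divr_gt0|near=> n].
have n0 : (0 < n)%N by near: n; exact: nbhs_infty_gt.
have lam_n := lam_gt0 n0; split=> //.
  rewrite -ler_pdivlMr // ltW //; near: n; apply: (cvgr_gt q ratio).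
  by rewrite gtr_pMr // invf_lt1 ?ltr1n.
rewrite -ler_pdivrMr ?exprn_gt0 // -mulrA -expr_div_n ltW //.
by near: n; apply: (cvgr_lt _ ratio_sqr); lra.
Unshelve. all: by end_near. Qed.

Hypothesis lam_ni : forall m n, (0 < m)%N -> (m <= n)%N -> lam n <= lam m.
Hypothesis lam_sqr_cvg : cvgn (series (fun n => lam n ^+ 2)).

Lemma near_dyadic_regular : exists c C : R, [/\ 0 < c, 0 < C &
  \forall M \near \oo, dyadic_regular c C lam M].
Proof.
have [rho [c [rho1 c0 [N _ lam_double]]]] := regular_variation_doubling.
have N0 : (0 < N)%N by have [] := lam_double N (leqnn N).
exists c, (1 - rho)^-1; split; rewrite ?invr_gt0 ?subr_gt0 //.
exists N => // M NM; have [M0 cM _] := lam_double M NM.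
have lam_block m : (M <= m < M + M)%N -> c * lam M <= lam m.
  move=> /andP[Mm mM]; rewrite (le_trans cM) // lam_ni ?(leq_trans M0) //.
  by rewrite mul2n -addnn ltnW.
split=> //; apply/andP; split.
  apply: le_trans (sum_le_tailsum M (M + M) (fun n => sqr_ge0 (lam n)) lam_sqr_cvg).
  rewrite mulrCA -exprMn mulr_natl -[M in _ *+ M](addnK M) -sumr_const_nat.
  rewrite ler_sum_nat // => m mM; have clam : 0 <= c * lam M by rewrite mulr_ge0 ?ltW ?lam_gt0.
  by rewrite lerXn2r // ?nnegrE ?lam_block // (le_trans clam) ?lam_block.
apply: (cvgr_to_le (cvg_tailsum (M := M) lam_sqr_cvg)); apply: nearW => K.
apply: (@sum_halving_le _ _ _ N) => //.
- by move=> n; exact: sqr_ge0.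
- move=> m n Nm mn; have m0 := leq_trans N0 Nm.
  by rewrite lerXn2r ?nnegrE ?lam_ni // ltW ?lam_gt0 // (leq_trans m0).
- by move=> n /lam_double[].
Qed.

End regular_variation.

(** * Edgeworth distribution functions *)

Section edgeworth_cdf.
Context {R : realType} (n : nat) (c : nat -> R).
Local Notation mu := (@lebesgue_measure R).
Local Notation D := (`]0, +oo[%classic : set R).
Local Notation light := [pred k : {ffun 'I_n -> 'I_n.+1} | (weight k <= n)%N].
Implicit Types (x t : R) (k : {ffun 'I_n -> 'I_n.+1}).

Definition edgeworth_cdf x : R := std_normal_cdf x - std_normal_pdf x *
  \sum_(k : {ffun 'I_n -> 'I_n.+1} | (1 <= weight k <= n)%N)
    edgeworth_coef c k * hermite (edgeworth_degree k - 1) x.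

Let term k x t := edgeworth_coef c k *
  (fourier_integrand (fourier_monomial (edgeworth_degree k)) x t * gauss 1 t).

Let integrable_term k x : mu.-integrable D (EFin \o term k x).
Proof. by apply: integrableZl_EFin => //; exact: integrable_gauss_integral. Qed.

Let fourier_integrand_edgeworth x t : fourier_integrand (edgeworth_char_fun n c) x t =
  \sum_(k <- enum light) term k x t.
Proof.
rewrite fourier_integrandZ mulrC.
have -> : edgeworth_poly n c = fun s =>
    \sum_(k <- enum light) (edgeworth_coef c k)%:C * fourier_monomial (edgeworth_degree k) s.
  by apply/funext => s; rewrite edgeworth_polyE big_enum.
rewrite fourier_integrand_sum mulr_suml; apply: eq_bigr => k _.
by rewrite (fourier_integrandZ (fun=> edgeworth_coef c k)) -mulrA.
Qed.

Lemma integrable_edgeworth_char_fun x :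
  mu.-integrable D (EFin \o fourier_integrand (edgeworth_char_fun n c) x).
Proof.
rewrite (_ : EFin \o _ =
  fun t => (\sum_(k <- enum light) (term k x t)%:E)%E); last first.
  by apply/funext => t /=; rewrite fourier_integrand_edgeworth sumEFin.
by apply: integrable_sum => // k _; exact: integrable_term.
Qed.

Lemma integral_edgeworth_char_fun x :
  \int[mu]_(t in D) fourier_integrand (edgeworth_char_fun n c) x t =
  \sum_(k : {ffun 'I_n -> 'I_n.+1} | (weight k <= n)%N)
    edgeworth_coef c k * gauss_integral (edgeworth_degree k) 1 x.
Proof.
under eq_Rintegral do rewrite fourier_integrand_edgeworth.
rewrite Rintegral_sum // -[RHS]big_enum /=; apply: eq_bigr => k _.
by rewrite RintegralZl //; exact: integrable_gauss_integral.
Qed.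

Lemma continuous_integral_edgeworth_char_fun :
  continuous (fun x => \int[mu]_(t in D) fourier_integrand (edgeworth_char_fun n c) x t).
Proof.
under eq_fun do rewrite integral_edgeworth_char_fun.
apply: continuous_big => [|k _ x]; first exact: add_continuous.
apply: cvgMr; exact: is_derive_continuous (is_derive_gauss_integral _ x ltr01).
Qed.

Lemma weight_eq0 k : (weight k == 0%N) = (k == [ffun=> ord0]).
Proof.
apply/eqP/eqP => [/eqP|->]; last by rewrite /weight big1 // => i _; rewrite ffunE muln0.
rewrite sum_nat_eq0 => /forallP k0; apply/ffunP => i; rewrite ffunE; apply/val_inj.
by have := k0 i; rewrite muln_eq0 addn1 => /eqP.
Qed.

Lemma edgeworth_cdfE x : edgeworth_cdf x =
  2^-1 + pi^-1 * \int[mu]_(t in D) fourier_integrand (edgeworth_char_fun n c) x t.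
Proof.
have pi_neq0 : pi != 0 :> R by rewrite gt_eqF // pi_gt0.
pose k0 : {ffun 'I_n -> 'I_n.+1} := [ffun=> ord0].
have /eqP weight0 : weight k0 == 0%N by rewrite weight_eq0.
have degree0 : edgeworth_degree k0 = 0%N.
  by rewrite /edgeworth_degree big1 // => i _; rewrite ffunE muln0.
have coef0 : edgeworth_coef c k0 = 1.
  by rewrite /edgeworth_coef /exp_monomial big1 // => i _; rewrite ffunE expr0 fact0 divr1.
rewrite integral_edgeworth_char_fun (bigD1 k0) ?weight0 //= degree0 coef0 mul1r.
rewrite gauss_integral0E // invr1 mul1r mulrDr mulKf // addrA addrC [2^-1 + _]addrC subrK.
rewrite addrC /edgeworth_cdf; congr (_ + _); rewrite !mulr_sumr -sumrN.
apply: eq_big => k; first by rewrite -weight_eq0 -lt0n andbC.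
move=> /andP[weight_gt0 _]; have degree_gt0 := leq_trans weight_gt0 (weight_le_degree k).
rewrite -(prednK degree_gt0) subn1 /= gauss_integral_hermite.
by rewrite 2!mulrN [edgeworth_coef c k * (pi * _)]mulrCA mulKf // mulrCA.
Qed.

Lemma edgeworth_cdf_distance (d : measure_display) (T : measurableType d)
    (P : probability T R) (X : T -> R) (C : R) : P.-integrable setT (EFin \o X) ->
  (forall t, 0 < t ->
    normc (char_fun P X t - edgeworth_char_fun n c t) <= C * (t / (1 + t ^+ 2))) ->
  forall x, `|fine (P [set w | X w <= x]) - edgeworth_cdf x| <= C / 2.
Proof.
move=> iX char_fun_near x; rewrite edgeworth_cdfE.
have -> : C / 2 = pi^-1 * \int[mu]_(t in D) (C * (1 + t ^+ 2)^-1).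
  rewrite RintegralZl //; last exact: integrable_oneDsqrV.
  by rewrite Rintegral_oneDsqrV mulrCA mulKf // gt_eqF // pi_gt0.
apply: (cdf_fourier_distance iX).
- by move=> t t0; rewrite mulrCA; exact: char_fun_near.
- by apply: integrableZl_EFin => //; exact: integrable_oneDsqrV.
- exact: integrable_edgeworth_char_fun.
- exact: continuous_integral_edgeworth_char_fun.
Qed.

End edgeworth_cdf.

(** * Weighted series of centred gamma variables *)

Section gamma_series.
Context {R : realType} (d : measure_display) (T : measurableType d) (P : probability T R).
Variables (r : R) (eta : nat -> T -> R) (lam : nat -> R).
Hypotheses (r0 : 0 < r) (eta_indep : mutually_independent P eta).
Hypothesis eta_law : forall n, has_gamma_rr_law P r (eta n).

Definition centered n w := lam n * (eta n w - 1).

Let measurable_eta n : measurable_fun setT (eta n). Proof. by case: eta_indep => + _; exact. Qed.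

Let integrable_eta n : P.-integrable setT (EFin \o eta n).
Proof. exact: gamma_integrable r0 (measurable_eta n) (@eta_law n). Qed.

Let integrable_cst (c : R) : P.-integrable setT (EFin \o (fun=> c)).
Proof. exact: finite_measure_integrable_cst. Qed.

Let integrable_etaB n : P.-integrable setT (EFin \o (fun w => eta n w - 1)).
Proof. exact: (integrableB measurableT (integrable_eta n) (integrable_cst 1)). Qed.

Lemma centered_independent : mutually_independent P centered.
Proof.
apply: (mutually_independent_comp (g := fun n y => lam n * (y - 1)) eta_indep) => n.
by apply: measurable_funM => //; exact: measurable_funB.
Qed.

Lemma integrable_centered n : P.-integrable setT (EFin \o centered n).
Proof. exact: (integrableZl_EFin (lam n) measurableT (integrable_etaB n)). Qed.

Let centered_sqrE n w :
  centered n w ^+ 2 = lam n ^+ 2 * (eta n w ^+ 2 - (2 * (eta n w - 1) + 1)).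
Proof. by rewrite /centered; ring. Qed.

Let integrable_affine n : P.-integrable setT (EFin \o (fun w => 2 * (eta n w - 1) + 1)).
Proof.
exact: (integrableD measurableT
  (integrableZl_EFin 2 measurableT (integrable_etaB n)) (integrable_cst 1)).
Qed.

Let integrable_eta_sqr n : P.-integrable setT (EFin \o (fun w => eta n w ^+ 2)).
Proof. exact: (gamma_power_integrable r0 (measurable_eta n) (@eta_law n) 2). Qed.

Lemma integrable_centered_sqr n : P.-integrable setT (fun w => (centered n w ^+ 2)%:E).
Proof.
under eq_fun do rewrite centered_sqrE.
exact: (integrableZl_EFin (lam n ^+ 2) measurableT
  (integrableB measurableT (integrable_eta_sqr n) (integrable_affine n))).
Qed.

Let mean_etaB n : \int[P]_w (eta n w - 1) = 0.
Proof.
rewrite (RintegralB measurableT (integrable_eta n) (integrable_cst 1)) expectation_cst.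
by rewrite (gamma_mean r0 (measurable_eta n) (@eta_law n)) subrr.
Qed.

Lemma mean_centered n : \int[P]_w centered n w = 0.
Proof. by rewrite (RintegralZl _ measurableT (integrable_etaB n)) mean_etaB mulr0. Qed.

Lemma variance_centered n : \int[P]_w (centered n w ^+ 2) = lam n ^+ 2 / r.
Proof.
have affine_mean : \int[P]_w (2 * (eta n w - 1) + 1) = 1.
  rewrite (RintegralD measurableT
    (integrableZl_EFin 2 measurableT (integrable_etaB n)) (integrable_cst 1)).
  rewrite (RintegralZl _ measurableT (integrable_etaB n)) mean_etaB mulr0 add0r.
  exact: expectation_cst.
under eq_Rintegral do rewrite centered_sqrE.
have iS := integrableB measurableT (integrable_eta_sqr n) (integrable_affine n).
rewrite (RintegralZl _ measurableT iS).
rewrite (RintegralB measurableT (integrable_eta_sqr n) (integrable_affine n)) affine_mean.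
by rewrite (gamma_second_moment r0 (measurable_eta n) (@eta_law n)) addrAC subrr add0r.
Qed.

Lemma char_fun_centered n t : char_fun P (centered n) t =
  cexp (r%:C * (clog (lam n / r * t) - (lam n / r * t)%:C * 'i)).
Proof.
rewrite char_funZ char_funBr // (gamma_char_fun r0 (measurable_eta n) (@eta_law n)) -cexpD.
have -> : r^-1 * (t * lam n) = lam n / r * t by ring.
rewrite addrC mulrBr; congr (cexp (_ - _)); rewrite mulrA -rmorphM; congr (_%:C * _).
by rewrite mulr1; field; rewrite gt_eqF.
Qed.

Lemma char_fun_psum_centered s M K t : char_fun P (psum centered M K) (t * s) =
  gamma_cf r (fun n => s * (lam n / r)) M K t.
Proof.
rewrite (char_fun_psum centered_independent) /gamma_cf cexp_sum; apply: eq_bigr => n _.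
by rewrite char_fun_centered [t * s]mulrC mulrCA mulrA.
Qed.

Hypothesis lam_sqr_cvg : cvgn (series (fun n => lam n ^+ 2)).

Let variance_cvg : cvgn (series (fun n => lam n ^+ 2 / r)).
Proof.
have -> : (fun n => lam n ^+ 2 / r) = r^-1 *: (fun n => lam n ^+ 2).
  by apply/funext => n; rewrite mulrC.
exact: is_cvg_seriesZ.
Qed.

Lemma integrable_gamma_series s M :
  P.-integrable setT (EFin \o (fun w => s * series_lim centered M w)).
Proof.
apply: integrableZl_EFin => //.
exact: (integrable_series_lim centered_independent integrable_centered integrable_centered_sqr
  mean_centered variance_centered variance_cvg).
Qed.

Lemma ccvg_char_fun_gamma_series s M t :
  ccvg (fun K => gamma_cf r (fun n => s * (lam n / r)) M K t)
    (char_fun P (fun w => s * series_lim centered M w) t).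
Proof.
rewrite char_funZ; under eq_fun do rewrite -char_fun_psum_centered.
exact: (ccvg_char_fun_series centered_independent integrable_centered integrable_centered_sqr
  mean_centered variance_centered variance_cvg).
Qed.

End gamma_series.

Section standard_weights.
Context {R : realType} (r : R) (lam : nat -> R).
Hypotheses (r0 : 0 < r) (lam_gt0 : forall n, (0 < n)%N -> 0 < lam n).
Hypothesis lam_ni : forall m n, (0 < m)%N -> (m <= n)%N -> lam n <= lam m.
Hypothesis lam_sqr_cvg : cvgn (series (fun n => lam n ^+ 2)).

Definition series_sd M : R := Num.sqrt (r^-1 * tailsum M (fun n => lam n ^+ 2)).

Definition series_cumulant k M : R :=
  (k.-1)`!%:R / (r ^+ k.-1 * series_sd M ^+ k) * tailsum M (fun n => lam n ^+ k).

Definition standard_weights M n : R := (series_sd M)^-1 * (lam n / r).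

Section fixed_start.
Variables (c C : R) (M : nat).
Hypotheses (c0 : 0 < c) (C0 : 0 < C) (lam_regular : dyadic_regular c C lam M).
Local Notation S2 := (tailsum M (fun n => lam n ^+ 2)).

Let M0 : (0 < M)%N := regular_gt0 lam_regular.
Let S2_bounds := regular_tail lam_regular.

Let S2_gt0 : 0 < S2.
Proof.
have /andP[+ _] := S2_bounds; apply: lt_le_trans.
by rewrite !mulr_gt0 ?exprn_gt0 ?ltr0n ?lam_gt0.
Qed.

Lemma series_sd_gt0 : 0 < series_sd M.
Proof. by rewrite sqrtr_gt0 mulr_gt0 ?invr_gt0. Qed.

Lemma standard_weights_sqr n : standard_weights M n ^+ 2 = lam n ^+ 2 / (S2 * r).
Proof.
rewrite /standard_weights exprMn exprVn sqr_sqrtr ?mulr_ge0 ?invr_ge0 ?(ltW S2_gt0) ?(ltW r0) //.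
by field; rewrite !gt_eqF.
Qed.

Lemma standard_weights_sup : M%:R * standard_weights M M ^+ 2 <= (c ^+ 2 * r)^-1.
Proof.
have /andP[S2_ge _] := S2_bounds.
rewrite standard_weights_sqr mulrA ler_pdivrMr ?mulr_gt0 //.
rewrite ler_pdivlMl ?mulr_gt0 ?exprn_gt0 //.
by rewrite mulrAC ler_pM2r.
Qed.

Lemma normalized_standard_weights :
  normalized_weights r c (C * r)^-1 M (standard_weights M).
Proof.
have sd0 := series_sd_gt0; split.
- move=> m Mm; have lam_m := ltW (lam_gt0 (leq_trans M0 Mm)).
  rewrite /standard_weights mulr_ge0 ?divr_ge0 ?invr_ge0 ?(ltW sd0) ?(ltW r0) //=.
  by rewrite ler_wpM2l ?invr_ge0 ?(ltW sd0) // ler_wpM2r ?invr_ge0 ?(ltW r0) ?lam_ni.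
- move=> m /(regular_block lam_regular) lam_m.
  rewrite /standard_weights mulrCA ler_wpM2l ?invr_ge0 ?(ltW sd0) //.
  by rewrite mulrA ler_wpM2r ?invr_ge0 ?(ltW r0).
- have /andP[_ S2_le] := S2_bounds.
  rewrite standard_weights_sqr mulrA ler_pdivlMr ?mulr_gt0 // ler_pdivrMl ?mulr_gt0 //.
  by rewrite mulrAC ler_pM2r.
rewrite (_ : (fun K => _) = fun K => S2^-1 * \sum_(M <= n < K) lam n ^+ 2).
  by rewrite -(mulVf (lt0r_neq0 S2_gt0)); apply: cvgMr; exact: cvg_tailsum.
apply/funext => K; rewrite /power_sum; under eq_bigr do rewrite standard_weights_sqr.
by rewrite -mulr_suml; field; rewrite !gt_eqF.
Qed.

Lemma gamma_cumulant_standard_weights k : gamma_cumulant r (standard_weights M) M k.+2 =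
  series_cumulant k.+2 M / (k.+2)`!%:R.
Proof.
have lamE n : lam n ^+ k.+2 = (r * series_sd M) ^+ k.+2 * standard_weights M n ^+ k.+2.
  rewrite -exprMn; congr (_ ^+ _); rewrite /standard_weights.
  by field; rewrite !gt_eqF ?series_sd_gt0.
rewrite /series_cumulant; under [X in tailsum M X]eq_fun do rewrite lamE.
rewrite tailsumZ; last first.
  have Cr0 : 0 < (C * r)^-1 by rewrite invr_gt0 mulr_gt0.
  by apply/cvg_ex; eexists; exact: (cvg_sum_weights r0 Cr0 normalized_standard_weights).
rewrite /gamma_cumulant factS natrM exprMn [r ^+ k.+2]exprS /=.
have fact0 : (k.+1)`!%:R != 0 :> R by rewrite pnatr_eq0 -lt0n fact_gt0.
have k0 : k.+2%:R != 0 :> R by rewrite pnatr_eq0.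
have sdk0 := lt0r_neq0 (exprn_gt0 k.+2 series_sd_gt0).
have rk0 := lt0r_neq0 (exprn_gt0 k.+1 r0).
move: (tailsum _ _) (k.+1)`!%:R k.+2%:R (series_sd M ^+ _) (r ^+ _) fact0 k0 sdk0 rk0.
by move=> S f k' s rk f0 k0 s0 rk0; field; rewrite f0 k0 s0 rk0.
Qed.

End fixed_start.

End standard_weights.

Lemma exprn_le_powR {R : realType} (x y b : R) k : 0 <= x -> 0 < y -> y * x ^+ 2 <= b ->
  x ^+ k <= Num.sqrt b ^+ k * y `^ (- (k%:R / 2)).
Proof.
move=> x0 y0 yx; have b0 : 0 <= b by apply: le_trans yx; rewrite mulr_ge0 ?sqr_ge0 ?ltW.
have root0 : 0 <= Num.sqrt b * y `^ (- 2^-1) by rewrite mulr_ge0 ?sqrtr_ge0 ?powR_ge0.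
have -> : y `^ (- (k%:R / 2)) = y `^ (- 2^-1) ^+ k.
  by rewrite -(powR_mulrn k (powR_ge0 _ _)) -powRrM mulNr mulrC.
rewrite -exprMn lerXn2r ?nnegrE // -ler_sqr ?nnegrE // exprMn sqr_sqrtr //.
rewrite -(powR_mulrn 2 (powR_ge0 _ _)) -powRrM mulNr mulVf // powR_inv1 ?(ltW y0) //.
by rewrite ler_pdivlMr // mulrC.
Qed.

Section edgeworth_expansion.
Context {R : realType} (d : measure_display) (T : measurableType d) (P : probability T R).
Variables (r gam : R) (eta : nat -> T -> R) (l : R -> R) (lam : nat -> R).
Hypotheses (r0 : 0 < r) (eta_indep : mutually_independent P eta).
Hypothesis eta_law : forall n, has_gamma_rr_law P r (eta n).
Hypotheses (gam_gt : 1 / 2 < gam) (l_slow : slowly_varying l).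
Hypothesis lamE : forall n, (0 < n)%N -> lam n = l n%:R * n%:R `^ (- gam).
Hypothesis lam_gt0 : forall n, (0 < n)%N -> 0 < lam n.
Hypothesis lam_ni : forall m n, (0 < m)%N -> (m <= n)%N -> lam n <= lam m.
Hypothesis lam_sqr_cvg : cvgn (series (fun n => lam n ^+ 2)).

Local Notation sd := (series_sd r lam).
Local Notation kappa := (series_cumulant r lam).
Local Notation standardized M := (fun w => (sd M)^-1 * series_lim (centered eta lam) M w).

Lemma edgeworth_expansion n : exists C : R, \forall M \near \oo, forall x,
  `|fine (P [set w | standardized M w <= x]) -
    edgeworth_cdf n (fun i => kappa (i + 3)%N M / ((i + 3)`!)%:R) x| <=
  C * M%:R `^ (- (n.+1%:R / 2)).
Proof.
have [c [A [c0 A0 near_regular]]] :=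
  near_dyadic_regular l_slow lamE gam_gt lam_gt0 lam_ni lam_sqr_cvg.
have Ar0 : 0 < (A * r)^-1 by rewrite invr_gt0 mulr_gt0.
have [B B0 char_fun_bound] := edgeworth_char_fun_bound n r0 c0 Ar0.
pose b := (c ^+ 2 * r)^-1; have radius0 := @truncation_radius_gt0 R n.
exists (B / 2 * Num.sqrt b ^+ n.+1); near=> M; move=> x.
have lam_regular : dyadic_regular c A lam M by near: M; exact: near_regular.
have M_gt0 : 0 < M%:R :> R by rewrite ltr0n (regular_gt0 lam_regular).
pose a := standard_weights r lam M.
have a_normal := normalized_standard_weights r0 lam_gt0 lam_ni lam_sqr_cvg c0 A0 lam_regular.
have a_sup : M%:R * a M ^+ 2 <= b := standard_weights_sup r0 lam_gt0 c0 lam_regular.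
have a0 : 0 <= a M := ltW (sup_weight_gt0 Ar0 a_normal).
have rM : 1 <= r * M%:R / 2.
  rewrite ler_pdivlMr // mul1r -ler_pdivrMl //.
  by near: M; exact: nbhs_infty_ger.
have a_small : a M <= truncation_radius n.
  rewrite -ler_sqr ?nnegrE ?(ltW radius0) // -(ler_pM2l M_gt0) (le_trans a_sup) //.
  rewrite -ler_pdivrMr ?exprn_gt0 //.
  by near: M; exact: nbhs_infty_ger.
have kappaE : (fun i => kappa (i + 3)%N M / ((i + 3)`!)%:R) = fun i => gamma_cumulant r a M i.+3.
  apply/funext => i; rewrite addn3.
  by rewrite -(gamma_cumulant_standard_weights r0 lam_gt0 lam_ni lam_sqr_cvg c0 A0 lam_regular).
rewrite kappaE; apply: (le_trans (edgeworth_cdf_distance (C := B * a M ^+ n.+1) _ _ x)).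
- exact: (integrable_gamma_series r0 eta_indep eta_law lam_sqr_cvg).
- apply: (char_fun_bound _ _ _ a_normal) => // t.
  exact: (ccvg_char_fun_gamma_series r0 eta_indep eta_law lam_sqr_cvg).
rewrite mulrAC -[leRHS]mulrA ler_wpM2l ?divr_ge0 //.
exact: exprn_le_powR.
Unshelve. all: by end_near. Qed.

End edgeworth_expansion.

Theorem theorem5p2
  (R : realType) (d : measure_display) (T : measurableType d)
  (P : probability T R) (r : R) (hr : 0 < r)
  (eta : nat -> T -> R)
  (heta_indep : mutually_independent P eta)
  (heta_law : forall n : nat, has_gamma_rr_law P r (eta n))
  (gam : R) (hgam : 1 / 2 < gam)
  (l : R -> R) (hl : slowly_varying l)
  (lam : nat -> R)
  (hlam : forall n : nat, (0 < n)%N -> lam n = l n%:R * n%:R `^ (- gam))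
  (hlam_pos : forall n : nat, (0 < n)%N -> 0 < lam n)
  (hlam_noninc : forall m n : nat, (0 < m)%N -> (m <= n)%N -> lam n <= lam m)
  (hlam_norm : (fun K : nat => r^-1 * \sum_(1 <= n < K) lam n ^+ 2) @ \oo --> (1 : R))
  (N : nat) (hN : (2 <= N)%N) :
  let sigma (M : nat) : R := Num.sqrt (r^-1 * tailsum M (fun n => lam n ^+ 2)) in
  let Ytilde (M : nat) (w : T) : R :=
    (sigma M)^-1 * tailsum M (fun n => lam n * (eta n w - 1)) in
  let kappa (k M : nat) : R :=
    (k.-1)`!%:R / (r ^+ k.-1 * sigma M ^+ k) * tailsum M (fun n => lam n ^+ k) in
  exists C : R, exists M0 : nat, forall M : nat, (M0 <= M)%N -> forall x : R,
    `| fine (P [set w | Ytilde M w <= x]) -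
       (std_normal_cdf x - std_normal_pdf x *
          \sum_(k : {ffun 'I_(N - 2) -> 'I_(N - 1)} |
                  (1 <= \sum_(i < N - 2) (i + 1) * k i <= N - 2)%N)
            ((\prod_(i < N - 2)
                (((k i)`!%:R)^-1 * (kappa (i + 3)%N M / ((i + 3)`!)%:R) ^+ k i))
             * hermite (\sum_(i < N - 2) (i + 3) * k i - 1)%N x)) |
    <= C * M%:R `^ (- ((N%:R - 1) / 2)).
Proof.
move=> sigma Ytilde kappa; case: N hN => [//|[//|n]] _.
rewrite (_ : n.+2 - 2 = n)%N ?subn2 // (_ : n.+2 - 1 = n.+1)%N ?subn1 //.
have lam_sqr_cvg : cvgn (series (fun n => lam n ^+ 2)).
  rewrite -(is_cvg_series_restrict 1); apply/cvg_ex; exists (r * 1).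
  rewrite (_ : (fun K => _) = fun K => r * (r^-1 * \sum_(1 <= n < K) lam n ^+ 2)).
    exact: cvgMr.
  by apply/funext => K; rewrite mulVKf // gt_eqF.
have [C [M0 _ expansion]] := edgeworth_expansion hr heta_indep heta_law hgam hl hlam
  hlam_pos hlam_noninc lam_sqr_cvg n.
exists C, M0 => M MM0 x.
have -> : (n.+2%:R - 1) / 2 = n.+1%:R / 2 :> R by rewrite -natr1 addrK.
under eq_bigr => k _ do under eq_bigr => i _ do rewrite mulrC.
exact: expansion.
Qed.
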